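(* Let $x_0\ge 0$ be deterministic, and let $G,g\colon[0,\infty)\to\mathbb{R}$ be of class $\mathcal{C}^2$ with bounded first and second order derivatives and $G(0)=g(0)=0$. Let $(X(t))_{t\ge 0}$ be the solution, with values in $[0,\infty)$, of the It\^o stochastic differential equation $$\mathrm{d}X(t)=G(X(t))\,\mathrm{d}t+g(X(t))\,\mathrm{d}B(t),\qquad X(0)=x_0,$$ and, for $T\in(0,\infty)$, $N\in\mathbb{N}$ and $\tau=T/N$, let $(X_n)_{0\le n\le N}$ be defined by $X_0=x_0$ and, for $n\in\{0,\ldots,N-1\}$, $$X_{n+1}=\exp\Bigl(F(X_n)\tau+f(X_n)\delta B_n+\tfrac12 (f'g)(X_n)\bigl[\delta B_n^2-\tau\bigr]-\tfrac12 f(X_n)^2\tau\Bigr)X_n .$$ (i) For all $\varepsilon\in(0,1)$, $T\in(0,\infty)$ and $p\in[1,\infty)$, there exist $C_{\varepsilon,p}(T,x_0)\in(0,\infty)$ and $\tau_p\in(0,1)$ such that for any time-step size $\tau=T/N$, with $N\in\mathbb{N}$, which satisfies $\tau\le\tau_p$, one has $$\Bigl(\mathbb{E}\bigl[\sup_{0\le n\le N}|X_n-X(t_n)|^{2p}\bigr]\Bigr)^{\frac{1}{2p}}\le C_{\varepsilon,p}(T,x_0)\,\tau^{1-\varepsilon}.$$ (ii) Moreover, for all $\varepsilon\in(0,1)$ and $T\in(0,\infty)$, there exists an almost surely finite random variable $\mathcal{M}_\varepsilon(T,x_0)$ such that, almost surely, for all $N\in\mathbb{N}$, with $\tau=T/N$,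 $$\sup_{0\le n\le N}|X_n-X(t_n)|\le \mathcal{M}_\varepsilon(T,x_0)\,\tau^{1-\varepsilon}.$$
   Context: $(\Omega,\mathcal{F},\mathbb{P})$ is a probability space equipped with a filtration $(\mathcal{F}_t)_{t\ge 0}$, and $(B(t))_{t\ge 0}$ is a standard real-valued $(\mathcal{F}_t)$-Wiener process. $\mathbb{N}$ denotes the positive integers. For $T\in(0,\infty)$ and $N\in\mathbb{N}$: $\tau=T/N$, $t_n=n\tau$, $\delta B_n=B(t_{n+1})-B(t_n)$ (so $X_n$, $t_n$ and $\delta B_n$ depend on $N$). The functions $F,f\colon[0,\infty)\to\mathbb{R}$ are defined by $F(x)=\int_0^1 G'(\theta x)\,\mathrm{d}\theta$ and $f(x)=\int_0^1 g'(\theta x)\,\mathrm{d}\theta$, so that $G(x)=xF(x)$ and $g(x)=xf(x)$; they are of class $\mathcal{C}^1$. $(f'g)(x)=f'(x)g(x)$. Constants may depend on $G$ and $g$ but not on $N$; the random variable $\mathcal{M}_\varepsilon(T,x_0)$ does not depend on $N$. *)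

(* Defs.v *)
From HB Require Import structures.
From mathcomp Require Import all_boot all_order all_algebra.
From mathcomp Require Import all_classical all_reals all_analysis.
From mathcomp Require Import measurable_realfun.

Set Implicit Arguments.
Unset Strict Implicit.
Unset Printing Implicit Defensive.

Import Order.TTheory GRing.Theory Num.Theory.
Import numFieldNormedType.Exports.

Local Open Scope classical_set_scope.
Local Open Scope ring_scope.

(* Functions on [0, +oo[ are encoded as functions R -> R of which only the
   values on [0, +oo[ are ever used: the derivative below only looks at points
   y >= 0, hence is one-sided at x = 0. *)
Section HalfLine.
Context {R : realType}.
Implicit Types (h : R -> R) (x : R).

Definition hl_slope h x : R -> R := fun y => (h y - h x) / (y - x).

Definition hl_derivable h x : Prop :=
  cvg (hl_slope h x @ within [set y | 0 <= y] (x^')).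

Definition hl_derive h x : R :=
  lim (hl_slope h x @ within [set y | 0 <= y] (x^')).

Definition hl_C1 h : Prop :=
  (forall x, 0 <= x -> hl_derivable h x) /\
  {within `[0, +oo[, continuous (hl_derive h)}.

Definition hl_C2 h : Prop := hl_C1 h /\ hl_C1 (hl_derive h).

Definition hl_bounded h : Prop :=
  exists M : R, forall x, 0 <= x -> `|h x| <= M.

(* h x = x * hl_quot h x for x >= 0 when h is hl_C1 and h 0 = 0. *)
Definition hl_quot h x : R :=
  \int[lebesgue_measure]_(theta in `[0, 1]) hl_derive h (theta * x).

End HalfLine.

(* Continuous-time processes are indexed by R, and only the times t >= 0
   matter.  The filtration is not assumed to be complete or right-continuous. *)
Section StochasticCalculus.
Context d (Omega : measurableType d) (R : realType) (P : probability Omega R).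
Implicit Types (Ft : R -> set (set Omega)) (B H I X : R -> Omega -> R).

Definition is_filtration Ft : Prop :=
  [/\ forall t : R, 0 <= t -> sigma_algebra setT (Ft t),
      forall t : R, 0 <= t -> Ft t `<=` measurable &
      forall s t : R, 0 <= s -> s <= t -> Ft s `<=` Ft t].

Definition measurable_wrt (F : set (set Omega)) (Y : Omega -> R) : Prop :=
  forall C : set R, measurable C -> F (Y @^-1` C).

Definition adapted Ft X : Prop :=
  forall t : R, 0 <= t -> measurable_wrt (Ft t) (X t).

Definition continuous_paths X : Prop :=
  {ae P, forall w, {within `[0, +oo[, continuous (fun t => X t w)}}.

Definition increment B (s t : R) (w : Omega) : R := B t w - B s w.

Record is_wiener Ft B : Prop := IsWiener {
  wiener_adapted : adapted Ft B ;
  wiener_continuous : continuous_paths B ;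
  wiener0 : {ae P, forall w, B 0 w = 0} ;
  wiener_normal : forall s t : R, 0 <= s -> s < t ->
    forall C : set R, measurable C ->
      P (increment B s t @^-1` C) = normal_prob 0 (Num.sqrt (t - s)) C ;
  wiener_indep : forall s t : R, 0 <= s -> s < t ->
    forall (A : set Omega) (C : set R), Ft s A -> measurable C ->
      P (A `&` increment B s t @^-1` C) =
      (P A * P (increment B s t @^-1` C))%E }.

(* The outer measure associated with P is used so that no measurability of the
   Y k is needed; it coincides with P on measurable sets. *)
Definition cvg0_in_probability (Y : nat -> Omega -> \bar R) : Prop :=
  forall delta : R, 0 < delta ->
    (fun k => mu_ext P [set w | (delta%:E < Y k w)%E]) @ \oo --> 0%E.

(* sum_(i < sp_size) sp_coef i * 1_(]sp_time i, sp_time i.+1]) *)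
Record simple_process Ft := SimpleProcess {
  sp_size : nat ;
  sp_time : nat -> R ;
  sp_coef : nat -> Omega -> R ;
  sp_time_ge0 : 0 <= sp_time 0 ;
  sp_time_le : forall i, sp_time i <= sp_time i.+1 ;
  sp_coef_measurable : forall i, measurable_wrt (Ft (sp_time i)) (sp_coef i) ;
  sp_coef_bounded : forall i, exists M : R, forall w, `|sp_coef i w| <= M }.

Definition sp_val Ft (S : simple_process Ft) (t : R) (w : Omega) : R :=
  \sum_(i < sp_size S)
    sp_coef S i w * \1_(`]sp_time S i, sp_time S i.+1]) t.

Definition sp_integral Ft B (S : simple_process Ft) (t : R) (w : Omega) : R :=
  \sum_(i < sp_size S) sp_coef S i w *
    (B (Num.min t (sp_time S i.+1)) w - B (Num.min t (sp_time S i)) w).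

(* I is (a version with continuous paths of) the Ito integral process of H with
   respect to B: it is the limit in probability of the integrals of simple
   processes S k such that, for all t, the integral over [0, t] of |S k - H|^2
   tends to 0 in probability.  This determines I up to indistinguishability, and
   forces H to be almost surely square integrable on each [0, t]. *)
Definition is_ito_integral Ft B H I : Prop :=
  [/\ {ae P, forall w, forall t : R, 0 <= t ->
         measurable_fun (`[0, t] : set R) (H ^~ w)},
      continuous_paths I &
      exists S : nat -> simple_process Ft, forall t : R, 0 <= t ->
        cvg0_in_probability (fun k w =>
          \int[lebesgue_measure]_(s in `[0%R, t])
            ((sp_val (S k) s w - H s w) ^+ 2)%:E)%E /\
        cvg0_in_probability (fun k w =>
          `|sp_integral B (S k) t w - I t w|%:E)].

(* X is a solution with values in [0, +oo[ of
     dX(t) = G(X(t)) dt + g(X(t)) dB(t), X(0) = x0,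
   for coefficients that are continuous on [0, +oo[. *)
Record is_sde_solution Ft B (G g : R -> R) (x0 : R) X : Prop := IsSdeSolution {
  sde_ge0 : forall t w, 0 <= t -> 0 <= X t w ;
  sde_adapted : adapted Ft X ;
  sde_continuous : continuous_paths X ;
  sde_eq : exists I, is_ito_integral Ft B (fun t w => g (X t w)) I /\
    {ae P, forall w, forall t : R, 0 <= t ->
      X t w = x0 + \int[lebesgue_measure]_(s in `[0, t]) G (X s w) + I t w} }.

End StochasticCalculus.

Section Scheme.
Context {Omega : Type} {R : realType}.
Variables (G g : R -> R) (B : R -> Omega -> R) (x0 : R).

Definition scheme_step (tau dB x : R) : R :=
  let F := hl_quot G in
  let f := hl_quot g in
  expR (F x * tau + f x * dB
        + 2^-1 * (hl_derive f x * g x) * (dB ^+ 2 - tau)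
        - 2^-1 * f x ^+ 2 * tau) * x.

Fixpoint scheme (tau : R) (n : nat) (w : Omega) : R :=
  if n is m.+1 then
    scheme_step tau (B (m.+1%:R * tau) w - B (m%:R * tau) w) (scheme tau m w)
  else x0.

Definition sup_error (X : R -> Omega -> R) (T : R) (N : nat) (w : Omega) : R :=
  let tau := T / N%:R in
  \big[Num.max/0]_(n < N.+1) `|scheme tau n w - X (n%:R * tau) w|.

End Scheme.

(* Main.v *)
Require Import Defs.
From HB Require Import structures.
From mathcomp Require Import all_boot all_order all_algebra.
From mathcomp Require Import all_classical all_reals all_analysis.
From mathcomp Require Import measurable_realfun.
From mathcomp Require Import ring lra.

Import Order.TTheory GRing.Theory Num.Theory.
Import numFieldNormedType.Exports.

Set Implicit Arguments.
Unset Strict Implicit.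
Unset Printing Implicit Defensive.

Local Open Scope classical_set_scope.
Local Open Scope ring_scope.

(** Neither the Ito formula nor a martingale inequality for continuous time is used. Write m = 2q+2
    for an even exponent and h for the step.

    The engine is [one_step]. Suppose an error e receives a h + b dB + c (dB^2 - h) + r, where dB is
    Gaussian and independent of e and of the coefficients. The term in b is odd in dB, the factor
    dB^2 - h is centred, and r is of order h^(3/2) with an even part of order h^2. Hence E e^m grows
    by at most C h times the m-th moments of e, a, b, sqrt(h) c and of the rescaled remainder. When
    these are dominated by e plus a source term, Gronwall concludes ([wiener_step], [le_erec]).

    The coefficients are extended to the whole line by [hl_ext]. With G = x F, g = x f and f' g =
    (g' - f) f, expanding the exponential reproduces the Milstein increment G h + g dB + (1/2) g g'
    (dB^2 - h) up to such a remainder ([erem_bounds]). So the exponential scheme is compared with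
    the Milstein scheme ([esch_mil]), and the latter with the solution.

    The obstacle in both comparisons is that [milc], that is g g' / 2, is not controlled by a global
    Lipschitz constant. [first_pass] uses its linear growth and yields order one half; [second_pass]
    feeds that order, for the exponent 2m, into the local Lipschitz bound and reaches order one.

    For the Milstein scheme and the solution, the steps 2h and h are compared ([mil_double_step],
    [mil_refine1]). The successive halvings add up geometrically, so the distance between the steps
    h and h / 2^k is O(h) in every even moment, uniformly in k ([mil_refine]). Moreover the scheme
    converges in probability to X ([mil_sde_probability]): X satisfies the Euler recursion up to a
    defect that is uniformly small on the grid in probability ([ito_riemann]), by a discrete
    Lenglart inequality ([lenglart]). A Fatou argument lets k tend to infinity ([mil_sde]).

    Finally the maximum over the grid is bounded by the sum over its points, which costs one power
    of the step in the m-th moment. A large m makes this loss smaller than epsilon, and a still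
    larger one makes the scaled moments summable over the number of steps, which gives the almost
    sure bound. *)

(** * Integration against a measure with a density *)

Section Density.
Local Open Scope ereal_scope.
Context d (T : measurableType d) (R : realType).
Variables (mu nu : {measure set T -> \bar R}) (h : T -> R).
Hypotheses (mh : measurable_fun setT h) (h0 : forall x, (0 <= h x)%R).
Hypothesis nuE : forall A, measurable A -> nu A = \int[mu]_(x in A) (h x)%:E.

Import HBNNSimple.

(** Approximation from below by simple functions: on an indicator the identity is [nuE], and
    monotone convergence applies on both sides. *)
Lemma ge0_integral_density (f : T -> \bar R) : measurable_fun setT f ->
  (forall x, 0 <= f x) -> \int[nu]_x f x = \int[mu]_x (f x * (h x)%:E).
Proof.
move=> mf f0; pose f_ := nnsfun_approx measurableT mf.
transitivity (limn (fun n => \int[nu]_x (f_ n x)%:E)).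
  rewrite -monotone_convergence//=.
  - apply: eq_integral => x _; apply/esym/cvg_lim => //=.
    by apply: cvg_nnsfun_approx => // *; exact: f0.
  - by move=> n; exact/measurable_EFinP/measurable_funP.
  - by move=> n x _; rewrite lee_fin.
  - by move=> x _ a b ab; rewrite lee_fin; exact/lefP/nd_nnsfun_approx.
rewrite (_ : \int[mu]_x _ = limn (fun n => \int[mu]_x ((f_ n x)%:E * (h x)%:E))).
  congr (limn _); apply/funext => n.
  transitivity (\sum_(k \in range (f_ n))
      \int[nu]_x (k * \1_(f_ n @^-1` [set k]) x)%:E).
    under eq_integral do rewrite fimfunE -fsumEFin//.
    rewrite ge0_integral_fsum//.
    - by move=> y; exact/measurable_EFinP/measurable_funM.
    - by move=> y x _; rewrite nnfun_muleindic_ge0.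
  transitivity (\sum_(k \in range (f_ n))
      \int[mu]_x ((k * \1_(f_ n @^-1` [set k]) x)%:E * (h x)%:E)).
    apply: eq_fsbigr => r _; rewrite integralZl_indic_nnsfun// integral_indic//=.
    rewrite setIT nuE// [in LHS]integral_mkcond/=.
    (* A negative value is not taken by the nonnegative [f_ n], so its preimage is empty; otherwise
       the factor r can be moved into the integral. *)
    have [r0|r0] := ltP r 0%R.
      rewrite preimage_nnfun0//= patch_set0 integral0 mule0.
      rewrite integral0_eq// => x _.
      by rewrite indic0 /= mulr0 mul0e.
    rewrite -ge0_integralZl//=.
    - apply: eq_integral => x _; rewrite patchE indicE.
      by case: ifP => _; rewrite ?mulr1 ?mulr0 ?mule0 ?mul0e.
    - apply/(measurable_restrictT _ _).1 => //.
      by apply: measurable_funTS; exact/measurable_EFinP.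
    - by move=> x _; apply: erestrict_ge0 => y _; rewrite lee_fin.
  rewrite -ge0_integral_fsum//.
  - apply: eq_integral => x _; rewrite -ge0_mule_fsuml.
      by rewrite fsumEFin// -fimfunE.
    by move=> r; rewrite nnfun_muleindic_ge0.
  - move=> r; apply: emeasurable_funM; apply/measurable_EFinP => //.
    exact: measurable_funM.
  - by move=> r x _; rewrite mule_ge0// ?nnfun_muleindic_ge0// lee_fin.
rewrite -monotone_convergence//=.
- apply: eq_integral => x _; apply/esym/cvg_lim => //=.
  apply: cvgeMr => //.
  by apply: cvg_nnsfun_approx => // *; exact: f0.
- move=> n; apply: emeasurable_funM; apply/measurable_EFinP => //.
- by move=> n x _; rewrite mule_ge0// lee_fin.
- by move=> x _ a b ab; rewrite lee_wpmul2r// lee_fin//; exact/lefP/nd_nnsfun_approx.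
Qed.

End Density.

(** * Exponential and quadratic Gaussian moments *)

Section Gaussian.
Context {R : realType}.
Implicit Types s : R.
Local Notation mu := (@lebesgue_measure R).

Lemma integral_normal_prob s (f : R -> \bar R) : measurable_fun setT f ->
  (forall x, 0 <= f x)%E ->
  (\int[normal_prob 0 s]_x f x = \int[mu]_x (f x * (normal_pdf 0 s x)%:E))%E.
Proof.
move=> mf f0; apply: ge0_integral_density => //.
- exact: measurable_normal_pdf.
- exact: normal_pdf_ge0.
Qed.

Lemma normal_probN s (C : set R) : s != 0 -> measurable C ->
  normal_prob 0 s (-%R @^-1` C) = normal_prob 0 s C.
Proof.
move=> s0 mC; rewrite /normal_prob.
have mpdf : measurable_fun setT (EFin \o normal_pdf 0 s).
  by apply/measurable_EFinP; exact: measurable_normal_pdf.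
have mN : measurable_fun setT (-%R : R -> measurableTypeR R) by exact: oppr_measurable.
transitivity (\int[pushforward mu (-%R : R -> measurableTypeR R)]_(x in C)
    (normal_pdf 0 s x)%:E)%E.
  rewrite ge0_integral_pushforward//.
  - apply: eq_integral => x _ /=; congr (_%:E).
    by rewrite !normal_pdfE// /normal_fun !subr0 sqrrN.
  - exact: measurable_funS mpdf.
  - by move=> x _; rewrite lee_fin normal_pdf_ge0.
by apply: eq_measure_integral => A mA _; exact: lebesgue_measureN.
Qed.

(** The exponential turns the density of variance s^2 into r / s times the density of variance r^2,
    whose mass is one. Both signs of the exponent are covered, according to r > s or r < s. *)
Lemma integral_normal_exp (s r : R) : 0 < s -> 0 < r ->
  (\int[normal_prob 0 s]_x
     (expR (((s ^+ 2 *+ 2)^-1 - (r ^+ 2 *+ 2)^-1) * x ^+ 2))%:E = (r / s)%:E)%E.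
Proof.
move=> s0 r0; rewrite integral_normal_prob; last 2 first.
- apply/measurable_EFinP; apply: measurableT_comp => //.
  by apply: measurable_funM => //; exact: measurable_funX.
- by move=> x; rewrite lee_fin expR_ge0.
transitivity (\int[mu]_x ((r / s)%:E * (normal_pdf 0 r x)%:E))%E.
  apply: eq_integral => x _; rewrite -!EFinM; congr (_%:E).
  rewrite !normal_pdfE ?gt_eqF// /normal_fun !subr0 mulrCA -expRD.
  rewrite [X in expR X](_ : _ = - x ^+ 2 / (r ^+ 2 *+ 2)); last ring.
  rewrite mulrA; congr (_ * _).
  rewrite /normal_peak -!mulrnAr (sqrtrM _ (sqr_ge0 s)) (sqrtrM _ (sqr_ge0 r)).
  rewrite !sqrtr_sqr !gtr0_norm//.
  have p0 : Num.sqrt (pi *+ 2) != 0 :> R by rewrite gt_eqF// sqrtr_gt0 mulrn_wgt0// pi_gt0.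
  by field; rewrite p0 !gt_eqF.
rewrite ge0_integralZl//.
- by rewrite integral_normal_pdf mule1.
- by apply/measurable_EFinP; exact: measurable_normal_pdf.
- by move=> x _; rewrite lee_fin normal_pdf_ge0.
- by rewrite lee_fin divr_ge0// ltW.
Qed.


(** The case r = sqrt 2 * s. This weight later absorbs the powers of the increment and the
    remainders. *)
Lemma integral_normal_exp4 s : 0 < s ->
  (\int[normal_prob 0 s]_x (expR (x ^+ 2 / (4 * s ^+ 2)))%:E = (Num.sqrt 2)%:E)%E.
Proof.
move=> s0; have s20 : 0 < Num.sqrt 2 :> R by rewrite sqrtr_gt0.
rewrite -[in RHS](mulfK (lt0r_neq0 s0) (Num.sqrt 2)).
rewrite -(integral_normal_exp s0 (mulr_gt0 s20 s0)).
apply: eq_integral => x _; congr (expR _)%:E; rewrite exprMn sqr_sqrtr//.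
by field; rewrite gt_eqF.
Qed.


End Gaussian.

Section Gaussian.
Context {R : realType}.
Implicit Types s : R.
(** The second moment is the derivative at 0 of the mean of exp(t x^2). It is reached without
    differentiating: 1 + t x^2 <= exp(t x^2) is integrated for small t of either sign, that is for r
    = s + e and r = s - e, and e is taken small. *)
Lemma integral_normal_sqr s : 0 < s ->
  (\int[normal_prob 0 s]_x (x ^+ 2)%:E = (s ^+ 2)%:E)%E.
Proof.
move=> s0; set V := LHS.
have V0 : (0 <= V)%E by apply: integral_ge0 => x _; rewrite lee_fin sqr_ge0.
have mX2 : measurable_fun setT (fun x : R => (x ^+ 2)%:E).
  by apply/measurable_EFinP; exact: measurable_funX.
have mexp (c : R) : measurable_fun setT (fun x : R => (expR (c * x ^+ 2))%:E).
  apply/measurable_EFinP; apply: measurableT_comp => //.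
  by apply: measurable_funM => //; exact: measurable_funX.
pose t r : R := (s ^+ 2 *+ 2)^-1 - (r ^+ 2 *+ 2)^-1.
have int1 : (\int[normal_prob 0 s]_x 1 = 1)%E.
  by rewrite integral_cst// mul1e; exact: (@probability_setT _ _ _ (normal_prob 0 s)).
have cV c : 0 <= c ->
    (\int[normal_prob 0 s]_x (1 + c%:E * (x ^+ 2)%:E) = 1 + c%:E * V)%E.
  move=> c0; rewrite ge0_integralD//.
  - by rewrite int1 ge0_integralZl// => x _; rewrite lee_fin sqr_ge0.
  - by move=> x _; rewrite mule_ge0// lee_fin// sqr_ge0.
  - by apply: emeasurable_funM.
have up r : s < r -> (1 + (t r)%:E * V <= (r / s)%:E)%E.
  move=> sr; have r0 : 0 < r := lt_trans s0 sr.
  have t0 : 0 <= t r.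
    by rewrite subr_ge0 lef_pV2 ?posrE ?mulrn_wgt0 ?exprn_gt0// lerMn2r /= ler_pXn2r ?nnegrE// ltW.
  rewrite -cV// -integral_normal_exp//; apply: ge0_le_integral => //.
  - by move=> x _; rewrite -EFinM -EFinD lee_fin addr_ge0// mulr_ge0 ?sqr_ge0.
  - by apply: emeasurable_funD => //; exact: emeasurable_funM.
  - exact: mexp.
  - by move=> x _; rewrite -EFinM -EFinD lee_fin expR_ge1Dx.
have dn r : 0 < r -> r < s -> (1 <= (r / s)%:E + (- t r)%:E * V)%E.
  move=> r0 rs.
  have t0 : 0 <= - t r.
    by rewrite oppr_ge0 subr_le0 lef_pV2 ?posrE ?mulrn_wgt0 ?exprn_gt0// lerMn2r /= ler_pXn2r ?nnegrE// ltW.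
  rewrite -(integral_normal_exp s0 r0) -ge0_integralZl//; last by move=> x _; rewrite lee_fin sqr_ge0.
  rewrite -ge0_integralD//; last 3 first.
  - exact: mexp.
  - by move=> x _; rewrite mule_ge0// lee_fin// sqr_ge0.
  - by apply: emeasurable_funM.
  rewrite -[leLHS]int1.
  apply: ge0_le_integral => //.
  - by apply: emeasurable_funD => //; [exact: mexp|exact: emeasurable_funM].
  - move=> x _; rewrite -EFinM -EFinD lee_fin; have := expR_ge1Dx (t r * x ^+ 2).
    by rewrite /t; lra.
have Vfin : V \is a fin_num.
  rewrite ge0_fin_numE//; have s2 : s < 2 * s by lra.
  have t0 : 0 < t (2 * s).
    by rewrite subr_gt0 ltf_pV2 ?posrE ?mulrn_wgt0 ?exprn_gt0 ?mulr_gt0// ltrMn2r /= ltr_pXn2r ?nnegrE// ltW// mulr_gt0.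
  have := up _ s2; rewrite ltey; apply: contraTN => /eqP ->.
  by rewrite gt0_muley ?lte_fin// -ltNge addey// ltry.
move: up dn V0; rewrite -(fineK Vfin) lee_fin; set v := fine V => up dn v0.
have {}up e : 0 < e -> (2 * s + e) * v <= 2 * s * (s + e) ^+ 2.
  move=> e0; have := up (s + e); rewrite ltrDl => /(_ e0).
  rewrite -EFinM -EFinD lee_fin /t => h.
  have -> : (2 * s + e) * v = (1 + ((s ^+ 2 *+ 2)^-1 - ((s + e) ^+ 2 *+ 2)^-1) * v - 1)
        * (2 * s ^+ 2 * (s + e) ^+ 2) / e.
    by field; rewrite !gt_eqF//= ?mulrn_wgt0// ?exprn_gt0// addr_gt0.
  rewrite ler_pdivrMr//; have -> : 2 * s * (s + e) ^+ 2 * e = ((s + e) / s - 1) * (2 * s ^+ 2 * (s + e) ^+ 2).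
    by field; rewrite gt_eqF.
  by rewrite ler_wpM2r ?lerD2r ?lerD2l ?lerN2 ?mulr_ge0 ?sqr_ge0//; lra.
have {}dn e : 0 < e -> e < s -> 2 * s * (s - e) ^+ 2 <= (2 * s - e) * v.
  move=> e0 es; have se : 0 < s - e by rewrite subr_gt0.
  have := dn (s - e) se; rewrite gtrBl => /(_ e0).
  rewrite -EFinM -EFinD lee_fin /t => h.
  have -> : (2 * s - e) * v = ((s - e) / s + - ((s ^+ 2 *+ 2)^-1 - ((s - e) ^+ 2 *+ 2)^-1) * v - (s - e) / s)
        * (2 * s ^+ 2 * (s - e) ^+ 2) / e.
    by field; rewrite !gt_eqF//= ?mulrn_wgt0// ?exprn_gt0.
  rewrite ler_pdivlMr//; have -> : 2 * s * (s - e) ^+ 2 * e = (1 - (s - e) / s) * (2 * s ^+ 2 * (s - e) ^+ 2).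
    by field; rewrite gt_eqF.
  by rewrite ler_wpM2r ?lerD2r ?lerD2l ?lerN2 ?mulr_ge0 ?sqr_ge0//; lra.
congr (_%:E); apply/eqP; rewrite eq_le; apply/andP; split; rewrite leNgt; apply/negP => vs.
(* With e <= s, [up] would give 2 s (v - s^2) <= 5 s^2 e, against 5 s e <= v - s^2. The other half
   uses [dn] in the same way. *)
- pose e := Num.min s ((v - s ^+ 2) / (5 * s)).
  have e0 : 0 < e by rewrite lt_min s0 divr_gt0 ?subr_gt0// mulr_gt0.
  have es : e <= s by rewrite ge_min lexx.
  have ed : 5 * s * e <= v - s ^+ 2.
    by rewrite mulrC -ler_pdivlMr ?mulr_gt0// ge_min lexx orbT.
  have := up _ e0; move: vs; nra.
- pose e := Num.min (s / 2) ((s ^+ 2 - v) / (4 * s)).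
  have e0 : 0 < e by rewrite lt_min !divr_gt0 ?subr_gt0// mulr_gt0.
  have es : e <= s / 2 by rewrite ge_min lexx.
  have ed : 4 * s * e <= s ^+ 2 - v.
    by rewrite mulrC -ler_pdivlMr ?mulr_gt0// ge_min lexx orbT.
  have es' : e < s by lra.
  have := dn _ e0 es'; move: vs; nra.
Qed.

End Gaussian.

(** * Elementary inequalities between powers *)

Section Powers.
Context {R : realType}.
Implicit Types (e d x y : R) (m n : nat).

(** Young's inequality with crude constants: the larger of x and y carries the whole product. *)
Lemma pow_mix (x y : R) m n : 0 <= x -> 0 <= y ->
  x ^+ m * y ^+ n <= x ^+ (m + n) + y ^+ (m + n).
Proof.
move=> x0 y0; rewrite !exprD; have [xy|/ltW yx] := leP x y.
  apply: (@le_trans _ _ (y ^+ m * y ^+ n)).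
    by rewrite ler_wpM2r ?exprn_ge0// lerXn2r ?nnegrE.
  by rewrite lerDr mulr_ge0// exprn_ge0.
apply: (@le_trans _ _ (x ^+ m * x ^+ n)).
  by rewrite ler_wpM2l ?exprn_ge0// lerXn2r ?nnegrE.
by rewrite lerDl mulr_ge0// exprn_ge0.
Qed.

Lemma expr_dbl x q : x ^+ q.*2 = (x ^+ 2) ^+ q.
Proof. by rewrite -exprM mul2n. Qed.

Lemma expr_dbl_ge0 x q : 0 <= x ^+ q.*2.
Proof. by rewrite expr_dbl exprn_ge0// sqr_ge0. Qed.

Lemma expr_dbl_norm x q : `|x| ^+ q.*2 = x ^+ q.*2.
Proof. by rewrite !expr_dbl -normrX ger0_norm// sqr_ge0. Qed.

End Powers.

Ltac ge0 := repeat first [ done | exact: normr_ge0 | exact: expR_ge0 | exact: sqrtr_ge0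
  | by apply: ltW
  | match goal with
    | |- is_true (0 <= _ + _) => apply: addr_ge0
    | |- is_true (0 <= ?x * ?x) => rewrite -expr2; exact: sqr_ge0
    | |- is_true (0 <= _ * _) => apply: mulr_ge0
    | |- is_true (0 <= _ ^+ 2) => exact: sqr_ge0
    | |- is_true (0 <= _ ^+ _.*2) => exact: expr_dbl_ge0
    | |- is_true (0 <= _ ^+ _) => apply: exprn_ge0
    | |- is_true (0 <= _^-1) => rewrite invr_ge0
    end ].


Section Powers2.
Context {R : realType}.
Implicit Types (e d x y : R) (m n : nat).

(** Second-order expansion of an even power, by induction on q through multiplication by (e + d)^2.
    Intermediate monomials are absorbed because each lies below the sum of the extreme ones. *)
Lemma powD_taylor q : exists2 C : R, 0 <= C & forall e d,
  (e + d) ^+ q.*2.+2 <= e ^+ q.*2.+2 + (q.*2.+2)%:R * e ^+ q.*2.+1 * d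
    + C * (e ^+ q.*2 * d ^+ 2 + d ^+ q.*2.+2).
Proof.
elim: q => [|q [C C0 IH]].
  exists 1 => // e d; rewrite double0 expr0 expr1.
  by have := sqr_ge0 d; rewrite !expr2; lra.
exists (1 + 4 * (q.*2.+2)%:R + 6 * C) => [|e d]; first by rewrite !addr_ge0// mulr_ge0.
rewrite doubleS.
have {}IH := ler_wpM2r (sqr_ge0 (e + d)) (IH e d).
move: IH; rewrite -exprD addn2 => /le_trans; apply.
set M := (q.*2.+2)%:R.
have M0 : 0 <= M by rewrite /M.
have -> : (q.*2.+4)%:R = M + 2 :> R by rewrite /M -natrD addn2.
have A0 : 0 <= e ^+ q.*2 by exact: expr_dbl_ge0.
have D0 : 0 <= d ^+ q.*2 by exact: expr_dbl_ge0.
have pX : 0 <= e ^+ q.*2 * e ^+ 2 * d ^+ 2 by ge0.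
have pY : 0 <= d ^+ q.*2 * d ^+ 2 * d ^+ 2 by ge0.
have h1 : e ^+ q.*2 * d ^+ 2 * d ^+ 2 <= e ^+ q.*2 * e ^+ 2 * d ^+ 2 + d ^+ q.*2 * d ^+ 2 * d ^+ 2.
  have [ed|/ltW de] := leP (d ^+ 2) (e ^+ 2).
    suff : e ^+ q.*2 * d ^+ 2 * d ^+ 2 <= e ^+ q.*2 * e ^+ 2 * d ^+ 2 by lra.
    by rewrite ler_wpM2r ?sqr_ge0// ler_wpM2l.
  suff : e ^+ q.*2 * d ^+ 2 * d ^+ 2 <= d ^+ q.*2 * d ^+ 2 * d ^+ 2 by lra.
  by rewrite !ler_wpM2r ?sqr_ge0// !expr_dbl lerXn2r ?nnegrE ?sqr_ge0.
have h2 : d ^+ q.*2 * d ^+ 2 * e ^+ 2 <= e ^+ q.*2 * e ^+ 2 * d ^+ 2 + d ^+ q.*2 * d ^+ 2 * d ^+ 2.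
  have [ed|/ltW de] := leP (d ^+ 2) (e ^+ 2).
    suff : d ^+ q.*2 * d ^+ 2 * e ^+ 2 <= e ^+ q.*2 * e ^+ 2 * d ^+ 2 by lra.
    by rewrite mulrAC !ler_wpM2r ?sqr_ge0// !expr_dbl lerXn2r ?nnegrE ?sqr_ge0.
  suff : d ^+ q.*2 * d ^+ 2 * e ^+ 2 <= d ^+ q.*2 * d ^+ 2 * d ^+ 2 by lra.
  by rewrite ler_wpM2l// mulr_ge0 ?sqr_ge0.
rewrite !exprSr in h1 h2 *.
set A := e ^+ q.*2 in A0 h1 h2 *; set D := d ^+ q.*2 in D0 h1 h2 *.
rewrite !expr0 !mul1r in h1 h2 *.
set X := A * (e * e) * (d * d) in h1 h2 *.
set Y := D * (d * d) * (d * d) in h1 h2 *.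
have X0 : 0 <= X by rewrite /X; ge0.
have Y0 : 0 <= Y by rewrite /Y; ge0.
set U := A * (d * d) * (d * d) in h1.
have U0 : 0 <= U by rewrite /U; ge0.
set V := D * (d * d) * (e * e) in h2.
have h3 : A * (d * d) * (e * d) <= X + U.
  have -> : X + U = A * (d * d) * (e * e + d * d) by rewrite /X /U; ring.
  apply: ler_wpM2l; first by ge0.
  by have := sqr_ge0 (e - d); have := sqr_ge0 (e + d); rewrite !expr2; lra.
have h4 : (A * (d * d) + D * (d * d)) * ((e + d) * (e + d)) <= 2 * (X + U + V + Y).
  have -> : 2 * (X + U + V + Y) = (A * (d * d) + D * (d * d)) * (2 * (e * e + d * d)).
    by rewrite /X /U /V /Y; ring.
  apply: ler_wpM2l; first by ge0.
  have := sqr_ge0 (e - d); rewrite !expr2; lra.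
rewrite [leLHS](_ : _ = A * (e * e) * (e * e) + (M + 2) * (A * (e * e) * e) * d + (1 + 2 * M) * X
    + M * (A * (d * d) * (e * d))
    + C * ((A * (d * d) + D * (d * d)) * ((e + d) * (e + d)))); last by rewrite /X; ring.
rewrite [leRHS](_ : _ = A * (e * e) * (e * e) + (M + 2) * (A * (e * e) * e) * d
    + (1 + 4 * M + 6 * C) * (X + Y)); last by rewrite /X /Y; ring.
move: (A * (e * e) * (e * e)) (_ * d) (A * (d * d) * (e * d)) (_ * ((e + d) * (e + d)))
  h1 h2 h3 h4 X0 Y0 U0 => a b T Q h1 h2 h3 h4 X0 Y0 U0.
have h5 : M * T <= M * (2 * X + Y) by rewrite ler_wpM2l//; lra.
have h6 : C * Q <= C * (6 * X + 6 * Y) by rewrite ler_wpM2l//; lra.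
have := mulr_ge0 M0 X0; have := mulr_ge0 M0 Y0.
have := mulr_ge0 C0 X0; have := mulr_ge0 C0 Y0.
by lra.
Qed.

(** The sum is at most four times the largest absolute value, whose power is one of the summands on
    the right. *)
Lemma pow_sum4 (x y z t : R) q : (x + y + z + t) ^+ q.*2 <=
  4 ^+ q.*2 * (x ^+ q.*2 + y ^+ q.*2 + z ^+ q.*2 + t ^+ q.*2).
Proof.
pose m := Num.max (Num.max `|x| `|y|) (Num.max `|z| `|t|).
have m0 : 0 <= m by rewrite !le_max normr_ge0.
have xm : `|x| <= m by rewrite !le_max lexx.
have ym : `|y| <= m by rewrite !le_max lexx ?orbT.
have zm : `|z| <= m by rewrite !le_max lexx ?orbT.
have tm : `|t| <= m by rewrite !le_max lexx ?orbT.
have sm : `|x + y + z + t| <= 4 * m.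
  have := ler_normD (x + y + z) t; have := ler_normD (x + y) z; have := ler_normD x y; lra.
rewrite -(expr_dbl_norm (x + y + z + t)).
apply: (@le_trans _ _ ((4 * m) ^+ q.*2)).
  by rewrite lerXn2r ?nnegrE//; ge0.
rewrite exprMn; apply: ler_wpM2l; first by ge0.
have xp := expr_dbl_ge0 x q; have yp := expr_dbl_ge0 y q.
have zp := expr_dbl_ge0 z q; have tp := expr_dbl_ge0 t q.
have mE : [|| m == `|x|, m == `|y|, m == `|z| | m == `|t|].
  rewrite /m; case: (leP (Num.max `|x| `|y|)) => _.
    by case: (leP `|z|) => _; rewrite eqxx ?orbT.
  by case: (leP `|x|) => _; rewrite eqxx ?orbT.
by case/or4P: mE => /eqP ->; rewrite expr_dbl_norm; lra.
Qed.

End Powers2.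

(** * The one-step estimate for a fixed increment and its opposite *)

Section StepPointwise.
Context {R : realType}.
Implicit Types (e d x y : R) (m n : nat).

(** Here s is the square root of the step, s * z the increment and t a weight dominating |z| and
    |z^2 - 1|. Adding the cases z and -z cancels the linear term in b, the only one of order s, and
    only [rp + rm], of order s^4, enters linearly. The linear term in c is kept as it stands,
    because its Gaussian mean will vanish; all the rest is of order s^2. *)
Lemma step_pointwise q (L : R) : 1 <= L -> exists2 C : R, 0 <= C &
  forall (e a b c k s z t rp rm : R),
  0 <= k -> 0 < s <= 1 -> 1 <= t -> `|z| <= L * t -> `|z ^+ 2 - 1| <= L * t ->
  `|rp| <= k * s ^+ 3 * t -> `|rm| <= k * s ^+ 3 * t ->
  `|rp + rm| <= k * s ^+ 4 * t ->
  (e + (a * s ^+ 2 + b * (s * z) + c * (s ^+ 2 * (z ^+ 2 - 1)) + rp)) ^+ q.*2.+2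
  + (e + (a * s ^+ 2 - b * (s * z) + c * (s ^+ 2 * (z ^+ 2 - 1)) + rm)) ^+ q.*2.+2
  <= 2 * (e ^+ q.*2.+2 + (q.*2.+2)%:R * e ^+ q.*2.+1 * c * s ^+ 2 * (z ^+ 2 - 1)
     + C * s ^+ 2 * (e ^+ q.*2.+2 + (a ^+ q.*2.+2 + b ^+ q.*2.+2 + (s * c) ^+ q.*2.+2
       + (s ^+ 2 * k) ^+ q.*2.+2)) * t ^+ q.*2.+2).
Proof.
move=> L1; have [C1 C10 tay] := @powD_taylor R q.
set N := q.*2.+2; set M : R := N%:R.
have M0 : 0 <= M by rewrite /M.
exists (2 * M + 2 * C1 * (1 + (4 * L) ^+ N)) => [|e a b c k s z t rp rm k0 /andP[s0 s1] t1 zL z2L rpk rmk rprm].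
  by ge0; lra.
have N2 : N = q.+1.*2 by rewrite doubleS.
have t0 : 0 <= t by lra.
have L0 : 0 <= L by lra.
have Lt1 : 1 <= L * t by nra.
have s0' : 0 <= s by lra.
set beta := `|a| + `|b| + `|s * c| + `|s ^+ 2 * k|.
have beta0 : 0 <= beta by rewrite /beta; ge0.
(* A common bound for both displacements: each of the four contributions is at most s times its
   coefficient in [beta] times L t. *)
set W := s * (beta * (L * t)).
have W0 : 0 <= W by rewrite /W; ge0; lra.
have [dp dpE] : exists dp, dp = a * s ^+ 2 + b * (s * z) + c * (s ^+ 2 * (z ^+ 2 - 1)) + rp by eexists.
have [dm dmE] : exists dm, dm = a * s ^+ 2 - b * (s * z) + c * (s ^+ 2 * (z ^+ 2 - 1)) + rm by eexists.
have ha : `|a * s ^+ 2| <= s * (`|a| * (L * t)).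
  rewrite normrM (ger0_norm (sqr_ge0 s)) [leRHS]mulrCA; apply: ler_wpM2l => //.
  by rewrite expr2; apply: ler_wpM2l => //; lra.
have hb : `|b * (s * z)| <= s * (`|b| * (L * t)).
  by rewrite !normrM (ger0_norm s0') [leRHS]mulrCA; do 2 (apply: ler_wpM2l => //).
have hc : `|c * (s ^+ 2 * (z ^+ 2 - 1))| <= s * (`|s * c| * (L * t)).
  rewrite (normrM c) (normrM (s ^+ 2)) (normrM s c) (ger0_norm (sqr_ge0 s)) (ger0_norm s0').
  have -> : s * (s * `|c| * (L * t)) = `|c| * (s ^+ 2 * (L * t)) by ring.
  by apply: ler_wpM2l => //; apply: ler_wpM2l => //; exact: sqr_ge0.
have kk : k * s ^+ 3 * t <= s * (`|s ^+ 2 * k| * (L * t)).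
  rewrite (@ger0_norm _ (s ^+ 2 * k)); last by ge0.
  have -> : s * (s ^+ 2 * k * (L * t)) = k * s ^+ 3 * (L * t) by ring.
  by apply: ler_wpM2l; [ge0 | rewrite ler_peMl].
have WE : W = s * (`|a| * (L * t)) + s * (`|b| * (L * t)) + s * (`|s * c| * (L * t))
    + s * (`|s ^+ 2 * k| * (L * t)) by rewrite /W /beta; ring.
have tri (x1 x2 x3 x4 : R) : `|x1 + x2 + x3 + x4| <= `|x1| + `|x2| + `|x3| + `|x4|.
  have := ler_normD (x1 + x2 + x3) x4; have := ler_normD (x1 + x2) x3.
  by have := ler_normD x1 x2; lra.
have dpW : `|dp| <= W.
  rewrite dpE WE; apply: (le_trans (tri _ _ _ _)).
  by rewrite !lerD// (le_trans rpk).
have dmW : `|dm| <= W.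
  rewrite dmE WE; apply: (le_trans (tri _ _ _ _)).
  by rewrite normrN !lerD// (le_trans rmk).
rewrite -dpE -dmE.
have eN0 : 0 <= e ^+ N by rewrite N2; ge0.
set T := t ^+ N.
have T1 : 1 <= T by rewrite exprn_ege1.
have T0 : 0 <= T by lra.
have tT : t <= T by rewrite /T exprS ler_peMr// exprn_ege1.
set S := a ^+ N + b ^+ N + (s * c) ^+ N + (s ^+ 2 * k) ^+ N.
have [an bn cn kn] : [/\ 0 <= a ^+ N, 0 <= b ^+ N, 0 <= (s * c) ^+ N & 0 <= (s ^+ 2 * k) ^+ N].
  by split; rewrite N2; ge0.
have S0 : 0 <= S by rewrite /S; lra.
have betaN : (beta * (L * t)) ^+ N <= (4 * L) ^+ N * S * T.
  rewrite !(exprMn N) -/T.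
  have -> : 4 ^+ N * L ^+ N * S * T = 4 ^+ N * S * (L ^+ N * T) by ring.
  apply: ler_wpM2r; first by ge0.
  rewrite /beta N2; apply: (le_trans (pow_sum4 _ _ _ _ _)).
  by rewrite !expr_dbl_norm -N2 /S.
have young (x : R) : `|e| ^+ q.*2.+1 * `|x| <= e ^+ N + x ^+ N.
  have := pow_mix q.*2.+1 1 (normr_ge0 e) (normr_ge0 x).
  by rewrite expr1 addn1 -/N N2 !expr_dbl_norm.
have young2 (x : R) : e ^+ q.*2 * x ^+ 2 <= e ^+ N + x ^+ N.
  have := pow_mix q.*2 2 (normr_ge0 e) (normr_ge0 x).
  rewrite addn2 -/N N2 !expr_dbl_norm; congr (_ <= _).
  by rewrite -normrX ger0_norm// sqr_ge0.
have WN : W ^+ N <= s ^+ 2 * ((4 * L) ^+ N * S * T).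
  rewrite /W exprMn; apply: ler_pM => //; [by ge0 | rewrite N2; ge0 |].
  by rewrite /N -addn2 addnC exprD ler_piMr ?sqr_ge0// exprn_ile1.
have eW : e ^+ q.*2 * W ^+ 2 <= s ^+ 2 * (e ^+ N + (4 * L) ^+ N * S * T).
  rewrite /W exprMn mulrCA; apply: ler_wpM2l; first by ge0.
  by apply: (le_trans (young2 _)); rewrite lerD2l.
have rem d : `|d| <= W -> C1 * (e ^+ q.*2 * d ^+ 2 + d ^+ N)
    <= C1 * (s ^+ 2 * (e ^+ N + 2 * ((4 * L) ^+ N * S * T))).
  move=> dW; apply: ler_wpM2l => //.
  have d2 : e ^+ q.*2 * d ^+ 2 <= e ^+ q.*2 * W ^+ 2.
    apply: ler_wpM2l; first by ge0.
    by rewrite -[d ^+ 2]ger0_norm ?sqr_ge0// normrX lerXn2r ?nnegrE.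
  have dn : d ^+ N <= W ^+ N by rewrite N2 -expr_dbl_norm lerXn2r ?nnegrE.
  by move: d2 dn WN eW; rewrite !mulrDr; lra.
have rP := rem _ dpW; have rM := rem _ dmW.
have tP := tay e dp; have tM := tay e dm.
(* First-order terms: those in b cancel, and the order s^4 of [rp + rm] leaves the factor s^2 in
   front of the coefficient s^2 k. *)
have sum : M * e ^+ q.*2.+1 * dp + M * e ^+ q.*2.+1 * dm <=
    2 * (M * e ^+ q.*2.+1 * c * s ^+ 2 * (z ^+ 2 - 1)) + 2 * M * (s ^+ 2 * ((e ^+ N + S) * T)) + M * (s ^+ 2 * ((e ^+ N + S) * T)).
  have -> : M * e ^+ q.*2.+1 * dp + M * e ^+ q.*2.+1 * dm =
     2 * (M * e ^+ q.*2.+1 * c * s ^+ 2 * (z ^+ 2 - 1))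
     + 2 * M * (s ^+ 2 * (e ^+ q.*2.+1 * a)) + M * (e ^+ q.*2.+1 * (rp + rm)).
    by rewrite dpE dmE; ring.
  rewrite lerD// ?lerD2l.
    apply: ler_wpM2l; first by ge0.
    apply: ler_wpM2l; first by ge0.
    apply: (@le_trans _ _ (e ^+ N + a ^+ N)).
      by apply: le_trans (young a); rewrite -normrX -normrM ler_norm.
    apply: (@le_trans _ _ (e ^+ N + S)); first by rewrite /S; lra.
    by rewrite ler_peMr//; lra.
  apply: ler_wpM2l => //.
  apply: (@le_trans _ _ (`|e| ^+ q.*2.+1 * (k * s ^+ 4 * t))).
    by rewrite (le_trans (ler_norm _))// normrM normrX ler_wpM2l// exprn_ge0.
  have -> : `|e| ^+ q.*2.+1 * (k * s ^+ 4 * t) = s ^+ 2 * (`|e| ^+ q.*2.+1 * (s ^+ 2 * k) * t) by ring.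
  apply: ler_wpM2l; first by ge0.
  apply: ler_pM => //; first by ge0.
  rewrite -[s ^+ 2 * k]ger0_norm; last by ge0.
  by apply: (le_trans (young _)); rewrite /S; lra.
have gT : s ^+ 2 * (e ^+ N + 2 * ((4 * L) ^+ N * S * T)) <= 2 * (1 + (4 * L) ^+ N) * (s ^+ 2 * ((e ^+ N + S) * T)).
  have -> : 2 * (1 + (4 * L) ^+ N) * (s ^+ 2 * ((e ^+ N + S) * T)) = s ^+ 2 * ((2 * (1 + (4 * L) ^+ N)) * ((e ^+ N + S) * T)) by ring.
  apply: ler_wpM2l; first by ge0.
  have L40 : 0 <= (4 * L) ^+ N by ge0.
  have p1 := mulr_ge0 eN0 (_ : 0 <= T - 1); have p2 := mulr_ge0 S0 T0.
  have p3 := mulr_ge0 L40 (mulr_ge0 eN0 T0); have {}p1 : e ^+ N <= e ^+ N * T by rewrite ler_peMr.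
  have -> : 2 * (1 + (4 * L) ^+ N) * ((e ^+ N + S) * T) = 2 * (e ^+ N * T) + 2 * (S * T)
      + 2 * ((4 * L) ^+ N * (e ^+ N * T)) + 2 * ((4 * L) ^+ N * S * T) by ring.
  by lra.
have gT1 := ler_wpM2l C10 gT.
rewrite (_ : (2 * M + _) * s ^+ 2 * _ * _ = 2 * (M * (s ^+ 2 * ((e ^+ N + S) * T)))
  + C1 * (2 * (1 + (4 * L) ^+ N) * (s ^+ 2 * ((e ^+ N + S) * T)))); last by rewrite /T /S /N; ring.
have pos : 0 <= M * (s ^+ 2 * ((e ^+ N + S) * T)) by ge0.
move: tP tM rP rM sum gT1 pos; clear.
rewrite -/N -/M -[2 * M * _]mulrA.
set Z := M * (s ^+ 2 * ((e ^+ N + S) * T)).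
set A1 := C1 * (_ * dp ^+ 2 + _); set A2 := C1 * (_ * dm ^+ 2 + _).
set A3 := C1 * (s ^+ 2 * _); set A4 := C1 * (2 * _ * _).
set A6 := M * _ * dp; set A7 := M * _ * dm; set A8 := M * _ * c * _ * _.
by move: Z A1 A2 A3 A4 A6 A7 A8 ((e + dp) ^+ N) ((e + dm) ^+ N) (e ^+ N); clear => *; lra.
Qed.

End StepPointwise.

(** * Integration against an independent Gaussian variable *)

Section Independence.
Context d d' (Omega : measurableType d) (S : measurableType d') (R : realType).
Variables (P : probability Omega R) (pr : Omega -> S) (D : Omega -> R) (s : R).
Hypotheses (mpr : measurable_fun setT pr) (mD : measurable_fun setT D).
Hypothesis indep : forall A C, measurable A -> measurable C ->
  P (pr @^-1` A `&` D @^-1` C) = (P (pr @^-1` A) * normal_prob 0 s C)%E.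

Let prM := isMeasurableFun.Build _ _ _ _ _ mpr.
Let prf : {mfun Omega >-> S} := HB.pack pr prM.

Local Notation mR := (measurableTypeR R).

Let mpair : measurable_fun setT ((fun w => (pr w, D w)) : Omega -> S * mR).
Proof. exact: measurable_fun_pair. Qed.
Let pairM := isMeasurableFun.Build _ _ _ _ _ mpair.
Let pairf : {mfun Omega >-> (S * mR)%type} :=
  HB.pack ((fun w => (pr w, D w)) : Omega -> S * mR) pairM.

(** The law of the pair (pr, D) agrees with the product law on rectangles, hence everywhere; Tonelli
    then integrates the Gaussian variable first. *)
Lemma integral_indep (phi : S * R -> \bar R) : measurable_fun setT phi ->
  (forall x, 0 <= phi x)%E ->
  (\int[P]_w phi (pr w, D w) = \int[P]_w \int[normal_prob 0 s]_y phi (pr w, y))%E.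
Proof.
move=> mphi' phi0.
have mphi : measurable_fun (setT : set (S * mR)) phi by exact: mphi'.
transitivity (\int[distribution P pairf]_z phi z)%E.
  by rewrite ge0_integral_distribution.
transitivity (\int[(distribution P prf \x normal_prob 0 s)%E]_z phi z)%E.
  apply: eq_measure_integral => A mA _; apply/esym.
  exact: product_measure_unique.
rewrite fubini_tonelli1//.
rewrite ge0_integral_distribution//.
- exact: measurable_fun_fubini_tonelli_F.
- by move=> x; apply: integral_ge0 => y _; exact: phi0.
Qed.

End Independence.

Section Gauss2.
Context {R : realType}.
Variable s : R.
Hypothesis s0 : 0 < s.

Lemma integral_normal_sym (f : R -> \bar R) : measurable_fun setT f ->
  (forall x, 0 <= f x)%E ->
  (\int[normal_prob 0 s]_x f (- x)%R = \int[normal_prob 0 s]_x f x)%E.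
Proof.
move=> mf f0.
pose mR := measurableTypeR R.
have mN : measurable_fun setT (-%R : mR -> mR) by exact: oppr_measurable.
pose NM := isMeasurableFun.Build _ _ _ _ _ mN.
pose Nf : {mfun mR >-> mR} := HB.pack (-%R : mR -> mR) NM.
transitivity (\int[distribution (normal_prob 0 s) Nf]_x f x)%E.
  by rewrite ge0_integral_distribution.
by apply: eq_measure_integral => A mA _; apply: normal_probN => //; rewrite gt_eqF.
Qed.

Lemma integral_normal_quad (A p K : R) : 0 <= A -> 0 <= p -> 0 <= K ->
  (\int[normal_prob 0 s]_x (A + p * x ^+ 2 + K * expR (x ^+ 2 / (4 * s ^+ 2)))%:E
   = (A + p * s ^+ 2 + K * Num.sqrt 2)%:E)%E.
Proof.
move=> A0 p0 K0.
have m2 : measurable_fun setT (fun x : R => (x ^+ 2)%:E).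
  by apply/measurable_EFinP; exact: measurable_funX.
have me : measurable_fun setT (fun x : R => (expR (x ^+ 2 / (4 * s ^+ 2)))%:E).
  by apply/measurable_EFinP; apply: measurableT_comp => //; exact: measurable_funM.
have m2' : measurable_fun setT (fun x : R => p%:E * (x ^+ 2)%:E)%E by exact: emeasurable_funM.
have me' : measurable_fun setT (fun x : R => K%:E * (expR (x ^+ 2 / (4 * s ^+ 2)))%:E)%E.
  exact: emeasurable_funM.
have mA : measurable_fun setT (fun x : R => A%:E + p%:E * (x ^+ 2)%:E)%E.
  exact: emeasurable_funD.
transitivity (\int[normal_prob 0 s]_x (A%:E + p%:E * (x ^+ 2)%:E) +
    \int[normal_prob 0 s]_x (K%:E * (expR (x ^+ 2 / (4 * s ^+ 2)))%:E))%E.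
  rewrite -ge0_integralD//.
  - by move=> x _; rewrite -EFinM -EFinD lee_fin addr_ge0// mulr_ge0// sqr_ge0.
  - by move=> x _; rewrite -EFinM lee_fin mulr_ge0// expR_ge0.
rewrite ge0_integralD//; last first.
  by move=> x _; rewrite -EFinM lee_fin mulr_ge0// sqr_ge0.
rewrite ge0_integralZl//; last by move=> x _; rewrite lee_fin sqr_ge0.
rewrite ge0_integralZl//.
rewrite integral_normal_exp4// integral_normal_sqr//.
rewrite integral_cst// !EFinD !EFinM; congr (_ + _ + _)%E.
by rewrite -[RHS]mule1; congr (_ * _)%E; exact: (@probability_setT _ _ _ (normal_prob 0 s)).
Qed.

End Gauss2.

(** * The one-step moment inequality *)

Section OneStep.
Context {R : realType}.

(** By symmetry of the Gaussian law the integrand may be averaged over y and -y, where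
    [step_pointwise] applies with t = exp(y^2 / (4 N s^2)), N = 2q+2. The N-th power of t has mean
    sqrt 2, and the term in c disappears since y^2 has mean s^2. *)
Lemma one_step_gauss q : exists2 C : R, 0 <= C & forall (s e a b c k : R) (r : R -> R),
  0 <= k -> 0 < s <= 1 -> measurable_fun setT r ->
  (forall y, `|r y| <= k * s ^+ 3 * expR (y ^+ 2 / (4 * (q.*2.+2)%:R * s ^+ 2))) ->
  (forall y, `|r y + r (- y)| <= k * s ^+ 4 * expR (y ^+ 2 / (4 * (q.*2.+2)%:R * s ^+ 2))) ->
  (\int[normal_prob 0 s]_y ((e + (a * s ^+ 2 + b * y + c * (y ^+ 2 - s ^+ 2) + r y)) ^+ q.*2.+2)%:E
  <= (e ^+ q.*2.+2 + C * s ^+ 2 * (e ^+ q.*2.+2 + (a ^+ q.*2.+2 + b ^+ q.*2.+2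
       + (s * c) ^+ q.*2.+2 + (s ^+ 2 * k) ^+ q.*2.+2)))%:E)%E.
Proof.
(* From exp u >= 1 + u one gets z^2 <= 4 M (t - 1), so this L makes L t dominate both |z| and |z^2 -
   1|. *)
set N := q.*2.+2; pose M : R := N%:R; pose L : R := 1 + 4 * M.
have M1 : 1 <= M by rewrite /M ler1n.
have L1 : 1 <= L by rewrite /L; lra.
have [C0 C00 H] := step_pointwise q L1.
have r20 : 0 <= Num.sqrt 2 :> R by exact: sqrtr_ge0.
exists (C0 * Num.sqrt 2) => [|s e a b c k r k0 s01 mr rk rk2]; first by ge0.
have s0 : 0 < s by case/andP: s01.
have s_neq0 : s != 0 by rewrite gt_eqF.
have N2 : N = q.+1.*2 by rewrite doubleS.
pose psi y := (e + (a * s ^+ 2 + b * y + c * (y ^+ 2 - s ^+ 2) + r y)) ^+ N.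
have psi0 y : 0 <= psi y by rewrite /psi N2; ge0.
have mpsi : measurable_fun setT psi.
  apply: measurable_funX; apply: measurable_funD => //; apply: measurable_funD => //.
  apply: measurable_funD; first by apply: measurable_funD => //; exact: measurable_funM.
  by apply: measurable_funM => //; apply: measurable_funB => //; exact: measurable_funX.
set K := C0 * s ^+ 2 * (e ^+ N + (a ^+ N + b ^+ N + (s * c) ^+ N + (s ^+ 2 * k) ^+ N)).
have K0 : 0 <= K by rewrite /K N2; ge0.
(* The coefficient of y^2 - s^2 has no definite sign. It is split as [zp - zn], and each term is put
   on the side of the inequality where it is nonnegative, so that only nonnegative functions are
   integrated. *)
pose zeta := M * e ^+ q.*2.+1 * c.
pose zp := Num.max zeta 0; pose zn := Num.max (- zeta) 0.
have zpn : zeta = zp - zn.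
  rewrite /zp /zn; case: (leP zeta) => h; case: (leP (- zeta)) => h'; lra.
have zp0 : 0 <= zp by rewrite le_max lexx orbT.
have zn0 : 0 <= zn by rewrite le_max lexx orbT.
have key y : psi y + psi (- y) + 2 * zn * y ^+ 2 + 2 * zp * s ^+ 2 <=
   2 * e ^+ N + 2 * zn * s ^+ 2 + 2 * zp * y ^+ 2 + 2 * K * expR (y ^+ 2 / (4 * s ^+ 2)).
  pose z := y / s; pose t := expR (y ^+ 2 / (4 * M * s ^+ 2)).
  have tN : t ^+ N = expR (y ^+ 2 / (4 * s ^+ 2)).
    by rewrite /t -expRM_natl -/M; congr expR; field; rewrite s_neq0/= gt_eqF//; lra.
  have zt : z ^+ 2 / (4 * M) <= t - 1.
    have := expR_ge1Dx (y ^+ 2 / (4 * M * s ^+ 2)); rewrite -/t.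
    suff -> : y ^+ 2 / (4 * M * s ^+ 2) = z ^+ 2 / (4 * M) by lra.
    by rewrite /z; field; rewrite s_neq0/= gt_eqF//; lra.
  rewrite ler_pdivrMr in zt; last by lra.
  have z20 := sqr_ge0 z.
  have t1 : 1 <= t.
    rewrite -expR0 ler_expR; apply: divr_ge0; first exact: sqr_ge0.
    by ge0; lra.
  have Lt : L * t = t + 4 * M * t by rewrite /L; ring.
  have Mt : M <= M * t by rewrite ler_peMr//; lra.
  have zt2 : z ^+ 2 <= 4 * M * t - 4 * M by move: zt; rewrite mulrBl mul1r (mulrC t).
  have h1 : `|z| <= L * t.
    have zz : `|z| <= 1 + z ^+ 2.
      by rewrite ler_norml; have := sqr_ge0 (z - 1); have := sqr_ge0 (z + 1); rewrite !expr2; lra.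
    by rewrite Lt; lra.
  have h2 : `|z ^+ 2 - 1| <= L * t.
    by rewrite Lt ler_norml; lra.
  have yE : y = s * z by rewrite /z mulrC divfK.
  have rkN : `|r (- y)| <= k * s ^+ 3 * t by have := rk (- y); rewrite sqrrN.
  have := H e a b c k s z t (r y) (r (- y)) k0 s01 t1 h1 h2 (rk y) rkN (rk2 y).
  rewrite -yE -/N tN.
  have -> : s ^+ 2 * (z ^+ 2 - 1) = y ^+ 2 - s ^+ 2 by rewrite yE; ring.
  rewrite -[e + (a * s ^+ 2 + _ + _ + _)]/(e + (a * s ^+ 2 + b * y + c * (y ^+ 2 - s ^+ 2) + r y)).
  rewrite -/(psi y) -(mulrN b) (_ : (e + _) ^+ N = psi (- y)); last by rewrite /psi sqrrN.
  rewrite -/K -/M.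
  rewrite (_ : M * _ * c * s ^+ 2 * _ = (zp - zn) * (y ^+ 2 - s ^+ 2)); last first.
    by rewrite -zpn /zeta yE; ring.
  move: (psi y) (psi (- y)) (expR _) => p1 p2 ex.
  clear; lra.
have mpsiE : measurable_fun setT (fun y : R => (psi y)%:E) by exact/measurable_EFinP.
have mpsiN : measurable_fun setT (fun y : R => (psi (- y))%:E).
  by apply: (measurableT_comp mpsiE); exact: oppr_measurable.
set I := (X in (X <= _)%E).
have I0 : (0 <= I)%E by apply: integral_ge0 => y _; rewrite lee_fin psi0.
have e0 : 0 <= e ^+ N by rewrite N2; ge0.
have mX2 (p : R) : measurable_fun setT (fun y : R => (p * y ^+ 2)%:E).
  by apply/measurable_EFinP; apply: measurable_funM => //; exact: measurable_funX.
have X2 p A : 0 <= p -> 0 <= A ->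
    (\int[normal_prob 0 s]_y (p * y ^+ 2 + A)%:E = (p * s ^+ 2 + A)%:E)%E.
  move=> p0 A0; have := integral_normal_quad s0 A0 p0 (lexx 0).
  rewrite mul0r addr0 (addrC A) => <-.
  by apply: eq_integral => y _; rewrite mul0r addr0 addrC.
have p1 : 0 <= 2 * zn by ge0.
have p2 : 0 <= 2 * zp * s ^+ 2 by ge0.
have p3 : 0 <= 2 * e ^+ N + 2 * zn * s ^+ 2 by ge0.
have p4 : 0 <= 2 * zp by ge0.
have p5 : 0 <= 2 * K by ge0.
(* Integral of [key]. Since y^2 has mean s^2, the terms in [zn] and [zp] coincide on both sides and
   cancel once [I] is known to be finite. *)
have main : (I + I + (2 * zn * s ^+ 2 + 2 * zp * s ^+ 2)%:E <=
    (2 * e ^+ N + 2 * zn * s ^+ 2 + 2 * zp * s ^+ 2 + 2 * K * Num.sqrt 2)%:E)%E.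
  rewrite -integral_normal_quad// -X2//.
  rewrite -[X in (I + X + _)%E](integral_normal_sym s0 mpsiE); last by move=> y; rewrite lee_fin; exact: psi0.
  rewrite -ge0_integralD//=; last 2 first.
  - by move=> y _; rewrite lee_fin; exact: psi0.
  - by move=> y _; rewrite lee_fin; exact: psi0.
  rewrite -ge0_integralD//=; last 4 first.
  - by move=> y _; rewrite -EFinD lee_fin addr_ge0//; exact: psi0.
  - exact: emeasurable_funD.
  - by move=> y _; rewrite lee_fin; ge0.
  - by under eq_fun do rewrite EFinD; apply: emeasurable_funD => //; exact: mX2.
  apply: ge0_le_integral => //=.
  - by move=> y _; rewrite -!EFinD lee_fin; apply: addr_ge0; [apply: addr_ge0; exact: psi0|by ge0].
  - apply: emeasurable_funD; first exact: emeasurable_funD.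
    by under eq_fun do rewrite EFinD; apply: emeasurable_funD => //; exact: mX2.
  - apply/measurable_EFinP; apply: measurable_funD; last first.
      apply: measurable_funM => //; apply: measurableT_comp => //; exact: measurable_funM.
    by apply: measurable_funD => //; apply/measurable_EFinP; exact: mX2.
  - by move=> y _; rewrite -!EFinD lee_fin addrA; exact: key.
have Ifin : I \is a fin_num.
  rewrite ge0_fin_numE//; apply: contraTT main; rewrite -leNgt leye_eq => /eqP ->.
  by rewrite -ltNge /= ltry.
move: main; rewrite -(fineK Ifin) -!EFinD !lee_fin -/K => main.
rewrite (_ : C0 * _ * _ * _ = K * Num.sqrt 2); last by rewrite /K; ring.
move: main; move: (fine I) => v; clear; lra.
Qed.

End OneStep.

(** [one_step_gauss] conditionally on the past [pr], which determines the coefficients and is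
    independent of the increment. The constant is chosen before the probability space. *)
Lemma one_step {R : realType} q : exists2 C : R, 0 <= C &
  forall d d' (Omega : measurableType d) (S : measurableType d')
    (P : probability Omega R) (pr : Omega -> S) (D : Omega -> R) (s : R)
    (e a b c k : S -> R) (r : S * R -> R),
  measurable_fun setT pr -> measurable_fun setT D ->
  (forall A C', measurable A -> measurable C' ->
    P (pr @^-1` A `&` D @^-1` C') = (P (pr @^-1` A) * normal_prob 0 s C')%E) ->
  measurable_fun setT e -> measurable_fun setT a -> measurable_fun setT b ->
  measurable_fun setT c -> measurable_fun setT k -> measurable_fun setT r ->
  (forall x, 0 <= k x) -> 0 < s <= 1 ->
  (forall x y, `|r (x, y)| <= k x * s ^+ 3 * expR (y ^+ 2 / (4 * (q.*2.+2)%:R * s ^+ 2))) ->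
  (forall x y, `|r (x, y) + r (x, - y)| <=
     k x * s ^+ 4 * expR (y ^+ 2 / (4 * (q.*2.+2)%:R * s ^+ 2))) ->
  (\int[P]_w ((e (pr w) + (a (pr w) * s ^+ 2 + b (pr w) * D w
       + c (pr w) * (D w ^+ 2 - s ^+ 2) + r (pr w, D w))) ^+ q.*2.+2)%:E
  <= \int[P]_w (e (pr w) ^+ q.*2.+2 + C * s ^+ 2 * (e (pr w) ^+ q.*2.+2
       + (a (pr w) ^+ q.*2.+2 + b (pr w) ^+ q.*2.+2
       + (s * c (pr w)) ^+ q.*2.+2 + (s ^+ 2 * k (pr w)) ^+ q.*2.+2)))%:E)%E.
Proof.
have [C C0 H] := @one_step_gauss R q; exists C => // d d' Omega S P pr D s e a b c k r.
move=> mpr mD indep me ma mb mc mk mr k0 s01 rk rk2.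
have f1 : measurable_fun setT (fst : S * R -> S) by exact: measurable_fst.
have f2 : measurable_fun setT (snd : S * R -> R) by exact: measurable_snd.
have mf (f : S -> R) : measurable_fun setT f -> measurable_fun setT (fun x : S * R => f x.1).
  by move=> ?; exact: measurableT_comp f1.
pose phi (x : S * R) := (e x.1 + (a x.1 * s ^+ 2 + b x.1 * x.2
       + c x.1 * (x.2 ^+ 2 - s ^+ 2) + r x)) ^+ q.*2.+2.
have pow0 (x : R) : 0 <= x ^+ q.*2.+2 by rewrite -doubleS; exact: expr_dbl_ge0.
have mphi : measurable_fun setT phi.
  apply: measurable_funX; apply: measurable_funD; first exact: mf.
  apply: measurable_funD => //; apply: measurable_funD.
    apply: measurable_funD; first by apply: measurable_funM => //; exact: mf.
    by apply: measurable_funM => //; exact: mf.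
  apply: measurable_funM; first exact: mf.
  by apply: measurable_funB => //; exact: measurable_funX.
rewrite (_ : (\int[P]_w _)%E = \int[P]_w (phi (pr w, D w))%:E)%E//.
rewrite (integral_indep mpr mD indep (phi := EFin \o phi)); last 2 first.
- exact/measurable_EFinP.
- by move=> x; rewrite /= lee_fin; exact: pow0.
apply: ge0_le_integral => //.
- by move=> w _; apply: integral_ge0 => y _; rewrite lee_fin; exact: pow0.
- have mE : measurable_fun setT (EFin \o phi) by exact/measurable_EFinP.
  have mF := @measurable_fun_fubini_tonelli_F _ _ S (measurableTypeR R) R (normal_prob 0 s) (EFin \o phi) mE.
  by apply: (measurableT_comp (mF _)) => // x; rewrite /= lee_fin; exact: pow0.
- apply/measurable_EFinP; apply: (measurableT_comp (f := fun x => e x ^+ q.*2.+2 + C * s ^+ 2 * (e x ^+ q.*2.+2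
       + (a x ^+ q.*2.+2 + b x ^+ q.*2.+2
       + (s * c x) ^+ q.*2.+2 + (s ^+ 2 * k x) ^+ q.*2.+2)))) => //.
  apply: measurable_funD; first exact: measurable_funX.
  apply: measurable_funM => //; repeat (apply: measurable_funD; try exact: measurable_funX);
   by apply: measurable_funX; apply: measurable_funM.
- move=> w _.
  apply: (H s (e (pr w)) (a (pr w)) (b (pr w)) (c (pr w)) (k (pr w)) (fun y => r (pr w, y))) => //.
  by apply: measurable_fun_pair2.
Qed.

(** * Adapted variables and one Wiener step *)

Section Filtration.
Context d (Omega : measurableType d) (R : realType) (P : probability Omega R).
Variables (Ft : R -> set (set Omega)) (B : R -> Omega -> R).
Hypotheses (hFt : is_filtration Ft) (hB : is_wiener P Ft B).

(** Measurability for [Ft t], phrased on the generated sigma-algebra type so that the general lemmas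
    on measurable functions apply to it. *)
Definition fm (t : R) (Z : Omega -> R) : Prop :=
  measurable_fun setT (Z : g_sigma_algebraType (Ft t) -> R).

Lemma measurable_Ft t A : 0 <= t ->
  measurable (A : set (g_sigma_algebraType (Ft t))) <-> Ft t A.
Proof.
move=> t0; have [sF _ _] := hFt.
by rewrite (measurable_g_measurableTypeE (sF t t0)).
Qed.

Lemma fmP t Z : 0 <= t -> measurable_wrt (Ft t) Z -> fm t Z.
Proof.
by move=> t0 mZ _ C mC; rewrite setTI; apply/measurable_Ft => //; exact: mZ.
Qed.

Lemma fm_mono s t Z : 0 <= s -> s <= t -> fm s Z -> fm t Z.
Proof.
move=> s0 st mZ _ C mC; rewrite setTI; have t0 := le_trans s0 st.
apply/measurable_Ft => //; have [_ _ mono] := hFt.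
apply: (mono s t) => //; apply/measurable_Ft => //.
by have := mZ measurableT C mC; rewrite setTI.
Qed.

Lemma measurable_id_Ft t : 0 <= t ->
  measurable_fun setT (idfun : Omega -> g_sigma_algebraType (Ft t)).
Proof.
move=> t0 _ A mA; rewrite setTI; have [_ sub _] := hFt.
by apply: (sub t t0); apply/measurable_Ft.
Qed.

Lemma fm_measurable t Z : 0 <= t -> fm t Z -> measurable_fun setT Z.
Proof. by move=> t0 mZ; exact: (measurableT_comp mZ (measurable_id_Ft t0)). Qed.

Lemma fm_wiener t : 0 <= t -> fm t (B t).
Proof. by move=> t0; apply: fmP => //; exact: (wiener_adapted hB). Qed.

Lemma fm_increment s t : 0 <= s -> s <= t -> fm t (increment B s t).
Proof.
move=> s0 st; have t0 := le_trans s0 st; apply: measurable_funB.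
- exact: fm_wiener.
- exact: (fm_mono s0 st (fm_wiener s0)).
Qed.

(** [one_step] in the form used by Gronwall: the coefficients are dominated by the current error and
    a source [g], so a bound x on the moment before the step becomes x + C h ((1 + K) x + y) after
    it. *)
Lemma wiener_step q : exists2 C : R, 0 <= C &
  forall (u h K x y : R) (e a b c k g : Omega -> R)
    (r : g_sigma_algebraType (Ft u) * R -> R),
  0 <= u -> 0 < h <= 1 -> 0 <= K ->
  fm u e -> fm u a -> fm u b -> fm u c -> fm u k -> measurable_fun setT r ->
  measurable_fun setT g -> (forall w, 0 <= g w) -> (forall w, 0 <= k w) ->
  let s := Num.sqrt h in
  (forall w z, `|r (w, z)| <= k w * s ^+ 3 * expR (z ^+ 2 / (4 * (q.*2.+2)%:R * h))) ->
  (forall w z, `|r (w, z) + r (w, - z)| <=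
     k w * s ^+ 4 * expR (z ^+ 2 / (4 * (q.*2.+2)%:R * h))) ->
  (forall w, a w ^+ q.*2.+2 + b w ^+ q.*2.+2 + (s * c w) ^+ q.*2.+2
     + (h * k w) ^+ q.*2.+2 <= K * e w ^+ q.*2.+2 + g w) ->
  (\int[P]_w (e w ^+ q.*2.+2)%:E <= x%:E)%E -> (\int[P]_w (g w)%:E <= y%:E)%E ->
  (\int[P]_w ((e w + (a w * h + b w * increment B u (u + h) w
       + c w * (increment B u (u + h) w ^+ 2 - h) + r (w, increment B u (u + h) w))) ^+ q.*2.+2)%:E
   <= (x + C * h * ((1 + K) * x + y))%:E)%E.
Proof.
have [C C0 H] := @one_step R q; exists C => //.
move=> u h K x y e a b c k g r u0 h01 K0 me ma mb mc mk mr mg g0 k0 s rk rk2 Kg ex gy; set D := increment B u (u + h).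
have h0 : 0 < h by case/andP: h01.
have h1 : h <= 1 by case/andP: h01.
have s2 : s ^+ 2 = h by rewrite /s sqr_sqrtr// ltW.
have s01 : 0 < s <= 1 by rewrite sqrtr_gt0 h0 -(ler_sqr _ _)// ?nnegrE ?sqrtr_ge0// s2 expr1n.
have pow0 (v : R) : 0 <= v ^+ q.*2.+2 by rewrite -doubleS; exact: expr_dbl_ge0.
have uh : 0 <= u + h by rewrite addr_ge0// ltW.
have uuh : u <= u + h by rewrite lerDl ltW.
have := H _ _ Omega (g_sigma_algebraType (Ft u)) P idfun D s e a b c k r.
rewrite !s2 => /(_ (measurable_id_Ft u0)) Hs.
have me' := fm_measurable u0 me.
apply: le_trans; first apply: Hs => //.
- exact: (fm_measurable uh (fm_increment u0 uuh)).
- move=> A C' mA mC'; have FA : Ft u A by apply/measurable_Ft.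
  have uuh' : u < u + h by rewrite ltrDl.
  have := wiener_indep hB u0 uuh' FA mC'.
  rewrite (wiener_normal hB u0 uuh' mC') /s.
  by rewrite (_ : u + h - u = h) => [E|]; [exact: E|rewrite addrAC subrr add0r].
apply: (@le_trans _ _ (\int[P]_w ((1 + C * h * (1 + K))%:E * (e w ^+ q.*2.+2)%:E + (C * h)%:E * (g w)%:E))%E).
  apply: ge0_le_integral => //.
  - move=> w _; rewrite lee_fin; apply: addr_ge0; first exact: pow0.
    apply: mulr_ge0; first by rewrite mulr_ge0// ltW.
    by repeat (apply: addr_ge0; try exact: pow0).
  - apply/measurable_EFinP; have mX (f : Omega -> R) : fm u f -> measurable_fun setT (fun w => f w ^+ q.*2.+2).
      by move=> mf; apply: measurable_funX; exact: fm_measurable mf.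
    apply: measurable_funD; first exact: mX.
    apply: measurable_funM => //; apply: measurable_funD; first exact: mX.
    apply: measurable_funD; last by apply: measurable_funX; apply: measurable_funM => //; exact: fm_measurable mk.
    apply: measurable_funD; last by apply: measurable_funX; apply: measurable_funM => //; exact: fm_measurable mc.
    by apply: measurable_funD; exact: mX.
  - apply: emeasurable_funD; apply: emeasurable_funM => //; apply/measurable_EFinP => //.
    exact: measurable_funX.
  - move=> w _; rewrite -!EFinM -EFinD lee_fin.
    rewrite [leRHS](_ : _ = e w ^+ q.*2.+2 + C * h * (e w ^+ q.*2.+2 + (K * e w ^+ q.*2.+2 + g w))); last ring.
    by rewrite lerD2l ler_wpM2l// ?lerD2l// mulr_ge0// ltW.
have Ch : 0 <= C * h by rewrite mulr_ge0// ltW.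
have p1 : 0 <= 1 + C * h * (1 + K) by rewrite addr_ge0// mulr_ge0// addr_ge0.
have m1 : measurable_fun setT (fun w => (e w ^+ q.*2.+2)%:E) by apply/measurable_EFinP; exact: measurable_funX.
have m2 : measurable_fun setT (fun w => (g w)%:E) by exact/measurable_EFinP.
rewrite ge0_integralD//; last 4 first.
- by move=> w _; rewrite -EFinM lee_fin; apply: mulr_ge0 => //; exact: pow0.
- exact: emeasurable_funM.
- by move=> w _; rewrite -EFinM lee_fin mulr_ge0.
- exact: emeasurable_funM.
rewrite ge0_integralZl//; last by move=> w _; rewrite lee_fin; exact: pow0.
rewrite ge0_integralZl//; last by move=> w _; rewrite lee_fin.
apply: (@le_trans _ _ ((1 + C * h * (1 + K))%:E * x%:E + (C * h)%:E * y%:E)%E).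
  by apply: leeD; apply: lee_wpmul2l => //; rewrite lee_fin.
by rewrite -!EFinM -EFinD lee_fin le_eqVlt; apply/orP; left; apply/eqP; ring.
Qed.

End Filtration.

(* [f1] plays the role of the derivative of [f]. *)
Record smooth_coef {R : realType} (L : R) (f f1 : R -> R) : Prop := SmoothCoef {
  sc_ge1 : 1 <= L ;
  sc0 : f 0 = 0 ;
  sc_lip : forall x y, `|f x - f y| <= L * `|x - y| ;
  sc_bnd1 : forall x, `|f1 x| <= L ;
  sc_lip1 : forall x y, `|f1 x - f1 y| <= L * `|x - y| ;
  sc_taylor : forall x y, `|f y - f x - f1 x * (y - x)| <= L * (y - x) ^+ 2 }.

(** * Lipschitz coefficients and the Milstein coefficient *)

Section Lipschitz.
Context {R : realType}.

Lemma lipschitz_continuous (L : R) (f : R -> R) :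
  (forall x y, `|f x - f y| <= L * `|x - y|) -> continuous f.
Proof.
move=> lip x; have L1 : 0 < `|L| + 1 by rewrite ltr_wpDl.
apply/cvgrPdist_lt => e e0; near=> y.
apply: (le_lt_trans (lip x y)); apply: (@le_lt_trans _ _ ((`|L| + 1) * `|x - y|)).
  by rewrite ler_wpM2r// (le_trans (ler_norm L))// lerDl.
rewrite mulrC -ltr_pdivlMr//; near: y.
by apply: cvgr_dist_lt; [exact: cvg_id|exact: divr_gt0].
Unshelve. all: by end_near. Qed.

Lemma lipschitz_measurable (L : R) (f : R -> R) :
  (forall x y, `|f x - f y| <= L * `|x - y|) -> measurable_fun setT f.
Proof. by move=> lip; apply: continuous_measurable_fun; exact: lipschitz_continuous lip. Qed.

Lemma bounded_pow (x K a b c t : R) q :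
  `|x| <= K * (`|a| + `|b| + `|c| + `|t|) ->
  x ^+ q.*2 <= (4 * K) ^+ q.*2 * (a ^+ q.*2 + b ^+ q.*2 + c ^+ q.*2 + t ^+ q.*2).
Proof.
move=> xK; rewrite -expr_dbl_norm.
have h0 : 0 <= K * (`|a| + `|b| + `|c| + `|t|) by apply: le_trans xK.
apply: (@le_trans _ _ ((K * (`|a| + `|b| + `|c| + `|t|)) ^+ q.*2)).
  by rewrite lerXn2r ?nnegrE.
rewrite exprMn [in leRHS]exprMn [4 ^+ _ * _]mulrC -mulrA.
apply: ler_wpM2l; first exact: expr_dbl_ge0.
by apply: (le_trans (pow_sum4 _ _ _ _ _)); rewrite !expr_dbl_norm.
Qed.

End Lipschitz.

Section Coef.
Context {R : realType} (L : R) (f f1 : R -> R).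
Hypothesis cf : smooth_coef L f f1.

Let L1 := sc_ge1 cf.
Let L0 : 0 <= L. Proof. exact: le_trans L1. Qed.

Lemma sc_ge0 : 0 <= L. Proof. exact: L0. Qed.

Lemma sc_growth x : `|f x| <= L * `|x|.
Proof. by have := sc_lip cf x 0; rewrite (sc0 cf) !subr0. Qed.

Lemma sc_measurable : measurable_fun setT f.
Proof. exact: lipschitz_measurable (sc_lip cf). Qed.

Lemma sc_measurable1 : measurable_fun setT f1.
Proof. exact: lipschitz_measurable (sc_lip1 cf). Qed.

(** Half of g g', the coefficient of dB^2 - h in the Milstein scheme. It grows linearly, but the
    Lipschitz constant available for it grows with the point, which is what forces the two passes
    below. *)
Definition milc (x : R) := 2^-1 * (f x * f1 x).

Lemma milc_growth x : `|milc x| <= L ^+ 2 * `|x|.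
Proof.
rewrite /milc !normrM (ger0_norm (_ : 0 <= 2^-1)) ?invr_ge0//.
have h : `|f x| * `|f1 x| <= (L * `|x|) * L by apply: ler_pM => //; [exact: sc_growth|exact: (sc_bnd1 cf)].
have : 0 <= `|f x| * `|f1 x| by ge0.
by rewrite expr2; lra.
Qed.

Lemma milc_lip x y : `|milc x - milc y| <= L ^+ 2 * (1 + `|y|) * `|x - y|.
Proof.
have -> : milc x - milc y = 2^-1 * ((f x - f y) * f1 x + f y * (f1 x - f1 y)) by rewrite /milc; ring.
rewrite normrM (ger0_norm (_ : 0 <= 2^-1)) ?invr_ge0//.
have h1 : `|(f x - f y) * f1 x| <= L ^+ 2 * `|x - y|.
  rewrite normrM (_ : L ^+ 2 * _ = L * `|x - y| * L); last ring.
  by apply: ler_pM => //; [exact: (sc_lip cf)|exact: (sc_bnd1 cf)].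
have h2 : `|f y * (f1 x - f1 y)| <= L ^+ 2 * `|y| * `|x - y|.
  rewrite normrM (_ : L ^+ 2 * _ * _ = (L * `|y|) * (L * `|x - y|)); last ring.
  by apply: ler_pM => //; [exact: sc_growth|exact: (sc_lip1 cf)].
have := ler_normD ((f x - f y) * f1 x) (f y * (f1 x - f1 y)).
have : 0 <= L ^+ 2 * `|y| * `|x - y| by ge0.
have : 0 <= L ^+ 2 * `|x - y| by ge0.
have -> : L ^+ 2 * (1 + `|y|) * `|x - y| = L ^+ 2 * `|x - y| + L ^+ 2 * `|y| * `|x - y| by ring.
lra.
Qed.

Lemma milc_measurable : measurable_fun setT milc.
Proof.
apply: measurable_funM => //; apply: measurable_funM; first exact: sc_measurable.
exact: sc_measurable1.
Qed.

End Coef.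

(** * Discrete Gronwall inequality *)

Section Gronwall.
Context {R : realType}.

Lemma gronwall (x : nat -> R) (C h y : R) : 0 <= C -> 0 <= h -> 0 <= y ->
  (forall n, x n.+1 <= x n + C * h * (x n + y)) ->
  forall n, x n <= (`|x 0%N| + y) * expR (C * (n%:R * h)).
Proof.
move=> C0 h0 y0 H n.
have Ch : 0 <= C * h by ge0.
suff : x n + y <= (`|x 0%N| + y) * expR (C * (n%:R * h)) by lra.
elim: n => [|n IH]; first by rewrite mul0r mulr0 expR0 mulr1 lerD2r ler_norm.
apply: (@le_trans _ _ ((x n + y) * (1 + C * h))).
  by apply: (le_trans (lerD (H n) (lexx y))); rewrite le_eqVlt; apply/orP; left; apply/eqP; ring.
apply: (le_trans (ler_wpM2r _ IH)); first by ge0.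
rewrite -mulrA; apply: ler_wpM2l; first by ge0.
rewrite -natr1 mulrDl mulrDr expRD mul1r; apply: ler_wpM2l; first exact: expR_ge0.
exact: expR_ge1Dx.
Qed.

End Gronwall.

Section Recursion.
Context {R : realType}.

(** Gronwall for expectations, which are extended reals: the recursion acts on real upper bounds,
    and the sequence of bounds it generates is handled by [gronwall]. It is required only below m,
    that is before the time horizon. *)
Lemma le_erec (E : nat -> \bar R) (C h x0 y : R) (m : nat) : 0 <= C -> 0 <= h -> 0 <= y -> 0 <= x0 ->
  (E 0%N <= x0%:E)%E ->
  (forall n (x : R), (n < m)%N -> 0 <= x -> (E n <= x%:E)%E ->
    (E n.+1 <= (x + C * h * (x + y))%:E)%E) ->
  forall n, (n <= m)%N -> (E n <= ((x0 + y) * expR (C * (n%:R * h)))%:E)%E.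
Proof.
move=> C0 h0 y0 x00 E0 H.
pose x := fix x n := if n is k.+1 then x k + C * h * (x k + y) else x0.
have xge0 n : 0 <= x n by elim: n => [|n IH] //=; ge0.
have Ex n : (n <= m)%N -> (E n <= (x n)%:E)%E.
  by elim: n => [//|n IH] nm /=; apply: H => //; apply: IH; exact: ltnW.
move=> n nm; apply: (le_trans (Ex n nm)); rewrite lee_fin.
have := @gronwall _ x C h y C0 h0 y0 (fun=> lexx _) n.
by rewrite /= (ger0_norm x00).
Qed.

End Recursion.

(** * Moments of Wiener increments *)

Section Moments.
Context d (Omega : measurableType d) (R : realType) (P : probability Omega R).
Variables (Ft : R -> set (set Omega)) (B : R -> Omega -> R).
Hypotheses (hFt : is_filtration Ft) (hB : is_wiener P Ft B).

(** From u^j / j! <= exp u at u = y^2 / (4 s^2), where the exponential has mean sqrt 2. *)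
Lemma normal_moment j : exists2 C : R, 0 <= C & forall s : R, 0 < s ->
  (\int[normal_prob 0 s]_y (y ^+ j.*2)%:E <= (C * s ^+ j.*2)%:E)%E.
Proof.
exists ((j`!)%:R * 4 ^+ j * Num.sqrt 2) => [|s s0]; first by ge0.
have c0 : 0 <= (j`!)%:R * 4 ^+ j * s ^+ j.*2 by ge0.
have := integral_normal_quad s0 (lexx 0) (lexx 0) c0.
rewrite mul0r !add0r => E.
rewrite [leRHS](_ : _ = ((j`!)%:R * 4 ^+ j * s ^+ j.*2 * Num.sqrt 2)%:E); last by congr _%:E; ring.
rewrite -E; apply: ge0_le_integral => //.
- by move=> y _; rewrite lee_fin; ge0.
- by apply/measurable_EFinP; exact: measurable_funX.
- apply/measurable_EFinP; apply: measurable_funD.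
    by apply: measurable_funD => //; apply: measurable_funM => //; exact: measurable_funX.
  apply: measurable_funM => //; apply: measurableT_comp => //; exact: measurable_funM.
- move=> y _; rewrite lee_fin add0r mul0r add0r.
  case: j {c0 E} => [|j]; first by rewrite !expr0 !mulr1 mul1r -expR0 ler_expR; ge0.
  have x0 : 0 <= y ^+ 2 / (4 * s ^+ 2) by ge0.
  have := expR_ge1Dxn j x0; set X := expR _ => h.
  have {}h : (y ^+ 2 / (4 * s ^+ 2)) ^+ j.+1 / (j.+1)`!%:R <= X by lra.
  rewrite ler_pdivrMr ?ltr0n ?fact_gt0// in h.
  have -> : y ^+ (j.+1).*2 = (y ^+ 2 / (4 * s ^+ 2)) ^+ j.+1 * (4 ^+ j.+1 * s ^+ (j.+1).*2).
    rewrite !expr_dbl -exprMn -exprMn divfK//.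
    by rewrite mulf_neq0// sqrf_eq0 gt_eqF.
  apply: (le_trans (ler_wpM2r _ h)); first by ge0.
  by rewrite le_eqVlt; apply/orP; left; apply/eqP; ring.
Qed.

(** The increment is independent of the past factor f, so its even moment, a multiple of h^j, comes
    out. *)
Lemma wiener_moment j : exists2 C : R, 0 <= C &
  forall (u h y : R) (f : Omega -> R), 0 <= u -> 0 < h -> fm Ft u f -> (forall w, 0 <= f w) ->
  (\int[P]_w (f w)%:E <= y%:E)%E ->
  (\int[P]_w (f w * increment B u (u + h) w ^+ j.*2)%:E <= (C * h ^+ j * y)%:E)%E.
Proof.
have [C C0 H] := normal_moment j; exists C => // u h y f u0 h0 mf f0 fy.
have uh : 0 <= u + h by rewrite addr_ge0// ltW.
have uuh : u <= u + h by rewrite lerDl ltW.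
have s0 : 0 < Num.sqrt h by rewrite sqrtr_gt0.
have s2 : Num.sqrt h ^+ j.*2 = h ^+ j by rewrite expr_dbl sqr_sqrtr// ltW.
have mI := fm_measurable hFt uh (fm_increment hFt hB u0 uuh).
have indep (A : set (g_sigma_algebraType (Ft u))) (C' : set R) : measurable A -> measurable C' ->
    P (idfun @^-1` A `&` increment B u (u + h) @^-1` C') =
    (P (idfun @^-1` A) * normal_prob 0 (Num.sqrt h) C')%E.
  move=> mA mC'; have FA : Ft u A by apply/(measurable_Ft hFt).
  have uuh' : u < u + h by rewrite ltrDl.
  have := wiener_indep hB u0 uuh' FA mC'.
  rewrite (wiener_normal hB u0 uuh' mC').
  by rewrite (_ : u + h - u = h) => [E|]; [exact: E|rewrite addrAC subrr add0r].
pose phi (x : g_sigma_algebraType (Ft u) * R) := (f x.1 * x.2 ^+ j.*2)%:E.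
have mphi : measurable_fun setT phi.
  apply/measurable_EFinP; apply: measurable_funM.
    exact: (measurableT_comp mf measurable_fst).
  by apply: measurable_funX; exact: measurable_snd.
rewrite (_ : (\int[P]_w _)%E = \int[P]_w phi (idfun w, increment B u (u + h) w))%E//.
rewrite (integral_indep (measurable_id_Ft hFt u0) mI indep (phi := phi))//; last first.
  by move=> x; rewrite lee_fin; ge0.
have mf' := fm_measurable hFt u0 mf.
have mfE : measurable_fun setT (fun w => (f w)%:E) by exact/measurable_EFinP.
have Ch0 : 0 <= C * h ^+ j by rewrite mulr_ge0// exprn_ge0// ltW.
apply: (@le_trans _ _ (\int[P]_w ((C * h ^+ j)%:E * (f w)%:E))%E).
  apply: ge0_le_integral => //.
  - by move=> w _; apply: integral_ge0 => z _; rewrite lee_fin; ge0.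
  - have mF := @measurable_fun_fubini_tonelli_F _ _ (g_sigma_algebraType (Ft u)) (measurableTypeR R) R
      (normal_prob 0 (Num.sqrt h)) phi mphi.
    apply: (measurableT_comp (mF _) (measurable_id_Ft hFt u0)).
    by move=> x; rewrite lee_fin; ge0.
  - exact: emeasurable_funM.
  - move=> w _; rewrite /phi /=; under eq_integral do rewrite EFinM.
    rewrite ge0_integralZl//; last 3 first.
    + by apply/measurable_EFinP; exact: measurable_funX.
    + by move=> z _; rewrite lee_fin; ge0.
    + by rewrite lee_fin.
    by rewrite muleC; apply: lee_wpmul2r; rewrite ?lee_fin// -s2; exact: H.
rewrite ge0_integralZl//; last by move=> w _; rewrite lee_fin.
by rewrite [leRHS]EFinM; apply: lee_wpmul2l; rewrite ?lee_fin.
Qed.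

Lemma int_add (f g : Omega -> R) (x y : R) : measurable_fun setT f -> measurable_fun setT g ->
  (forall w, 0 <= f w) -> (forall w, 0 <= g w) ->
  (\int[P]_w (f w)%:E <= x%:E)%E -> (\int[P]_w (g w)%:E <= y%:E)%E ->
  (\int[P]_w (f w + g w)%:E <= (x + y)%:E)%E.
Proof.
move=> mf mg f0 g0 fx gy; under eq_integral do rewrite EFinD.
rewrite ge0_integralD//.
- by rewrite EFinD leeD.
- by move=> w _; rewrite lee_fin.
- exact/measurable_EFinP.
- by move=> w _; rewrite lee_fin.
- exact/measurable_EFinP.
Qed.

Lemma int_scale (f : Omega -> R) (c x : R) : measurable_fun setT f ->
  (forall w, 0 <= f w) -> 0 <= c ->
  (\int[P]_w (f w)%:E <= x%:E)%E -> (\int[P]_w (c * f w)%:E <= (c * x)%:E)%E.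
Proof.
move=> mf f0 c0 fx; under eq_integral do rewrite EFinM.
rewrite ge0_integralZl//.
- by rewrite EFinM lee_wpmul2l// lee_fin.
- exact/measurable_EFinP.
- by move=> w _; rewrite lee_fin.
Qed.

Lemma int_le (f g : Omega -> R) (x : R) : measurable_fun setT f -> measurable_fun setT g ->
  (forall w, 0 <= f w) -> (forall w, f w <= g w) ->
  (\int[P]_w (g w)%:E <= x%:E)%E -> (\int[P]_w (f w)%:E <= x%:E)%E.
Proof.
move=> mf mg f0 fg; apply: le_trans; apply: ge0_le_integral => //.
- by move=> w _; rewrite lee_fin.
- exact/measurable_EFinP.
- exact/measurable_EFinP.
- by move=> w _; rewrite lee_fin.
Qed.

Lemma int_cst (c : R) : (\int[P]_w c%:E = c%:E)%E.
Proof.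
by rewrite integral_cst// -[RHS]mule1; congr (_ * _)%E; exact: (@probability_setT _ _ _ P).
Qed.

End Moments.

(** * Taylor bounds for the exponential *)

Section ExpTaylor.
Context {R : realType}.
Implicit Types v x z : R.

(** Mean value theorem: both factors of the bound on the derivative increase with |x|, so
    integrating once raises the power by one. Iterated from exp, this yields the Taylor remainders
    below. *)
Lemma taylor_primitive (phi psi : R -> R) k : phi 0 = 0 ->
  (forall x : R, is_derive x 1 phi (psi x)) ->
  (forall x, `|psi x| <= `|x| ^+ k * expR `|x|) ->
  forall v, `|phi v| <= `|v| ^+ k.+1 * expR `|v|.
Proof.
move=> phi0 dphi psib v.
have cphi x : {for x, continuous phi}.
  by apply: differentiable_continuous; apply/derivable1_diffP; case: (dphi x).
have cont a b : {within `[a, b], continuous phi}.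
  by apply: continuous_subspaceT => x; exact: cphi.
have key c : `|c| <= `|v| -> `|psi c * v| <= `|v| ^+ k.+1 * expR `|v|.
  move=> cv; rewrite normrM exprSr mulrAC ler_wpM2r//.
  apply: (le_trans (psib c)); apply: ler_pM => //; rewrite ?exprn_ge0 ?expR_ge0//.
    by rewrite lerXn2r ?nnegrE.
  by rewrite ler_expR.
have [v0|v0|->] := ltgtP v 0.
- have [c] := MVT v0 (fun x _ => dphi x) (cont _ _).
  rewrite in_itv/= phi0 !sub0r => /andP[vc c0] E.
  have -> : phi v = psi c * v by rewrite -[LHS]opprK E mulrN opprK.
  by apply: key; rewrite !ltr0_norm// lerN2 ltW.
- have [c] := MVT v0 (fun x _ => dphi x) (cont _ _).
  rewrite in_itv/= phi0 !subr0 => /andP[c0 cv] ->.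
  by apply: key; rewrite !gtr0_norm// ltW.
- by rewrite phi0 normr0 expr0n mul0r.
Qed.

Lemma expR_taylor0 v : `|expR v - 1| <= `|v| ^+ 1 * expR `|v|.
Proof.
apply: (@taylor_primitive (fun x => expR x - 1) expR 0%N).
- by rewrite expR0 subrr.
- by move=> x; apply: is_derive_eq; rewrite subr0.
- by move=> x; rewrite expr0 mul1r ger0_norm ?expR_ge0// ler_expR ler_norm.
Qed.

Lemma expR_taylor1 v : `|expR v - 1 - v| <= `|v| ^+ 2 * expR `|v|.
Proof.
apply: (@taylor_primitive (fun x => expR x - 1 - x) (fun x => expR x - 1) 1%N).
- by rewrite expR0 !subrr.
- by move=> x; apply: is_derive_eq; rewrite subr0.
- exact: expR_taylor0.
Qed.

Lemma expR_taylor2 v : `|expR v - 1 - v - 2^-1 * v ^+ 2| <= `|v| ^+ 3 * expR `|v|.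
Proof.
apply: (@taylor_primitive (fun x => expR x - 1 - x - 2^-1 * x ^+ 2) (fun x => expR x - 1 - x) 2%N).
- by rewrite expR0 !subrr expr0n mulr0 subrr.
- move=> x; apply: is_derive_eq; rewrite subr0 /GRing.scale/=; by field.
- exact: expR_taylor1.
Qed.

Lemma expR_taylor3 v : `|expR v - 1 - v - 2^-1 * v ^+ 2 - 6^-1 * v ^+ 3| <= `|v| ^+ 4 * expR `|v|.
Proof.
apply: (@taylor_primitive (fun x => expR x - 1 - x - 2^-1 * x ^+ 2 - 6^-1 * x ^+ 3)
  (fun x => expR x - 1 - x - 2^-1 * x ^+ 2) 3%N).
- by rewrite expR0 !subrr !expr0n !mulr0 !subrr.
- by move=> x; apply: is_derive_eq; rewrite subr0 /GRing.scale/=; by field.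
- exact: expR_taylor2.
Qed.

(** Odd terms cancel between v and -v, so the third-order expansion leaves a remainder of order
    four. *)
Lemma cosh_taylor v :
  `|expR v + expR (- v) - 2 - v ^+ 2| <= 2 * (v ^+ 4 * expR `|v|).
Proof.
have h1 := expR_taylor3 v; have h2 := expR_taylor3 (- v).
have v4 : `|v| ^+ 4 = v ^+ 4 by rewrite -(expr_dbl_norm v 2).
rewrite normrN v4 in h2; rewrite v4 in h1.
rewrite [X in `|X|](_ : _ = (expR v - 1 - v - 2^-1 * v ^+ 2 - 6^-1 * v ^+ 3)
  + (expR (- v) - 1 - - v - 2^-1 * (- v) ^+ 2 - 6^-1 * (- v) ^+ 3)); last by field.
by apply: (le_trans (ler_normD _ _)); lra.
Qed.


Lemma le_poly_exp (m : nat) z (c : R) : 1 <= c ->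
  (1 + z ^+ 2) ^+ m <= c ^+ m * expR (m%:R * (z ^+ 2 / c)).
Proof.
move=> c1; have c0 : 0 < c by lra.
rewrite expRM_natl -exprMn lerXn2r ?nnegrE//.
- by rewrite addr_ge0// sqr_ge0.
- by rewrite mulr_ge0 ?expR_ge0// ltW.
apply: (@le_trans _ _ (c * (1 + z ^+ 2 / c))).
  by rewrite mulrDr mulrCA divff ?gt_eqF// !mulr1 lerD2r.
by apply: ler_wpM2l; [exact: ltW|exact: expR_ge1Dx].
Qed.

(* With [s] small enough, [expR (`|A| + `|D|)] only costs half of the Gaussian weight. *)
Lemma exp_expand (N K : R) : 1 <= N -> 1 <= K -> exists C s0 : R,
  [/\ 0 <= C, 0 < s0 < 1 & forall F f c s z A D : R,
    `|F| <= K -> `|f| <= K -> `|c| <= K -> 0 < s <= s0 ->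
    A = F * s ^+ 2 + c * ((s * z) ^+ 2 - s ^+ 2) -> D = f * (s * z) ->
    `|expR (A + D) - 1 - A - D - 2^-1 * D ^+ 2| <= C * s ^+ 3 * expR (z ^+ 2 / (4 * N)) /\
    `|expR (A + D) + expR (A - D) - 2 - 2 * A - D ^+ 2| <= C * s ^+ 4 * expR (z ^+ 2 / (4 * N))].
Proof.
(* This bound on s makes the exponent w at most 6 K + z^2 / (16 N). The polynomial factor [Q ^+ 4]
   costs another exp(z^2 / (16 N)), so the two together stay below exp(z^2 / (4 N)) up to a
   constant. *)
move=> N1 K1; pose s0 := (64 * N * K)^-1.
have NK1 : 1 <= N * K by rewrite -[leLHS]mulr1 ler_pM.
have s00 : 0 < s0 by rewrite invr_gt0; lra.
have s01 : s0 < 1 by rewrite invf_lt1; lra.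
have N0 : 0 < N by lra.
pose C1 : R := (64 * N) ^+ 4 * expR (6 * K).
have C10 : 0 <= C1 by rewrite /C1; ge0.
exists (200 * K ^+ 4 * C1), s0; split; [by ge0; lra|by rewrite s00 s01|].
move=> F f c s z A D FK fK cK /andP[s_gt0 ss0] AE DE.
have s1 : s <= 1 by lra.
have sK : s * (64 * N * K) <= 1 by rewrite -ler_pdivlMr ?div1r//; lra.
pose Q := 1 + z ^+ 2.
have z20 := sqr_ge0 z.
have Q1 : 1 <= Q by rewrite /Q; lra.
have zQ : `|z| <= Q.
  by rewrite /Q ler_norml; have := sqr_ge0 (z - 1); have := sqr_ge0 (z + 1); rewrite !expr2; lra.
have s2 : s ^+ 2 <= s by rewrite expr2 ler_piMr// ltW.
have s20 := sqr_ge0 s.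
have AQ : `|A| <= 2 * K * (s ^+ 2 * Q).
  rewrite AE (_ : F * s ^+ 2 + _ = s ^+ 2 * (F + c * (z ^+ 2 - 1))); last ring.
  rewrite normrM (ger0_norm s20) mulrCA ler_wpM2l//.
  apply: (le_trans (ler_normD _ _)); rewrite normrM.
  have : `|c| * `|z ^+ 2 - 1| <= K * Q.
    by apply: ler_pM => //; rewrite /Q ler_norml; lra.
  have : K * 1 <= K * Q by rewrite ler_wpM2l//; lra.
  lra.
have DQ : `|D| <= K * (s * Q).
  rewrite DE !normrM (gtr0_norm s_gt0); apply: ler_pM => //; first by ge0.
  by rewrite ler_wpM2l// ltW.
have AQ' : `|A| <= 2 * K * (s * Q).
  by apply: (le_trans AQ); apply: ler_wpM2l; [lra|]; apply: ler_wpM2r => //; lra.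
pose w := `|A| + `|D|.
have wQ : w <= 3 * K * (s * Q) by rewrite /w; lra.
pose X := expR (z ^+ 2 / (4 * N)).
have expw : expR w <= expR (6 * K) * expR (z ^+ 2 / (16 * N)).
  rewrite -expRD ler_expR; apply: (le_trans wQ).
  have -> : 3 * K * (s * Q) = 3 * K * s + 3 * (s * (64 * N * K)) * (z ^+ 2 / (64 * N)).
    by rewrite /Q; field; rewrite gt_eqF.
  have : 3 * (s * (64 * N * K)) * (z ^+ 2 / (64 * N)) <= 3 * (z ^+ 2 / (64 * N)).
    by apply: ler_wpM2r; [apply: divr_ge0; lra|lra].
  have : z ^+ 2 / (16 * N) = 4 * (z ^+ 2 / (64 * N)) by field; rewrite gt_eqF.
  have : 0 <= z ^+ 2 / (64 * N) by apply: divr_ge0; lra.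
  have : 3 * K * s <= 3 * K by rewrite ler_piMr//; lra.
  lra.
have Q4 : Q ^+ 4 <= (64 * N) ^+ 4 * expR (z ^+ 2 / (16 * N)).
  have := @le_poly_exp 4%N z (64 * N); rewrite (_ : 4%:R * _ = z ^+ 2 / (16 * N)); last by field; rewrite gt_eqF.
  by apply; lra.
have main m : (m <= 4)%N -> Q ^+ m * expR w <= C1 * X.
  move=> m4; apply: (@le_trans _ _ (Q ^+ 4 * expR w)).
    by rewrite ler_wpM2r ?expR_ge0// ler_weXn2l.
  have XE : X = expR (z ^+ 2 / (16 * N)) * expR (z ^+ 2 / (16 * N)) * expR (2 * (z ^+ 2 / (16 * N))).
    by rewrite -!expRD /X; congr expR; field; rewrite gt_eqF.
  rewrite /C1 XE [leRHS](_ : _ = ((64 * N) ^+ 4 * expR (z ^+ 2 / (16 * N))) *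
     (expR (6 * K) * expR (z ^+ 2 / (16 * N))) * expR (2 * (z ^+ 2 / (16 * N)))); last ring.
  have e1 : 1 <= expR (2 * (z ^+ 2 / (16 * N))).
    by rewrite -expR0 ler_expR; apply: mulr_ge0 => //; apply: divr_ge0; rewrite ?sqr_ge0// mulr_ge0// ltW.
  have Q40 : 0 <= Q ^+ 4 by rewrite exprn_ge0// (le_trans ler01).
  rewrite -[leLHS]mulr1; apply: ler_pM => //; first by rewrite mulr_ge0// expR_ge0.
  by apply: ler_pM => //; exact: expR_ge0.
have Aw : expR `|A| <= expR w by rewrite ler_expR /w lerDl.
have Dw : expR `|D| <= expR w by rewrite ler_expR /w lerDr.
have K0 : 0 <= K by lra.
have s_ge0 : 0 <= s by lra.
have sQ0 : 0 <= s * Q by ge0; lra.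
have Q0 : 0 <= Q by lra.
have Kp m : (m <= 4)%N -> K ^+ m <= K ^+ 4 by move=> ?; rewrite ler_weXn2l.
have w0 : 0 <= w by rewrite /w addr_ge0.
have ew1 : 1 <= expR w by rewrite -expR0 ler_expR.
(* a generic term bounded by [a * K^m * s^j * Q^m * expR w] *)
have term (T0 a : R) m j l : (m <= 4)%N -> (l <= 4)%N -> 0 <= a ->
    T0 <= a * K ^+ m * s ^+ j * Q ^+ l * expR w -> T0 <= a * (K ^+ 4 * C1 * s ^+ j * X).
  move=> m4 l4 a0 /le_trans; apply.
  rewrite [leLHS](_ : _ = a * ((K ^+ m * (Q ^+ l * expR w)) * s ^+ j)); last ring.
  rewrite [leRHS](_ : _ = a * ((K ^+ 4 * (C1 * X)) * s ^+ j)); last ring.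
  apply: ler_wpM2l => //; apply: ler_wpM2r; first by ge0.
  apply: ler_pM; [by ge0|by ge0|exact: Kp|exact: main].
split.
- have -> : expR (A + D) - 1 - A - D - 2^-1 * D ^+ 2 =
      (expR (A + D) - 1 - (A + D) - 2^-1 * (A + D) ^+ 2) + (2^-1 * A ^+ 2 + A * D) by field.
  apply: (le_trans (ler_normD _ _)).
  have t1 : `|expR (A + D) - 1 - (A + D) - 2^-1 * (A + D) ^+ 2| <= 27 * (K ^+ 4 * C1 * s ^+ 3 * X).
    apply: (term _ _ 3%N 3%N 3%N) => //; apply: (le_trans (expR_taylor2 _)).
    have nw : `|A + D| <= w by exact: ler_normD.
    rewrite (_ : 27 * _ * _ * _ = (3 * K * (s * Q)) ^+ 3); last ring.
    apply: ler_pM; rewrite ?exprn_ge0 ?expR_ge0// ?ler_expR//.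
    by rewrite lerXn2r ?nnegrE// ?(le_trans nw)//; ge0; lra.
  have t2 : `|2^-1 * A ^+ 2 + A * D| <= 4 * (K ^+ 4 * C1 * s ^+ 3 * X).
    apply: (term _ _ 2%N 3%N 2%N) => //.
    apply: (@le_trans _ _ (4 * K ^+ 2 * s ^+ 3 * Q ^+ 2 * 1)); last first.
      by apply: ler_wpM2l => //; ge0.
    apply: (le_trans (ler_normD _ _)); rewrite mulr1 normrM (ger0_norm (_ : 0 <= 2^-1)) ?invr_ge0//.
    rewrite (normrM A D) normrX.
    have a1 : `|A| ^+ 2 <= 2 * K * (s ^+ 2 * Q) * (2 * K * (s * Q)) by rewrite expr2 ler_pM.
    have a2 : `|A| * `|D| <= 2 * K * (s ^+ 2 * Q) * (K * (s * Q)) by rewrite ler_pM.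
    have -> : 4 * K ^+ 2 * s ^+ 3 * Q ^+ 2 = 2^-1 * (2 * K * (s ^+ 2 * Q) * (2 * K * (s * Q)))
      + 2 * K * (s ^+ 2 * Q) * (K * (s * Q)) by field.
    by rewrite lerD// ler_wpM2l.
  have TT0 : 0 <= K ^+ 4 * C1 * s ^+ 3 * X by rewrite /X; ge0.
  rewrite [leRHS](_ : _ = 200 * (K ^+ 4 * C1 * s ^+ 3 * X)); last by rewrite /X; ring.
  by move: t1 t2 TT0; clear; lra.
(* The three summands are of order D^4, A^2 and A D^2; since A is of order s^2 and D of order s,
   each is of order s^4. *)
- have -> : expR (A + D) + expR (A - D) - 2 - 2 * A - D ^+ 2 =
    (expR D + expR (- D) - 2 - D ^+ 2) + 2 * (expR A - 1 - A)
    + (expR A - 1) * ((expR D - 1 - D) + (expR (- D) - 1 - (- D))).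
    by rewrite !expRD; field.
  apply: (le_trans (ler_normD _ _)); apply: (le_trans (lerD (ler_normD _ _) (lexx _))).
  have D2 : `|D| ^+ 2 <= (K * (s * Q)) ^+ 2 by rewrite lerXn2r// nnegrE ?mulr_ge0.
  have t1 : `|expR D + expR (- D) - 2 - D ^+ 2| <= 2 * (K ^+ 4 * C1 * s ^+ 4 * X).
    apply: (term _ _ 4%N 4%N 4%N) => //; apply: (le_trans (cosh_taylor _)).
    rewrite (_ : 2 * _ * _ * _ * _ = 2 * ((K * (s * Q)) ^+ 4 * expR w)); last ring.
    apply: ler_wpM2l => //.
    apply: ler_pM; rewrite ?expR_ge0//; first by rewrite (expr_dbl_ge0 D 2).
    by rewrite -(expr_dbl_norm D 2) lerXn2r// nnegrE ?mulr_ge0.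
  have t2 : `|2 * (expR A - 1 - A)| <= 8 * (K ^+ 4 * C1 * s ^+ 4 * X).
    apply: (term _ _ 2%N 4%N 2%N) => //.
    rewrite normrM (ger0_norm (_ : 0 <= 2))//.
    rewrite (_ : 8 * _ * _ * _ * _ = 2 * ((2 * K * (s ^+ 2 * Q)) ^+ 2 * expR w)); last ring.
    apply: ler_wpM2l => //; apply: (le_trans (expR_taylor1 _)).
    apply: ler_pM; rewrite ?exprn_ge0 ?expR_ge0//.
    by rewrite lerXn2r// nnegrE ?mulr_ge0//; lra.
  have t3 : `|(expR A - 1) * ((expR D - 1 - D) + (expR (- D) - 1 - (- D)))| <= 4 * (K ^+ 4 * C1 * s ^+ 4 * X).
    apply: (term _ _ 3%N 4%N 3%N) => //.
    rewrite normrM (_ : 4 * _ * _ * _ * _ = 2 * ((2 * K * (s ^+ 2 * Q)) * (K * (s * Q)) ^+ 2 * expR w)); last ring.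
    have b1 := expR_taylor0 A; rewrite expr1 in b1.
    have b2 : `|(expR D - 1 - D) + (expR (- D) - 1 - (- D))| <= 2 * (`|D| ^+ 2 * expR `|D|).
      apply: (le_trans (ler_normD _ _)); have := expR_taylor1 D; have := expR_taylor1 (- D).
      by rewrite normrN; lra.
    apply: (le_trans (ler_pM _ _ b1 b2)) => //.
    rewrite [leLHS](_ : _ = 2 * (`|A| * `|D| ^+ 2 * (expR `|A| * expR `|D|))); last ring.
    rewrite -expRD -/w; apply: ler_wpM2l => //; apply: ler_wpM2r; first exact: expR_ge0.
    by apply: ler_pM => //; rewrite exprn_ge0.
  have TT0 : 0 <= K ^+ 4 * C1 * s ^+ 4 * X by rewrite /X; ge0.
  rewrite [leRHS](_ : _ = 200 * (K ^+ 4 * C1 * s ^+ 4 * X)); last by rewrite /X; ring.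
  by move: t1 t2 t3 TT0; clear; lra.
Qed.

End ExpTaylor.

(** * Operations on adapted variables *)

Section FmOps.
Context d (Omega : measurableType d) (R : realType) (Ft : R -> set (set Omega)).
Variable u : R.
Implicit Types f g : Omega -> R.

Lemma fm_cst (c : R) : fm Ft u (fun=> c).
Proof. exact: measurable_cst. Qed.
Lemma fmD f g : fm Ft u f -> fm Ft u g -> fm Ft u (fun w => f w + g w).
Proof. exact: measurable_funD. Qed.
Lemma fmB f g : fm Ft u f -> fm Ft u g -> fm Ft u (fun w => f w - g w).
Proof. exact: measurable_funB. Qed.
Lemma fmM f g : fm Ft u f -> fm Ft u g -> fm Ft u (fun w => f w * g w).
Proof. exact: measurable_funM. Qed.
Lemma fmX f n : fm Ft u f -> fm Ft u (fun w => f w ^+ n).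
Proof. by move=> mf; exact: measurable_funX. Qed.
Lemma fm_comp (k : R -> R) f : measurable_fun setT k -> fm Ft u f -> fm Ft u (fun w => k (f w)).
Proof. by move=> mk mf; exact: (measurableT_comp mk mf). Qed.

End FmOps.

Ltac fmt := repeat (lazymatch goal with
  | |- fm _ _ (fun=> ?c) => exact: fm_cst
  | |- fm _ _ (fun w => @?f w - @?g w) => apply: (@fmB _ _ _ _ _ f g)
  | |- fm _ _ (fun w => @?f w + @?g w) => apply: (@fmD _ _ _ _ _ f g)
  | |- fm _ _ (fun w => @?f w ^+ ?n) => apply: (@fmX _ _ _ _ _ f n)
  | |- fm _ _ (fun w => @?f w * @?g w) => apply: (@fmM _ _ _ _ _ f g)
  | |- fm _ _ (fun w => ?k (@?f w)) => first [assumption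
      | apply: (@fm_comp _ _ _ _ _ k f); first by eauto using sc_measurable, sc_measurable1, milc_measurable]
  | |- fm _ _ _ => assumption
  end).

Lemma pow_dom {R : realType} (a v M : R) q : 0 <= M -> `|a| <= M * `|v| ->
  a ^+ q.*2.+2 <= M ^+ q.*2.+2 * v ^+ q.*2.+2.
Proof.
move=> M0 av; rewrite -!doubleS -(expr_dbl_norm a) -(expr_dbl_norm v) -exprMn.
by rewrite lerXn2r// nnegrE mulr_ge0.
Qed.

Section WienerStep0.
Context d (Omega : measurableType d) (R : realType) (P : probability Omega R).
Variables (Ft : R -> set (set Omega)) (B : R -> Omega -> R).
Hypotheses (hFt : is_filtration Ft) (hB : is_wiener P Ft B).

Lemma wiener_step0 q : exists2 C : R, 0 <= C &
  forall (u h K x y : R) (e a b c g : Omega -> R),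
  0 <= u -> 0 < h <= 1 -> 0 <= K ->
  fm Ft u e -> fm Ft u a -> fm Ft u b -> fm Ft u c ->
  measurable_fun setT g -> (forall w, 0 <= g w) ->
  (forall w, a w ^+ q.*2.+2 + b w ^+ q.*2.+2 + h ^+ q.+1 * c w ^+ q.*2.+2
     <= K * e w ^+ q.*2.+2 + g w) ->
  (\int[P]_w (e w ^+ q.*2.+2)%:E <= x%:E)%E -> (\int[P]_w (g w)%:E <= y%:E)%E ->
  (\int[P]_w ((e w + (a w * h + b w * increment B u (u + h) w
       + c w * (increment B u (u + h) w ^+ 2 - h))) ^+ q.*2.+2)%:E
   <= (x + C * h * ((1 + K) * x + y))%:E)%E.
Proof.
have [C C0 H] := wiener_step hFt hB q; exists C => //.
move=> u h K x y e a b c g u0 h01 K0 me ma mb mc mg g0 dom ex gy.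
under eq_integral do rewrite -[X in e _ + X]addr0.
apply: (H u h K x y e a b c (fun=> 0) g (fun=> 0)) => //.
- exact: fm_cst.
- by move=> w z; rewrite normr0 !mul0r.
- by move=> w z; rewrite addr0 normr0 !mul0r.
- move=> w; rewrite mulr0 (expr0n _ q.*2.+2) addr0; apply: le_trans (dom w).
  rewrite lerD2l exprMn (_ : Num.sqrt h ^+ q.*2.+2 = h ^+ q.+1)//.
  rewrite -doubleS expr_dbl sqr_sqrtr//.
  by case/andP: h01 => /ltW.
Qed.

End WienerStep0.

(** * The Milstein scheme and its moments *)

Section Milstein.
Context {R : realType} (G g g1 : R -> R).

Definition mstep (h D x : R) : R :=
  x + (G x * h + g x * D + milc g g1 x * (D ^+ 2 - h)).

(** Auxiliary scheme standing between the exponential scheme and the solution. It may become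
    negative, hence coefficients defined on the whole line. *)
Fixpoint mil {Omega : Type} (B : R -> Omega -> R) (x0 h : R) (n : nat) (w : Omega) : R :=
  if n is m.+1 then mstep h (B (m%:R * h + h) w - B (m%:R * h) w) (mil B x0 h m w)
  else x0.

End Milstein.

Section MilsteinMoments.
Context d (Omega : measurableType d) (R : realType) (P : probability Omega R).
Variables (Ft : R -> set (set Omega)) (B : R -> Omega -> R).
Hypotheses (hFt : is_filtration Ft) (hB : is_wiener P Ft B).
Variables (G G1 g g1 : R -> R) (L x0 : R).
Hypotheses (cG : smooth_coef L G G1) (cg : smooth_coef L g g1).
Local Notation mil := (mil G g g1 B x0).
Local Notation cc := (milc g g1).

Let L1 : 1 <= L. Proof. exact: sc_ge1 cG. Qed.
Let L0 : 0 <= L. Proof. exact: sc_ge0 cG. Qed.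

Lemma succ_time (m : nat) (h : R) : m.+1%:R * h = m%:R * h + h.
Proof. by rewrite -natr1 mulrDl mul1r. Qed.

Lemma mil_fm h n : 0 <= h -> fm Ft (n%:R * h) (mil h n).
Proof.
move=> h0; elim: n => [|n IH] /=; first exact: fm_cst.
have nh : 0 <= n%:R * h by ge0.
have le : n%:R * h <= n.+1%:R * h by rewrite succ_time lerDl.
have mB1 : fm Ft (n.+1%:R * h) (B (n%:R * h + h)).
  by rewrite succ_time; apply: (fm_wiener hFt hB); rewrite addr_ge0.
have mB0 : fm Ft (n.+1%:R * h) (B (n%:R * h)).
  by apply: (fm_mono hFt nh le); exact: (fm_wiener hFt hB).
have {}IH := fm_mono hFt nh le IH.
by rewrite /mstep; fmt.
Qed.

(** [wiener_step0] with the scheme itself in the role of the error: G, g and [milc] have linear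
    growth, so no source is left. *)
Lemma mil_moment q (T : R) : exists2 K : R, 0 <= K & forall (h : R) (n : nat), 0 < h <= 1 ->
  n%:R * h <= T -> (\int[P]_w (mil h n w ^+ q.*2.+2)%:E <= K%:E)%E.
Proof.
have [C C0 H] := wiener_step0 hFt hB q.
pose K0 := L ^+ q.*2.+2 + L ^+ q.*2.+2 + (L ^+ 2) ^+ q.*2.+2.
have K00 : 0 <= K0 by rewrite /K0; ge0.
pose xx := x0 ^+ q.*2.+2.
have xx0 : 0 <= xx by rewrite /xx -doubleS; ge0.
exists ((xx + 0) * expR (C * (1 + K0) * T)) => [|h n h01 nT]; first by ge0.
have h0 : 0 < h by case/andP: h01.
have h1 : h <= 1 by case/andP: h01.
have hge0 := ltW h0.
have Ck : 0 <= C * (1 + K0) by ge0.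
apply: (@le_trans _ _ ((xx + 0) * expR (C * (1 + K0) * (n%:R * h)))%:E); last first.
  by rewrite lee_fin; apply: ler_wpM2l; [rewrite addr0|rewrite ler_expR; apply: ler_wpM2l].
apply: (@le_erec _ (fun n => \int[P]_w (mil h n w ^+ q.*2.+2)%:E)%E _ _ _ _ n) => //.
  by rewrite /= int_cst.
move=> m x mn x_ge0 mx.
have u0 : 0 <= m%:R * h by ge0.
have mm := @mil_fm h m hge0.
have mG : fm Ft (m%:R * h) (fun w => G (mil h m w)) by fmt.
have mg : fm Ft (m%:R * h) (fun w => g (mil h m w)) by fmt.
have mc : fm Ft (m%:R * h) (fun w => cc (mil h m w)) by fmt.
rewrite [leRHS](_ : _ = (x + C * h * ((1 + K0) * x + 0))%:E); last by congr _%:E; ring.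
apply: (H _ _ K0 x 0 (mil h m) (fun w => G (mil h m w)) (fun w => g (mil h m w))
  (fun w => cc (mil h m w)) (fun=> 0)) => //; last by rewrite int_cst.
move=> w; rewrite addr0 /K0 !mulrDl.
apply: lerD; first by apply: lerD; apply: pow_dom => //; [exact: sc_growth cG _|exact: sc_growth cg _].
apply: (@le_trans _ _ (1 * cc (mil h m w) ^+ q.*2.+2)).
  by apply: ler_wpM2r; [rewrite -doubleS; ge0|rewrite exprn_ile1].
by rewrite mul1r; apply: pow_dom; [ge0|exact: milc_growth].
Qed.

End MilsteinMoments.

(** * Coefficient estimates for one step of length 2h against two of length h *)

Lemma half_step2_sum {R : realFieldType} (a1 b1 c1 A1 B1 hq1 e1 p1 q1 d1 D1 : R) : 0 <= hq1 -> 0 <= A1 -> 0 <= B1 -> 0 <= e1 -> 0 <= p1 ->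
    0 <= q1 -> 0 <= d1 -> 0 <= D1 -> a1 <= A1 * (e1 + p1) -> b1 <= A1 * (e1 + p1 + d1 * D1) ->
    c1 <= hq1 * (B1 * (d1 + q1)) ->
    a1 + b1 + c1 <= (2 * A1 + B1) * (e1 + (hq1 * d1 + d1 * D1) + (p1 + hq1 * q1)).
Proof.
move=> h0 A0 B0 e0 p0 q0 d0 D0 a b c.
  have -> : (2 * A1 + B1) * (e1 + (hq1 * d1 + d1 * D1) + (p1 + hq1 * q1)) =
    A1 * (e1 + p1) + A1 * (e1 + p1 + d1 * D1) + hq1 * (B1 * (d1 + q1))
    + (A1 * (d1 * D1) + 2 * (A1 * (hq1 * d1)) + 2 * (A1 * (hq1 * q1)) + B1 * e1 + B1 * p1 + B1 * (d1 * D1)) by ring.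
  have : 0 <= A1 * (d1 * D1) + 2 * (A1 * (hq1 * d1)) + 2 * (A1 * (hq1 * q1)) + B1 * e1 + B1 * p1 + B1 * (d1 * D1).
    by ge0.
  by lra.
Qed.

Section HalfSteps.
Context {R : realType} (G G1 g g1 : R -> R) (L : R).
Hypotheses (cG : smooth_coef L G G1) (cg : smooth_coef L g g1).
Local Notation cc := (milc g g1).

Let L1 : 1 <= L. Proof. exact: sc_ge1 cG. Qed.
Let L0 : 0 <= L. Proof. exact: sc_ge0 cG. Qed.

Lemma mstep_remainder h D Z : 0 < h <= 1 ->
  `|mstep G g g1 h D Z - Z - g Z * D| <= 2 * L ^+ 2 * (`|Z| * (h + D ^+ 2)).
Proof.
move=> /andP[h0 h1].
have -> : mstep G g g1 h D Z - Z - g Z * D = G Z * h + cc Z * (D ^+ 2 - h) by rewrite /mstep; ring.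
apply: (le_trans (ler_normD _ _)); rewrite (normrM (G Z)) (normrM (cc Z)) (gtr0_norm h0).
have D2 := sqr_ge0 D.
have n1 : `|D ^+ 2 - h| <= h + D ^+ 2 by rewrite ler_norml; lra.
have p1 : `|G Z| * h <= L ^+ 2 * `|Z| * h.
  apply: ler_wpM2r; first exact: ltW.
  by apply: (le_trans (sc_growth cG Z)); apply: ler_wpM2r => //; rewrite expr2 ler_peMl.
have p2 : `|cc Z| * `|D ^+ 2 - h| <= L ^+ 2 * `|Z| * (h + D ^+ 2).
  by apply: ler_pM => //; exact: milc_growth cg Z.
have p3 : 0 <= L ^+ 2 * `|Z| * D ^+ 2 by ge0.
have -> : 2 * L ^+ 2 * (`|Z| * (h + D ^+ 2)) = L ^+ 2 * `|Z| * h + L ^+ 2 * `|Z| * (h + D ^+ 2)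
   + L ^+ 2 * `|Z| * D ^+ 2 by ring.
by lra.
Qed.

Lemma mstep_increment h D Z : 0 < h <= 1 ->
  `|mstep G g g1 h D Z - Z| <= 2 * L ^+ 2 * (`|Z| * (`|D| + h + D ^+ 2)).
Proof.
move=> h01; have r := mstep_remainder D Z h01.
have -> : mstep G g g1 h D Z - Z = g Z * D + (mstep G g g1 h D Z - Z - g Z * D) by ring.
apply: (le_trans (ler_normD _ _)).
have p : `|g Z * D| <= 2 * L ^+ 2 * (`|Z| * `|D|).
  rewrite normrM mulrA; apply: ler_wpM2r => //.
  apply: (le_trans (sc_growth cg Z)); apply: ler_wpM2r => //.
  have LL : L <= L * L by rewrite ler_peMr.
  by rewrite expr2; have := mulr_ge0 L0 L0; lra.
have -> : 2 * L ^+ 2 * (`|Z| * (`|D| + h + D ^+ 2)) = 2 * L ^+ 2 * (`|Z| * `|D|)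
   + 2 * L ^+ 2 * (`|Z| * (h + D ^+ 2)) by ring.
exact: lerD.
Qed.

(** One step moves Z by g(Z) D up to terms of order h + D^2; the first-order variation of f is thus
    f'(Z) g(Z) D, and the correction on the left removes it. *)
Lemma sc_taylor_mstep f f1 h D Y Z Z' : smooth_coef L f f1 -> 0 < h <= 1 ->
  Z' = mstep G g g1 h D Z ->
  `|f Y - f Z' + f1 Z * (g Z * D)| <= 24 * L ^+ 5 * (`|Y - Z| + `|(1 + Z ^+ 2) * (h + D ^+ 2 + D ^+ 4)|).
Proof.
move=> cf h01 Z'E.
set V := Z' - Z; set R1 := Z' - Z - g Z * D.
have -> : f Y - f Z' + f1 Z * (g Z * D) =
   (f Y - f Z) + (- (f Z' - f Z - f1 Z * V) + - (f1 Z * R1)) by rewrite /R1 /V; ring.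
have hV := mstep_increment D Z h01; have hR := mstep_remainder D Z h01.
case/andP: h01 => h0 h1.
rewrite -Z'E -/V in hV; rewrite -Z'E -/R1 in hR.
have D4E : D ^+ 4 = D ^+ 2 * D ^+ 2 by ring.
have D2 := sqr_ge0 D; have Z2 := sqr_ge0 Z.
have D4 : 0 <= D ^+ 4 by rewrite D4E mulr_ge0.
have P0 : 0 <= (1 + Z ^+ 2) * (h + D ^+ 2 + D ^+ 4) by apply: mulr_ge0; lra.
rewrite (ger0_norm P0); set PP := (1 + Z ^+ 2) * _ in P0 *.
have LL k : 1 <= L ^+ k by rewrite exprn_ege1.
have L15 : L <= L ^+ 5 by rewrite [leRHS]exprS ler_peMr.
have L25 : L ^+ 3 <= L ^+ 5 by rewrite ler_weXn2l.
have t1 : `|f Y - f Z| <= L ^+ 5 * `|Y - Z|.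
  by apply: (le_trans (sc_lip cf _ _)); apply: ler_wpM2r.
have zz : `|Z| <= 1 + Z ^+ 2.
  by rewrite ler_norml; have := sqr_ge0 (Z - 1); have := sqr_ge0 (Z + 1); rewrite !expr2; lra.
have t3 : `|f1 Z * R1| <= 2 * L ^+ 5 * PP.
  rewrite normrM; apply: (@le_trans _ _ (L * (2 * L ^+ 2 * (`|Z| * (h + D ^+ 2))))).
    by apply: ler_pM => //; exact: (sc_bnd1 cf).
  rewrite (_ : L * _ = 2 * L ^+ 3 * (`|Z| * (h + D ^+ 2))); last ring.
  apply: ler_pM; [by ge0| |by apply: ler_wpM2l|]; first by apply: mulr_ge0 => //; lra.
  by rewrite /PP; apply: ler_pM => //; lra.
have V2 : V ^+ 2 <= 12 * L ^+ 4 * PP.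
  rewrite -(ger0_norm (sqr_ge0 V)) normrX.
  apply: (@le_trans _ _ ((2 * L ^+ 2 * (`|Z| * (`|D| + h + D ^+ 2))) ^+ 2)).
    by rewrite lerXn2r// nnegrE; ge0.
  have -> : (2 * L ^+ 2 * (`|Z| * (`|D| + h + D ^+ 2))) ^+ 2 =
     4 * L ^+ 4 * (`|Z| ^+ 2 * (`|D| + h + D ^+ 2) ^+ 2) by ring.
  rewrite -normrX (ger0_norm Z2).
  have d2 : (`|D| + h + D ^+ 2) ^+ 2 <= 3 * (h + D ^+ 2 + D ^+ 4).
    have nD2 : `|D| ^+ 2 = D ^+ 2 by rewrite -normrX ger0_norm.
    have hh : h ^+ 2 <= h by rewrite expr2 ler_piMr// ltW.
    have e1 := sqr_ge0 (`|D| - h); have e2 := sqr_ge0 (`|D| - D ^+ 2); have e3 := sqr_ge0 (h - D ^+ 2).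
    have -> : (`|D| + h + D ^+ 2) ^+ 2 = 3 * (`|D| ^+ 2 + h ^+ 2 + (D ^+ 2) ^+ 2)
       - (`|D| - h) ^+ 2 - (`|D| - D ^+ 2) ^+ 2 - (h - D ^+ 2) ^+ 2 by ring.
    rewrite nD2 -[(D ^+ 2) ^+ 2]exprM; lra.
  rewrite (_ : 12 * L ^+ 4 * PP = 4 * L ^+ 4 * ((1 + Z ^+ 2) * (3 * (h + D ^+ 2 + D ^+ 4)))); last by rewrite /PP; ring.
  apply: ler_wpM2l; first by ge0.
  apply: ler_pM => //; first by ge0.
  by rewrite lerDr.
have t2 : `|f Z' - f Z - f1 Z * V| <= 12 * L ^+ 5 * PP.
  apply: (le_trans (sc_taylor cf Z Z')); rewrite -/V.
  by rewrite (_ : 12 * L ^+ 5 * PP = L * (12 * L ^+ 4 * PP)); [apply: ler_wpM2l|ring].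
have LP : 0 <= L ^+ 5 * PP by ge0.
have LY : 0 <= L ^+ 5 * `|Y - Z| by ge0.
apply: (le_trans (ler_normD _ _)).
have := ler_normD (- (f Z' - f Z - f1 Z * V)) (- (f1 Z * R1)).
rewrite !normrN (mulrDr (24 * L ^+ 5)) -!(mulrA 24).
rewrite -(mulrA 12) in t2; rewrite -(mulrA 2) in t3.
by move: (L ^+ 5 * PP) (L ^+ 5 * `|Y - Z|) LP LY t1 t2 t3 => *; lra.
Qed.

Lemma milc_mstep h D Y Z Z' : 0 < h <= 1 -> Z' = mstep G g g1 h D Z ->
  `|cc Y - cc Z'| <= 8 * L ^+ 4 * (`|cc Y - cc Z| + `|(1 + Z ^+ 2) * (`|D| + h + D ^+ 2)|).
Proof.
move=> h01 Z'E; have hV := mstep_increment D Z h01; case/andP: h01 => h0 h1; rewrite -Z'E in hV.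
have D2 := sqr_ge0 D; have Z2 := sqr_ge0 Z; have nD := normr_ge0 D.
have P0 : 0 <= (1 + Z ^+ 2) * (`|D| + h + D ^+ 2) by apply: mulr_ge0; lra.
rewrite (ger0_norm P0).
have -> : cc Y - cc Z' = (cc Y - cc Z) + (cc Z - cc Z') by ring.
have L41 : 1 <= L ^+ 4 by rewrite exprn_ege1.
have LL : 1 <= 8 * L ^+ 4 by lra.
have h2 : `|cc Z - cc Z'| <= 8 * L ^+ 4 * ((1 + Z ^+ 2) * (`|D| + h + D ^+ 2)).
  rewrite distrC; apply: (le_trans (milc_lip cg _ _)).
  apply: (@le_trans _ _ (L ^+ 2 * (1 + `|Z|) * (2 * L ^+ 2 * (`|Z| * (`|D| + h + D ^+ 2))))).
    by apply: ler_wpM2l => //; ge0.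
  rewrite [leLHS](_ : _ = 2 * L ^+ 4 * (((1 + `|Z|) * `|Z|) * (`|D| + h + D ^+ 2))); last ring.
  rewrite [leRHS](_ : _ = 2 * L ^+ 4 * ((4 * (1 + Z ^+ 2)) * (`|D| + h + D ^+ 2))); last ring.
  apply: ler_wpM2l; first by ge0.
  apply: ler_wpM2r; first by lra.
  have nZ2 : `|Z| ^+ 2 = Z ^+ 2 by rewrite -normrX ger0_norm.
  by have := sqr_ge0 (`|Z| - 1); rewrite -nZ2 !expr2; nra.
apply: (le_trans (ler_normD _ _)); rewrite (mulrDr (8 * L ^+ 4)); apply: lerD => //.
by rewrite ler_peMl.
Qed.

(** Coefficients of dt and dB in the first half step. The term [h * (G1 Z * g Z)] is imported from
    the drift of the second half, as explained at [mil_double_step]. *)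
Lemma half_step1 q : exists2 K : R, 0 <= K & forall Y Z h : R, 0 < h <= 1 ->
  (G Y - G Z) ^+ q.*2.+2 + (g Y - g Z - h * (G1 Z * g Z)) ^+ q.*2.+2
  <= K * ((Y - Z) ^+ q.*2.+2 + h ^+ q.*2.+2 * Z ^+ q.*2.+2).
Proof.
exists (L ^+ q.*2.+2 + (4 * L ^+ 2) ^+ q.*2.+2) => [|Y Z h /andP[h0 h1]]; first by ge0.
have hge0 := ltW h0.
have p0 : 0 <= (Y - Z) ^+ q.*2.+2 by rewrite -doubleS; ge0.
have z0 : 0 <= h ^+ q.*2.+2 * Z ^+ q.*2.+2 by rewrite -!doubleS; ge0.
have a : (G Y - G Z) ^+ q.*2.+2 <= L ^+ q.*2.+2 * (Y - Z) ^+ q.*2.+2.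
  by apply: pow_dom => //; exact: (sc_lip cG).
have b : (g Y - g Z - h * (G1 Z * g Z)) ^+ q.*2.+2 <=
    (4 * L ^+ 2) ^+ q.*2.+2 * ((Y - Z) ^+ q.*2.+2 + h ^+ q.*2.+2 * Z ^+ q.*2.+2).
  rewrite -exprMn -!doubleS.
  have := @bounded_pow R (g Y - g Z - h * (G1 Z * g Z)) (L ^+ 2) (Y - Z) (h * Z) 0 0 q.+1.
  rewrite !normr0 !addr0 doubleS (expr0n _ q.*2.+2) !addr0; apply.
  apply: (le_trans (ler_normB _ _)); rewrite mulrDr; apply: lerD.
    apply: (le_trans (sc_lip cg _ _)); apply: ler_wpM2r => //.
    by rewrite expr2 ler_peMl.
  rewrite !normrM [leRHS]mulrCA; apply: ler_wpM2l => //.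
  rewrite expr2 -mulrA; apply: ler_pM => //; [exact: (sc_bnd1 cG)|exact: sc_growth cg Z].
have LL : 0 <= L ^+ q.*2.+2 by ge0.
have := mulr_ge0 LL z0; rewrite mulrDl; move: a b; rewrite (mulrDr (L ^+ _)); lra.
Qed.

(** Coefficients in the second half step, given the first increment D. First-order variations are
    compensated: in the drift by the term moved to the first half, in the diffusion by
    [2 * cc Y * D], the cross term of the squared double increment. The coefficient of D^2 - h needs
    no such correction, thanks to its weight h^(q+1). *)
Lemma half_step2 q : exists2 K : R, 0 <= K & forall Y Z Z' h D : R, 0 < h <= 1 ->
  Z' = mstep G g g1 h D Z ->
  (G Y - G Z' + G1 Z * g Z * D) ^+ q.*2.+2 + (g Y + 2 * cc Y * D - g Z') ^+ q.*2.+2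
  + h ^+ q.+1 * (cc Y - cc Z') ^+ q.*2.+2
  <= K * ((Y - Z) ^+ q.*2.+2 + (h ^+ q.+1 * (cc Y - cc Z) ^+ q.*2.+2 + (cc Y - cc Z) ^+ q.*2.+2 * D ^+ q.*2.+2)
     + (((1 + Z ^+ 2) * (h + D ^+ 2 + D ^+ 4)) ^+ q.*2.+2
        + h ^+ q.+1 * ((1 + Z ^+ 2) * (`|D| + h + D ^+ 2)) ^+ q.*2.+2)).
Proof.
pose K1 := 24 * L ^+ 5; pose K2 := 8 * L ^+ 4.
have L51 : 1 <= L ^+ 5 by rewrite exprn_ege1.
have K1_ge2 : 2 <= K1 by rewrite /K1; lra.
exists (2 * (4 * K1) ^+ q.*2.+2 + (4 * K2) ^+ q.*2.+2) => [|Y Z Z' h D h01 Z'E].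
  by rewrite /K1 /K2; ge0.
set PP := (1 + Z ^+ 2) * (h + _ + _); set QQ := (1 + Z ^+ 2) * (`|D| + _ + _); set dC := cc Y - cc Z.
have a : (G Y - G Z' + G1 Z * g Z * D) ^+ q.*2.+2 <= (4 * K1) ^+ q.*2.+2 * ((Y - Z) ^+ q.*2.+2 + PP ^+ q.*2.+2).
  rewrite -!doubleS; have := @bounded_pow R (G Y - G Z' + G1 Z * g Z * D) K1 (Y - Z) PP 0 0 q.+1.
  rewrite !normr0 !addr0 doubleS (expr0n _ q.*2.+2) !addr0; apply.
  by rewrite -mulrA; exact: (sc_taylor_mstep Y cG h01 Z'E).
have b : (g Y + 2 * cc Y * D - g Z') ^+ q.*2.+2 <=
   (4 * K1) ^+ q.*2.+2 * ((Y - Z) ^+ q.*2.+2 + PP ^+ q.*2.+2 + dC ^+ q.*2.+2 * D ^+ q.*2.+2).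
  rewrite -exprMn -!doubleS; have := @bounded_pow R (g Y + 2 * cc Y * D - g Z') K1 (Y - Z) PP (dC * D) 0 q.+1.
  rewrite !normr0 !addr0 doubleS (expr0n _ q.*2.+2) !addr0; apply.
  have -> : g Y + 2 * cc Y * D - g Z' = (g Y - g Z' + g1 Z * (g Z * D)) + 2 * (dC * D).
    by rewrite /dC /milc; field.
  apply: (le_trans (ler_normD _ _)); rewrite (mulrDr K1); apply: lerD.
    exact: (sc_taylor_mstep Y cg h01 Z'E).
  by rewrite normrM (ger0_norm (_ : 0 <= 2))//; apply: ler_wpM2r.
have c : (cc Y - cc Z') ^+ q.*2.+2 <= (4 * K2) ^+ q.*2.+2 * (dC ^+ q.*2.+2 + QQ ^+ q.*2.+2).
  rewrite -!doubleS; have := @bounded_pow R (cc Y - cc Z') K2 dC QQ 0 0 q.+1.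
  rewrite !normr0 !addr0 doubleS (expr0n _ q.*2.+2) !addr0; apply.
  exact: (milc_mstep Y h01 Z'E).
have hq : 0 <= h ^+ q.+1 by case/andP: h01 => h0 _; rewrite exprn_ge0// ltW.
have {}c := ler_wpM2l hq c.
have [A0 B0] : 0 <= (4 * K1) ^+ q.*2.+2 /\ 0 <= (4 * K2) ^+ q.*2.+2 by split; rewrite -doubleS; ge0.
have pw (x : R) : 0 <= x ^+ q.*2.+2 by rewrite -doubleS; ge0.
exact: half_step2_sum.
Qed.

End HalfSteps.

Section HalfStepRemainder.
Context {R : realType}.

(** Separates the remainders into monomials f0 * D^j with f0 known before the increment, the form in
    which [wiener_moment] applies. *)
Lemma half_step_rem q : exists2 K : R, 0 <= K & forall Z h D f0 : R, 0 < h <= 1 ->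
  f0 = 1 + Z ^+ (q.*2.+2).*2 ->
  (((1 + Z ^+ 2) * (h + D ^+ 2 + D ^+ 4)) ^+ q.*2.+2
   + h ^+ q.+1 * ((1 + Z ^+ 2) * (`|D| + h + D ^+ 2)) ^+ q.*2.+2)
  <= K * (h ^+ q.*2.+2 * f0 + (f0 * D ^+ (q.*2.+2).*2 + (f0 * D ^+ (q.*2.+2).*2.*2
     + h ^+ q.+1 * (f0 * D ^+ q.+1.*2)))) :> R.
Proof.
exists (3 * (4 ^+ q.*2.+2 * 4 ^+ q.*2.+2)) => [|Z h D f0 /andP[h0 h1] f0E]; first by ge0.
have hge0 := ltW h0.
pose F : R := 4 ^+ q.*2.+2; have F0 : 0 <= F by rewrite /F; ge0.
set N := q.*2.+2; have N2 : N = q.+1.*2 by rewrite doubleS.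
have D2N : (D ^+ 2) ^+ N = D ^+ N.*2 by rewrite expr_dbl.
have D4N : (D ^+ 4) ^+ N = D ^+ N.*2.*2 by rewrite -exprM -!mul2n mulnA.
have Z2N : (Z ^+ 2) ^+ N = Z ^+ N.*2 by rewrite expr_dbl.
have z1 : (1 + Z ^+ 2) ^+ N <= F * f0.
  have := pow_sum4 1 (Z ^+ 2) 0 0 q.+1.
  by rewrite !addr0 doubleS (expr0n _ q.*2.+2) !addr0 expr1n -/N Z2N -f0E.
have d1 : (h + D ^+ 2 + D ^+ 4) ^+ N <= F * (h ^+ N + D ^+ N.*2 + D ^+ N.*2.*2).
  have := pow_sum4 h (D ^+ 2) (D ^+ 4) 0 q.+1.
  by rewrite !addr0 doubleS (expr0n _ q.*2.+2) !addr0 -/N D2N D4N.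
have d2 : (`|D| + h + D ^+ 2) ^+ N <= F * (D ^+ q.+1.*2 + h ^+ N + D ^+ N.*2).
  have := pow_sum4 `|D| h (D ^+ 2) 0 q.+1.
  by rewrite !addr0 expr_dbl_norm doubleS (expr0n _ q.*2.+2) !addr0 -/N D2N.
have f00 : 0 <= f0 by rewrite f0E; ge0.
have zp : 0 <= (1 + Z ^+ 2) ^+ N by rewrite N2; ge0.
have hN : 0 <= h ^+ N by rewrite exprn_ge0.
have hq : 0 <= h ^+ q.+1 by rewrite exprn_ge0.
have hq1 : h ^+ q.+1 <= 1 by rewrite exprn_ile1.
have dN : 0 <= D ^+ q.+1.*2 by ge0.
have d2N : 0 <= D ^+ N.*2 by ge0.
have d4N : 0 <= D ^+ N.*2.*2 by ge0.
rewrite !exprMn.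
have p1 : (1 + Z ^+ 2) ^+ N * (h + D ^+ 2 + D ^+ 4) ^+ N <=
   F * F * (f0 * (h ^+ N + D ^+ N.*2 + D ^+ N.*2.*2)).
  rewrite (_ : F * F * _ = F * f0 * (F * (h ^+ N + D ^+ N.*2 + D ^+ N.*2.*2))); last ring.
  by apply: ler_pM => //; rewrite N2; ge0.
have p2 : h ^+ q.+1 * ((1 + Z ^+ 2) ^+ N * (`|D| + h + D ^+ 2) ^+ N) <=
   F * F * (h ^+ q.+1 * (f0 * (D ^+ q.+1.*2 + h ^+ N + D ^+ N.*2))).
  rewrite (_ : F * F * _ = h ^+ q.+1 * (F * f0 * (F * (D ^+ q.+1.*2 + h ^+ N + D ^+ N.*2)))); last ring.
  by apply: ler_wpM2l => //; apply: ler_pM => //; rewrite N2; ge0.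
have p3 : h ^+ q.+1 * (f0 * (h ^+ N + D ^+ N.*2)) <= f0 * (h ^+ N + D ^+ N.*2).
  by rewrite ler_piMl//; apply: mulr_ge0 => //; apply: addr_ge0.
have p4 : 0 <= f0 * (h ^+ N) by apply: mulr_ge0.
have p5 : 0 <= f0 * (D ^+ N.*2) by apply: mulr_ge0.
have p6 : 0 <= f0 * (D ^+ N.*2.*2) by apply: mulr_ge0.
have p7 : 0 <= h ^+ q.+1 * (f0 * D ^+ q.+1.*2) by apply: mulr_ge0 => //; apply: mulr_ge0.
have e1 : f0 * (h ^+ N + D ^+ N.*2 + D ^+ N.*2.*2) = f0 * h ^+ N + f0 * D ^+ N.*2 + f0 * D ^+ N.*2.*2 by ring.
have e2 : h ^+ q.+1 * (f0 * (D ^+ q.+1.*2 + h ^+ N + D ^+ N.*2)) =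
   h ^+ q.+1 * (f0 * D ^+ q.+1.*2) + h ^+ q.+1 * (f0 * (h ^+ N + D ^+ N.*2)) by ring.
have e3 : f0 * (h ^+ N + D ^+ N.*2) = f0 * h ^+ N + f0 * D ^+ N.*2 by ring.
apply: (le_trans (lerD p1 p2)); rewrite e1 e2; move: p3; rewrite e3.
rewrite -/N -/F -(mulrDr (F * F)) (mulrC _ f0) -(mulrA 3) (mulrCA 3); move=> p3; apply: ler_wpM2l; first by apply: mulr_ge0.
move: p3 p4 p5 p6 p7.
move: (f0 * h ^+ N) (f0 * D ^+ N.*2) (f0 * D ^+ N.*2.*2) (h ^+ q.+1 * (f0 * D ^+ q.+1.*2)) => a b c t.
rewrite mulrDr; move: (h ^+ q.+1 * a) (h ^+ q.+1 * b) => v v'.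
by lra.
Qed.

End HalfStepRemainder.

Ltac nneg p1 p2 p3 := repeat first [ exact: p1 | exact: p2 | exact: p3 | done
  | match goal with
    | |- is_true (0 <= _ + _) => apply: addr_ge0
    | |- is_true (0 <= _ * _) => apply: mulr_ge0
    end ].

(** * Propagation of the difference between the steps 2h and h *)

Section DoubleStep.
Context d (Omega : measurableType d) (R : realType) (P : probability Omega R).
Variables (Ft : R -> set (set Omega)) (B : R -> Omega -> R).
Hypotheses (hFt : is_filtration Ft) (hB : is_wiener P Ft B).
Variables (G G1 g g1 : R -> R) (L x0 : R).
Hypotheses (cG : smooth_coef L G G1) (cg : smooth_coef L g g1).
Local Notation mil := (mil G g g1 B x0).
Local Notation cc := (milc g g1).

(** The step of length 2h is read as two half steps with increments d1 and d2. In the second half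
    the drift difference contains - G1(Z) g(Z) d1, of order sqrt(h), which would ruin order one.
    Multiplied by h it is a multiple of d1, so it is charged to the first half as part of the
    coefficient of d1, where it is of order h. [wiener_step0] is then applied twice; y measures the
    discrepancy of the Milstein coefficients, left open at this stage. *)
Lemma mil_double_step q : exists2 C : R, 0 <= C & forall (h : R) (n : nat) (x y W : R),
  0 < h <= 1 -> 0 <= x -> 0 <= y -> 0 <= W ->
  (\int[P]_w ((mil (2 * h) n w - mil h n.*2 w) ^+ q.*2.+2)%:E <= x%:E)%E ->
  (\int[P]_w (1 + mil h n.*2 w ^+ (q.*2.+2).*2)%:E <= W%:E)%E ->
  (\int[P]_w (h ^+ q.+1 * (cc (mil (2 * h) n w) - cc (mil h n.*2 w)) ^+ q.*2.+2)%:E <= y%:E)%E ->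
  (\int[P]_w ((mil (2 * h) n.+1 w - mil h n.+1.*2 w) ^+ q.*2.+2)%:E
    <= (x + C * h * (x + (y + h ^+ q.*2.+2 * W)))%:E)%E.
Proof.
have [C0 C00 H] := wiener_step0 hFt hB q.
have [K1 K10 H1] := half_step1 cG cg q.
have [K2 K20 H2] := half_step2 cG cg q.
have [K3 K30 H3] := @half_step_rem R q.
have [D1 D10 mom1] := wiener_moment hFt hB q.+1.
have [D2 D20 mom2] := wiener_moment hFt hB q.*2.+2.
have [D4 D40 mom4] := wiener_moment hFt hB (q.*2.+2).*2.
pose Ky := K2 * (2 + D1 + K3 * (1 + D2 + D4 + D1)).
have Ky0 : 0 <= Ky by rewrite /Ky; ge0.
pose C1 := C0 * (1 + K1).
have C10 : 0 <= C1 by rewrite /C1; ge0.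
exists (C1 + C0 * (1 + C1 + Ky)) => [|h n x y W h01 x_ge0 y_ge0 W_ge0 ex eW ey]; first by ge0.
have h0 : 0 < h by case/andP: h01.
have h1 : h <= 1 by case/andP: h01.
have hge0 := ltW h0.
pose N := q.*2.+2; have N2 : N = q.+1.*2 by rewrite doubleS.
pose u := n.*2%:R * h; have u0 : 0 <= u by rewrite /u; ge0.
have nu : n%:R * (2 * h) = u by rewrite /u -mul2n natrM; ring.
pose Y := mil (2 * h) n; pose Z := mil h n.*2.
have mY : fm Ft u Y by rewrite -nu; apply: (mil_fm hFt hB x0 cG cg); ge0.
have mZ : fm Ft u Z by exact: (mil_fm hFt hB x0 cG cg).
pose d1 := increment B u (u + h); pose d2 := increment B (u + h) (u + h + h).
have uh0 : 0 <= u + h by rewrite addr_ge0.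
have uuh : u <= u + h by rewrite lerDl.
have md1 : fm Ft (u + h) d1 by exact: (fm_increment hFt hB).
have mY' := fm_mono hFt u0 uuh mY; have mZ' := fm_mono hFt u0 uuh mZ.
pose Z1 w := mstep G g g1 h (d1 w) (Z w).
have mZ1 : fm Ft (u + h) Z1 by rewrite /Z1 /mstep; fmt.
pose e w := Y w - Z w.
pose e1 w := e w + ((G (Y w) - G (Z w)) * h + (g (Y w) - g (Z w) - h * (G1 (Z w) * g (Z w))) * d1 w
   + (cc (Y w) - cc (Z w)) * (d1 w ^+ 2 - h)).
have me : fm Ft u e by rewrite /e; fmt.
have me1 : fm Ft (u + h) e1 by rewrite /e1 /e; fmt.
pose dC w := cc (Y w) - cc (Z w).
have mdC : fm Ft u dC by rewrite /dC; fmt.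
pose f0 w := 1 + Z w ^+ N.*2.
have mf0 : fm Ft u f0 by rewrite /f0; fmt.
have f00 w : 0 <= f0 w by rewrite /f0; ge0.
have hN : 0 <= h ^+ N by rewrite exprn_ge0.
have hq : 0 <= h ^+ q.+1 by rewrite exprn_ge0.
have hqq : h ^+ q.+1 * h ^+ q.+1 = h ^+ N by rewrite -exprD addnn N2.
have pw (v : R) : 0 <= v ^+ N by rewrite N2; ge0.
have toM t Z0 : 0 <= t -> fm Ft t Z0 -> measurable_fun setT Z0 by move=> t0; exact: fm_measurable.
have ZN w : Z w ^+ N <= f0 w.
  rewrite /f0 expr_dbl -exprM mulnC exprM.
  by have := sqr_ge0 (Z w ^+ N - 1); have := pw (Z w); rewrite !expr2; lra.
have step1 : (\int[P]_w (e1 w ^+ N)%:E <= (x + C0 * h * ((1 + K1) * x + (K1 * (h ^+ N * W) + y)))%:E)%E.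
  apply: (H _ _ _ _ _ _ _ _ _ (fun w => K1 * (h ^+ N * f0 w) + h ^+ q.+1 * dC w ^+ N)) => //; try by rewrite ?/e; fmt.
  - by apply: (toM _ _ u0); fmt.
  - by move=> w; rewrite addr_ge0// mulr_ge0// mulr_ge0.
  - move=> w; have := H1 (Y w) (Z w) h h01; rewrite -/N.
    have := ler_wpM2l K10 (ler_wpM2l hN (ZN w)); rewrite /e -/(dC w) mulrDr; lra.
  - apply: int_add.
    + by apply: (toM _ _ u0); fmt.
    + by apply: (toM _ _ u0); fmt.
    + by move=> w; ge0.
    + by move=> w; apply: mulr_ge0.
    + apply: int_scale => //; [by apply: (toM _ _ u0); fmt|by move=> w; apply: mulr_ge0|].
      by apply: int_scale => //; apply: (toM _ _ u0); fmt.
    + exact: ey.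
pose x1 := x + C0 * h * ((1 + K1) * x + (K1 * (h ^+ N * W) + y)).
pose g2 w := K2 * (e w ^+ N + (h ^+ q.+1 * dC w ^+ N + dC w ^+ N * d1 w ^+ q.+1.*2)
   + K3 * (h ^+ N * f0 w + (f0 w * d1 w ^+ N.*2 + (f0 w * d1 w ^+ N.*2.*2 + h ^+ q.+1 * (f0 w * d1 w ^+ q.+1.*2))))).
have Dn w j : 0 <= d1 w ^+ j.*2 by ge0.
have mm (f : Omega -> R) : fm Ft (u + h) f -> measurable_fun setT f by exact: toM.
have [me' [mdC' mf0']] : fm Ft (u + h) e /\ fm Ft (u + h) dC /\ fm Ft (u + h) f0.
  by split; [|split]; apply: (fm_mono hFt u0 uuh).
have g20 w : 0 <= g2 w.
  by rewrite /g2; nneg pw Dn f00.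
have hq2 : h ^+ q.+1 * D1 * h ^+ q.+1 * W = D1 * (h ^+ N * W) by rewrite -hqq; ring.
have eg2 : (\int[P]_w (g2 w)%:E <= (K2 * (x + (y + D1 * y)
   + K3 * (h ^+ N * W + (D2 * h ^+ N * W + (D4 * h ^+ N * W + D1 * (h ^+ N * W))))))%:E)%E.
  have nn (w : Omega) : 0 <= f0 w * d1 w ^+ N.*2 by apply: mulr_ge0.
  have t1 : (\int[P]_w (h ^+ N * f0 w)%:E <= (h ^+ N * W)%:E)%E.
    by apply: int_scale => //; exact: mm.
  have t2 := mom2 u h W f0 u0 h0 mf0 f00 eW.
  have t4 : (\int[P]_w (f0 w * d1 w ^+ N.*2.*2)%:E <= (D4 * h ^+ N * W)%:E)%E.
    apply: (le_trans (mom4 u h W f0 u0 h0 mf0 f00 eW)); rewrite lee_fin.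
    apply: ler_wpM2r => //; apply: ler_wpM2l => //.
    by rewrite -addnn exprD ler_piMr// exprn_ile1.
  have t3 : (\int[P]_w (h ^+ q.+1 * (f0 w * d1 w ^+ q.+1.*2))%:E <= (D1 * (h ^+ N * W))%:E)%E.
    rewrite -hq2 -!mulrA; apply: int_scale => //.
    + by apply: mm; fmt.
    + by move=> w; apply: mulr_ge0.
    + by have := mom1 u h W f0 u0 h0 mf0 f00 eW; rewrite -mulrA.
  (* The moment of d1 contributes h^(q+1), exactly the weight with which dC is controlled by y. *)
  have t5 : (\int[P]_w (dC w ^+ N * d1 w ^+ q.+1.*2)%:E <= (D1 * y)%:E)%E.
    have hq' : 0 < h ^+ q.+1 by rewrite exprn_gt0.
    have ey' : (\int[P]_w (dC w ^+ N)%:E <= ((h ^+ q.+1)^-1 * y)%:E)%E.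
      rewrite [leLHS](_ : _ = \int[P]_w ((h ^+ q.+1)^-1 * (h ^+ q.+1 * dC w ^+ N))%:E)%E; last first.
        by apply: eq_integral => w _; rewrite mulKf// gt_eqF.
      apply: int_scale => //; first by apply: (toM _ _ u0); fmt.
        by move=> w; apply: mulr_ge0.
      by rewrite invr_ge0.
    have := mom1 u h _ (fun w => dC w ^+ N) u0 h0 (fmX N mdC) (fun w => pw _) ey'.
    by rewrite -mulrA mulVKf// gt_eqF.
  have mmt (f : Omega -> R) : fm Ft (u + h) f -> measurable_fun setT f := mm f.
  rewrite /g2; apply: int_scale => //.
  - by apply: mm; fmt.
  - by move=> w; nneg pw Dn f00.
  repeat (first [apply: int_add; [by apply: mm; fmt|by apply: mm; fmt
    |by move=> w; nneg pw Dn f00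
    |by move=> w; nneg pw Dn f00
    | | ] | assumption
    | apply: (@int_scale _ _ _ P _ K3); [by apply: mm; fmt
      |by move=> w; nneg pw Dn f00
      |done|]]).
set y2 := K2 * _ in eg2.
have step2 : (\int[P]_w ((e1 w + ((G (Y w) - G (Z1 w) + G1 (Z w) * g (Z w) * d1 w) * h
     + (g (Y w) + 2 * cc (Y w) * d1 w - g (Z1 w)) * d2 w
     + (cc (Y w) - cc (Z1 w)) * (d2 w ^+ 2 - h))) ^+ N)%:E <= (x1 + C0 * h * ((1 + 0) * x1 + y2))%:E)%E.
  apply: (H _ _ _ _ _ _ _ _ _ g2) => //; try by fmt.
  - by apply: mm; rewrite /g2; fmt.
  - move=> w; rewrite mul0r add0r; have := H2 (Y w) (Z w) (Z1 w) h (d1 w) h01 erefl.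
    have := ler_wpM2l K20 (H3 (Z w) h (d1 w) (f0 w) h01 erefl).
    rewrite -/N -/(f0 w) -/(dC w) /g2 /e -[d1 w ^+ q.+1.*2]/(d1 w ^+ N).
    by rewrite !(mulrDr K2); lra.
(* Since (d1 + d2)^2 - 2h = (d1^2 - h) + (d2^2 - h) + 2 d1 d2, the cross term joins the coefficient
   of d2. *)
rewrite [leLHS](_ : _ = \int[P]_w ((e1 w + ((G (Y w) - G (Z1 w) + G1 (Z w) * g (Z w) * d1 w) * h
     + (g (Y w) + 2 * cc (Y w) * d1 w - g (Z1 w)) * d2 w
     + (cc (Y w) - cc (Z1 w)) * (d2 w ^+ 2 - h))) ^+ N)%:E)%E; last first.
  apply: eq_integral => w _; congr (_ ^+ _)%:E.
  rewrite /= nu -/Y -/u (_ : n.*2.+1%:R * h = u + h); last by rewrite succ_time.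
  rewrite (_ : u + 2 * h = u + h + h); last ring.
  rewrite -/Z -[B (u + h) w - B u w]/(d1 w) -[B (u + h + h) w - B (u + h) w]/(d2 w).
  rewrite (_ : B (u + h + h) w - B u w = d1 w + d2 w); last by rewrite /d1 /d2 /increment; ring.
  have Z1E : Z1 w = Z w + (G (Z w) * h + g (Z w) * d1 w + cc (Z w) * (d1 w ^+ 2 - h)) by [].
  rewrite /e1 /e -/(Y w) -/(Z1 w) {1 2}/mstep.
  by move: (G (Z1 w)) (g (Z1 w)) (cc (Z1 w)) => a b c; rewrite Z1E; ring.
apply: (le_trans step2); rewrite lee_fin addr0 mul1r.
pose V := h ^+ N * W; have V0 : 0 <= V by rewrite /V; apply: mulr_ge0.
have hW : D2 * h ^+ N * W = D2 * V /\ D4 * h ^+ N * W = D4 * V by rewrite /V !mulrA.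
have y2E : y2 <= Ky * (x + (y + V)).
  rewrite /y2 -/V hW.1 hW.2 /Ky -!mulrA; apply: ler_wpM2l => //.
  rewrite (_ : (2 + D1 + _) * _ = x + (y + D1 * y) + K3 * (V + (D2 * V + (D4 * V + D1 * V)))
    + (x + y + 2 * V + D1 * (x + V) + K3 * ((1 + D2 + D4 + D1) * (x + y)))); last by ring.
  by rewrite lerDl; repeat (first [done | apply: addr_ge0 | apply: mulr_ge0]).
have x1E : x1 <= x + C1 * h * (x + (y + V)).
  rewrite /x1 lerD2l /C1 -/V (_ : C0 * (1 + K1) * h * (x + (y + V)) = C0 * h * ((1 + K1) * x + (K1 * V + y))
    + C0 * h * (K1 * y + V)); last by ring.
  by rewrite lerDl; repeat (first [done | apply: addr_ge0 | apply: mulr_ge0]).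
have S0 : 0 <= x + (y + V) by repeat (first [done | apply: addr_ge0]).
have x1E' : x1 <= (1 + C1) * (x + (y + V)).
  apply: (le_trans x1E); rewrite mulrDl mul1r; apply: lerD.
    by rewrite lerDl addr_ge0.
  by apply: ler_wpM2r => //; rewrite ler_piMr.
have Ch0 : 0 <= C0 * h by apply: mulr_ge0.
rewrite -/N -/V (_ : x + (C1 + _) * h * _ = (x + C1 * h * (x + (y + V)))
   + C0 * h * ((1 + C1) * (x + (y + V)) + Ky * (x + (y + V)))); last by ring.
by apply: lerD => //; apply: ler_wpM2l => //; apply: lerD.
Qed.

End DoubleStep.

(** * From order one half to order one in two passes *)

Section TwoPass.
Context d (Omega : measurableType d) (R : realType) (P : probability Omega R).
Variables (g g1 : R -> R) (L T : R).
Hypothesis cg : smooth_coef L g g1.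
Local Notation cc := (milc g g1).

Definition moment_bound (Y : R -> nat -> Omega -> R) : Prop :=
  forall q, exists K h0 : R, [/\ 0 <= K, 0 < h0 <= 1 & forall h n, 0 < h <= h0 ->
    n%:R * h <= T -> (\int[P]_w (Y h n w ^+ q.*2.+2)%:E <= K%:E)%E].

Variables Y Z : R -> nat -> Omega -> R.
Hypotheses (mY : forall h n, 0 < h -> measurable_fun setT (Y h n))
  (mZ : forall h n, 0 < h -> measurable_fun setT (Z h n)).
Hypotheses (bY : moment_bound Y) (bZ : moment_bound Z).
Hypothesis pass : forall q, exists C h0 : R, [/\ 0 <= C, 0 < h0 <= 1 & forall h m y,
  0 < h <= h0 -> 0 <= y -> m%:R * h <= T ->
  (forall n, (n < m)%N ->
    (\int[P]_w (h ^+ q.+1 * (cc (Y h n w) - cc (Z h n w)) ^+ q.*2.+2)%:E <= y%:E)%E) ->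
  (\int[P]_w ((Y h m w - Z h m w) ^+ q.*2.+2)%:E <= (C * (y + h ^+ q.*2.+2))%:E)%E].

Let L0 : 0 <= L. Proof. exact: sc_ge0 cg. Qed.
Let pw (v : R) q : 0 <= v ^+ q.*2.+2. Proof. by rewrite -doubleS; ge0. Qed.

(* The Lipschitz constant of [cc] grows linearly: a first pass, where only its
   linear growth is used, yields order one half. *)
Lemma first_pass q : exists C h0 : R, [/\ 0 <= C, 0 < h0 <= 1 & forall h n, 0 < h <= h0 ->
  n%:R * h <= T -> (\int[P]_w ((Y h n w - Z h n w) ^+ q.*2.+2)%:E <= (C * h ^+ q.+1)%:E)%E].
Proof.
have [KY [hY [KY0 hY01 HY]]] := bY q; have [KZ [hZ [KZ0 hZ01 HZ]]] := bZ q.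
have [C [hC [C0 hC01 HC]]] := pass q.
pose D := (4 * L ^+ 2) ^+ q.*2.+2; have D0 : 0 <= D by rewrite /D; ge0.
exists (C * (D * (KY + KZ) + 1)), (Num.min hC (Num.min hY hZ)); split; first by ge0.
  by rewrite !lt_min ge_min; case/andP: hY01 => ->; case/andP: hZ01 => ->; case/andP: hC01 => -> ->.
move=> h n; rewrite !le_min => /and4P[h0 hhC hhY hhZ] nT.
have hge0 := ltW h0.
have h1 : h <= 1 by apply: (le_trans hhC); case/andP: hC01.
have hq : 0 <= h ^+ q.+1 by rewrite exprn_ge0.
have mcc : measurable_fun setT cc := milc_measurable cg.
apply: (le_trans (HC h n (h ^+ q.+1 * (D * (KY + KZ))) _ _ _ _)) => //.
- by rewrite h0.
- by ge0.
- move=> k kn; have kT : k%:R * h <= T.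
    by apply: le_trans nT; apply: ler_wpM2r => //; rewrite ler_nat ltnW.
  apply: int_scale => //.
    by apply: measurable_funX; apply: measurable_funB; apply: (measurableT_comp mcc); [exact: mY|exact: mZ].
  apply: (@int_le _ _ _ _ _ (fun w => D * (Y h k w ^+ q.*2.+2 + Z h k w ^+ q.*2.+2))) => //.
  + by apply: measurable_funX; apply: measurable_funB; apply: (measurableT_comp mcc); [exact: mY|exact: mZ].
  + by apply: measurable_funM => //; apply: measurable_funD; apply: measurable_funX; [exact: mY|exact: mZ].
  + move=> w; have := @bounded_pow R (cc (Y h k w) - cc (Z h k w)) (L ^+ 2) (Y h k w) (Z h k w) 0 0 q.+1.
    rewrite !normr0 !addr0 !doubleS (expr0n _ q.*2.+2) !addr0; apply.
    apply: (le_trans (ler_normB _ _)); rewrite mulrDr; apply: lerD; exact: milc_growth cg _.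
  + apply: int_scale => //.
    * by apply: measurable_funD; apply: measurable_funX; [exact: mY|exact: mZ].
    * by move=> w; rewrite addr_ge0.
    * apply: int_add => //; [by apply: measurable_funX; exact: mY|by apply: measurable_funX; exact: mZ|apply: HY|apply: HZ] => //.
      - by rewrite h0.
      - by rewrite h0.
- rewrite lee_fin -mulrA; apply: ler_wpM2l => //; rewrite mulrDl mul1r (mulrC (h ^+ _)) lerD2l.
  by apply: ler_wiXn2l => //; rewrite -doubleS -addnn leq_addr.
Qed.

(** With N = 2q+2, [milc_lip] bounds the discrepancy by (1 + |z|) |y - z|. By Young, h^(N/2) (1 +
    |z|)^N |y - z|^N is at most h^N (1 + |z|)^(2N) + |y - z|^(2N). The first term is a moment of Z,
    and the second has mean O(h^N) by [first_pass] for the exponent 2N. *)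
Lemma second_pass q : exists C h0 : R, [/\ 0 <= C, 0 < h0 <= 1 & forall h n, 0 < h <= h0 ->
  n%:R * h <= T -> (\int[P]_w ((Y h n w - Z h n w) ^+ q.*2.+2)%:E <= (C * h ^+ q.*2.+2)%:E)%E].
Proof.
(* Chosen so that 2q' + 2 is twice the exponent 2q + 2. *)
pose q' := q.*2.+1.
have q'E : q'.*2.+2 = (q.*2.+2).*2 by rewrite /q' !doubleS.
have [KZ [hZ [KZ0 hZ01 HZ]]] := bZ q'.
have [C [hC [C0 hC01 HC]]] := pass q.
have [CF [hF [CF0 hF01 HF]]] := first_pass q'.
pose N := q.*2.+2; pose D := (L ^+ 2) ^+ N; have D0 : 0 <= D by rewrite /D; ge0.
pose E := 4 ^+ N.*2 : R; have E0 : 0 <= E by rewrite /E; ge0.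
exists (C * (D * (E * (1 + KZ) + CF) + 1)), (Num.min hC (Num.min hZ hF)); split; first by ge0.
  by rewrite !lt_min ge_min; case/andP: hF01 => ->; case/andP: hZ01 => ->; case/andP: hC01 => -> ->.
move=> h n; rewrite !le_min => /and4P[h0 hhC hhZ hhF] nT.
have hge0 := ltW h0.
have hN : 0 <= h ^+ N by rewrite exprn_ge0.
have hq : 0 <= h ^+ q.+1 by rewrite exprn_ge0.
have hqq : h ^+ q.+1 * h ^+ q.+1 = h ^+ N by rewrite -exprD addnn doubleS.
have mcc : measurable_fun setT cc := milc_measurable cg.
apply: (le_trans (HC h n (h ^+ N * (D * (E * (1 + KZ) + CF))) _ _ _ _)) => //.
- by rewrite h0.
- by ge0.
- move=> k kn; have kT : k%:R * h <= T.
    by apply: le_trans nT; apply: ler_wpM2r => //; rewrite ler_nat ltnW.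
  apply: (@int_le _ _ _ _ _ (fun w => D * (E * (h ^+ N * (1 + Z h k w ^+ N.*2)) + (Y h k w - Z h k w) ^+ N.*2))).
  + apply: measurable_funM => //; apply: measurable_funX; apply: measurable_funB; apply: (measurableT_comp mcc); [exact: mY|exact: mZ].
  + apply: measurable_funM => //; apply: measurable_funD.
      by do 2 (apply: measurable_funM => //); apply: measurable_funD => //; apply: measurable_funX; exact: mZ.
    by apply: measurable_funX; apply: measurable_funB; [exact: mY|exact: mZ].
  + by move=> w; apply: mulr_ge0.
  + move=> w; set y := Y h k w; set z := Z h k w.
    have c1 : (cc y - cc z) ^+ N <= D * ((1 + `|z|) ^+ N * (y - z) ^+ N).
      rewrite -exprMn -exprMn /N -doubleS -(expr_dbl_norm (cc y - cc z)) -(expr_dbl_norm (L ^+ 2 * _)).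
      rewrite lerXn2r// ?nnegrE// !normrM (ger0_norm (_ : 0 <= 1 + `|z|)) ?addr_ge0//.
      have -> : `|L| * `|L| = L ^+ 2 by rewrite ger0_norm// expr2.
      by rewrite mulrA; exact: milc_lip cg _ _.
    have z1 : (1 + `|z|) ^+ N.*2 <= E * (1 + z ^+ N.*2).
      have := pow_sum4 1 `|z| 0 0 N.
      by rewrite !addr0 expr1n expr_dbl_norm /N doubleS (expr0n _ (q.*2.+1).*2.+2) !addr0.
    have yo : h ^+ q.+1 * ((1 + `|z|) ^+ N * (y - z) ^+ N) <= h ^+ N * (1 + `|z|) ^+ N.*2 + (y - z) ^+ N.*2.
      rewrite mulrA -hqq.
      have -> : h ^+ q.+1 * h ^+ q.+1 * (1 + `|z|) ^+ N.*2 = (h ^+ q.+1 * (1 + `|z|) ^+ N) ^+ 2.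
        by rewrite -addnn exprD; ring.
      rewrite -[(y - z) ^+ N.*2](_ : ((y - z) ^+ N) ^+ 2 = _); last by rewrite -exprM muln2.
      have := sqr_ge0 (h ^+ q.+1 * (1 + `|z|) ^+ N - (y - z) ^+ N).
      have : 0 <= (h ^+ q.+1 * (1 + `|z|) ^+ N) ^+ 2 by exact: sqr_ge0.
      have : 0 <= ((y - z) ^+ N) ^+ 2 by exact: sqr_ge0.
      by move: (h ^+ q.+1 * _) ((y - z) ^+ N) => a b; rewrite !expr2; lra.
    apply: (le_trans (ler_wpM2l hq c1)); rewrite mulrCA; apply: ler_wpM2l => //.
    apply: (le_trans yo); rewrite lerD2r (mulrCA E); exact: ler_wpM2l.
  + rewrite (_ : h ^+ N * _ = D * (E * (h ^+ N * (1 + KZ)) + CF * h ^+ N)); last by ring.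
    have m1 : measurable_fun setT (fun w => 1 + Z h k w ^+ N.*2).
      by apply: measurable_funD => //; apply: measurable_funX; exact: mZ.
    have m2 : measurable_fun setT (fun w => (Y h k w - Z h k w) ^+ N.*2).
      by apply: measurable_funX; apply: measurable_funB; [exact: mY|exact: mZ].
    have z0 w : 0 <= 1 + Z h k w ^+ N.*2 by ge0.
    have m3 : measurable_fun setT (fun w => h ^+ N * (1 + Z h k w ^+ N.*2)) by exact: measurable_funM.
    have m4 : measurable_fun setT (fun w => E * (h ^+ N * (1 + Z h k w ^+ N.*2))) by exact: measurable_funM.
    apply: int_scale => //; [exact: measurable_funD|by move=> w; ge0; exact: z0|].
    apply: int_add => //; [by move=> w; ge0; exact: z0|by move=> w; ge0| |].
      apply: int_scale => //; first by move=> w; ge0; exact: z0.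
      apply: int_scale => //.
      apply: int_add => //; [by apply: measurable_funX; exact: mZ|by move=> w; ge0|by rewrite int_cst|].
      by have := HZ h k; rewrite q'E; apply => //; rewrite h0.
    by have := HF h k; rewrite q'E; apply => //; rewrite h0.
- rewrite lee_fin -mulrA; apply: ler_wpM2l => //.
  by rewrite mulrDl mul1r (mulrC (h ^+ _)) lerD2l.
Qed.

End TwoPass.

(** * Dyadic refinement of the Milstein scheme *)

(** Convexity, by induction and the rearrangement inequality [ch]. The constant matters: it is 2^m
    for the exponent m + 1, one factor two below 2^(m+1), and this factor makes the halvings in
    [mil_refine] summable. *)
Lemma powD_convex {R : realFieldType} (A B : R) m : 0 <= A -> 0 <= B ->
  (A + B) ^+ m.+1 <= 2 ^+ m * (A ^+ m.+1 + B ^+ m.+1).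
Proof.
move=> A0 B0; elim: m => [|m IH]; first by rewrite expr0 mul1r !expr1.
rewrite exprSr; apply: (le_trans (ler_wpM2r _ IH)); first exact: addr_ge0.
rewrite (exprSr 2) -!mulrA; apply: ler_wpM2l; first by rewrite exprn_ge0.
have ch : 0 <= (A ^+ m.+1 - B ^+ m.+1) * (A - B).
  have [AB|/ltW BA] := leP A B.
    by rewrite -mulrNN; apply: mulr_ge0; rewrite opprB subr_ge0// lerXn2r ?nnegrE.
  by apply: mulr_ge0; rewrite subr_ge0// lerXn2r ?nnegrE.
rewrite (exprSr A m.+1) (exprSr B m.+1); move: ch; move: (A ^+ m.+1) (B ^+ m.+1) => a b.
by rewrite mulrBl !mulrBr; lra.
Qed.

Lemma powD_even_convex {R : realType} (a b : R) q :
  (a + b) ^+ q.*2.+2 <= 2 ^+ q.*2.+1 * (a ^+ q.*2.+2 + b ^+ q.*2.+2).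
Proof.
have ev (x : R) : x ^+ q.*2.+2 = `|x| ^+ q.*2.+2 by rewrite -doubleS expr_dbl_norm.
rewrite (ev (a + b)) (ev a) (ev b).
apply: le_trans (powD_convex _ (normr_ge0 a) (normr_ge0 b)).
by rewrite lerXn2r ?nnegrE ?addr_ge0// ler_normD.
Qed.

Section Refine.
Context d (Omega : measurableType d) (R : realType) (P : probability Omega R).
Variables (Ft : R -> set (set Omega)) (B : R -> Omega -> R).
Hypotheses (hFt : is_filtration Ft) (hB : is_wiener P Ft B).
Variables (G G1 g g1 : R -> R) (L x0 : R).
Hypotheses (cG : smooth_coef L G G1) (cg : smooth_coef L g g1).
Local Notation mil := (mil G g g1 B x0).
Local Notation cc := (milc g g1).

Lemma mil_measurable h n : 0 < h -> measurable_fun setT (mil h n).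
Proof.
move=> h0; have nh : 0 <= n%:R * h by rewrite mulr_ge0// ltW.
by apply: (fm_measurable hFt nh); apply: (mil_fm hFt hB x0 cG cg); exact: ltW.
Qed.

(** [second_pass] for the steps 2h and h at common times; [mil_double_step] with Gronwall supplies
    [pass]. *)
Lemma mil_refine1 q (T : R) : exists C h0 : R, [/\ 0 <= C, 0 < h0 <= 1 & forall h n, 0 < h <= h0 ->
  n%:R * h <= T -> (\int[P]_w ((mil (2 * h) n w - mil h n.*2 w) ^+ q.*2.+2)%:E <= (C * h ^+ q.*2.+2)%:E)%E].
Proof.
have half01 : 0 < (2^-1 : R) <= 1 by rewrite invr_gt0 invf_le1//= ltr0n ler1n.
apply: (second_pass cg (T := T) (Y := fun h n => mil (2 * h) n) (Z := fun h n => mil h n.*2)).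
- by move=> h n h0; apply: mil_measurable; rewrite mulr_gt0.
- by move=> h n h0; exact: mil_measurable.
- move=> p; have [K K0 HK] := mil_moment hFt hB x0 cG cg p (2 * T).
  exists K, 2^-1; split => // h n /andP[h0 h1] nT; apply: HK; last first.
    by rewrite mulrCA ler_wpM2l.
  by rewrite mulr_gt0//= mulrC -ler_pdivlMr// div1r.
- move=> p; have [K K0 HK] := mil_moment hFt hB x0 cG cg p (2 * T).
  exists K, 2^-1; split => // h n /andP[h0 h1] nT; apply: HK.
    by rewrite h0/= (le_trans h1)// invf_le1// ler1n.
  by rewrite -mul2n natrM -mulrA ler_wpM2l.
- move=> p; have [C C0 HC] := mil_double_step hFt hB x0 cG cg p.
  have [K K0 HK] := mil_moment hFt hB x0 cG cg p.*2.+1 (2 * T).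
  exists ((1 + (1 + K)) * expR (C * `|T|)), 2^-1; split => //; first by ge0.
  move=> h m y /andP[h0 h1] y0 mT Hy.
  have hle1 : h <= 1 by rewrite (le_trans h1)// invf_le1// ler1n.
  have hN : 0 <= h ^+ p.*2.+2 by rewrite exprn_ge0// ltW.
  have W0 : 0 <= 1 + K by rewrite addr_ge0.
  have yy : 0 <= y + h ^+ p.*2.+2 * (1 + K) by apply: addr_ge0 => //; apply: mulr_ge0.
  apply: (@le_trans _ _ (((0 + (y + h ^+ p.*2.+2 * (1 + K))) * expR (C * (m%:R * h)))%:E)); last first.
    rewrite lee_fin add0r [leRHS]mulrAC; apply: ler_pM => //; rewrite ?expR_ge0//.
      by have := mulr_ge0 W0 y0; lra.
    by rewrite ler_expR; apply: ler_wpM2l => //; rewrite (le_trans mT)// ler_norm.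
  apply: (@le_erec _ (fun n => \int[P]_w ((mil (2 * h) n w - mil h n.*2 w) ^+ p.*2.+2)%:E)%E
    C h 0 (y + h ^+ p.*2.+2 * (1 + K)) m) => //; first exact: ltW.
    by rewrite [leLHS]integral0_eq// => w _ /=; rewrite subrr expr0n.
  move=> n x nm x_ge0 ex.
  have nT : n%:R * h <= T.
    by apply: le_trans mT; apply: ler_wpM2r; [exact: ltW|rewrite ler_nat ltnW].
  apply: HC => //.
  + by rewrite h0.
  + apply: int_add => //.
    * by apply: measurable_funX; exact: mil_measurable.
    * by move=> w; ge0.
    * by rewrite int_cst.
    * by apply: (HK h n.*2); rewrite ?h0// -mul2n natrM -mulrA ler_wpM2l.
  + exact: Hy.
Qed.

(** Induction on k through the step h / 2. With N = 2q+2, the convexity constant 2^(N-1) meets the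
    factor 2^(-N) from (h / 2)^N, so the bound of the previous stage is halved before the error of
    the first halving is added; hence a constant valid for all k. *)
Lemma mil_refine q (T : R) : exists C h0 : R, [/\ 0 <= C, 0 < h0 <= 1 & forall k h n, 0 < h <= h0 ->
  n%:R * h <= T ->
  (\int[P]_w ((mil h n w - mil (h / 2 ^+ k) (n * 2 ^ k) w) ^+ q.*2.+2)%:E <= (C * h ^+ q.*2.+2)%:E)%E].
Proof.
have [C [h0 [C0 h001 H]]] := mil_refine1 q T.
pose F : R := 2 ^+ q.*2.+1; have F0 : 0 <= F by rewrite /F exprn_ge0.
exists (2 * F * C), h0; split => //; first by ge0.
elim=> [|k IH] h n h01 nT.
  case/andP: h01 => h_gt0 _; rewrite expr0 divr1 expn0 muln1.
  rewrite integral0_eq => [|w _]; last by rewrite subrr expr0n.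
  by rewrite lee_fin; ge0.
case/andP: (h01) => h_gt0 hh0.
have h2 : 0 < h / 2 by rewrite divr_gt0.
have h201 : 0 < h / 2 <= h0 by rewrite h2 (le_trans _ hh0)// ler_pdivrMr// ler_peMr ?ler1n// ltW.
have m1 := @mil_measurable h n h_gt0; have m2 := @mil_measurable _ n.*2 h2.
have m3 := @mil_measurable (h / 2 ^+ k.+1) (n * 2 ^ k.+1)%N (divr_gt0 h_gt0 (exprn_gt0 k.+1 (ltr0Sn R 1))).
have n2T : n.*2%:R * (h / 2) <= T by rewrite (_ : n.*2%:R * (h / 2) = n%:R * h)// -mul2n natrM; field.
have e1 : (\int[P]_w ((mil h n w - mil (h / 2) n.*2 w) ^+ q.*2.+2)%:E <= (C * (h / 2) ^+ q.*2.+2)%:E)%E.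
  have := H (h / 2) n h201; rewrite (_ : 2 * (h / 2) = h); last by field.
  by apply; apply: le_trans nT; apply: ler_wpM2l => //; rewrite ler_pdivrMr// ler_peMr ?ler1n// ltW.
have e2 := IH (h / 2) n.*2 h201 n2T.
rewrite (_ : h / 2 / 2 ^+ k = h / 2 ^+ k.+1) in e2; last by rewrite exprS; field; rewrite expf_neq0.
rewrite (_ : (n.*2 * 2 ^ k)%N = (n * 2 ^ k.+1)%N) in e2; last by rewrite -muln2 -mulnA expnS.
apply: (@int_le _ _ _ _ _ (fun w => F * ((mil h n w - mil (h / 2) n.*2 w) ^+ q.*2.+2
   + (mil (h / 2) n.*2 w - mil (h / 2 ^+ k.+1) (n * 2 ^ k.+1) w) ^+ q.*2.+2))).
- by apply: measurable_funX; exact: measurable_funB.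
- by apply: measurable_funM => //; apply: measurable_funD; apply: measurable_funX; exact: measurable_funB.
- by move=> w; rewrite -doubleS; ge0.
- move=> w; rewrite -[X in X ^+ _](subrKA (mil (h / 2) n.*2 w)); exact: powD_even_convex.
- apply: le_trans.
    apply: int_scale => //; last first.
      by apply: int_add; [| | | |exact: e1|exact: e2]; first [exact: measurable_funX (measurable_funB _ _)
        | by apply: measurable_funX; exact: measurable_funB | by move=> w; rewrite -doubleS; ge0].
    + by move=> w; rewrite -!doubleS; ge0.
    + by apply: measurable_funD; apply: measurable_funX; exact: measurable_funB.
  rewrite lee_fin expr_div_n (_ : 2 ^+ q.*2.+2 = 2 * F); last by rewrite /F exprS.
  have F1 : F != 0 by rewrite /F expf_neq0.
  rewrite [leLHS](_ : _ = 2^-1 * (C * h ^+ q.*2.+2) + F * (C * h ^+ q.*2.+2)); last by field.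
  have hN : 0 <= C * h ^+ q.*2.+2 by rewrite mulr_ge0// exprn_ge0// ltW.
  rewrite -mulrDl -!mulrA mulrA; apply: ler_wpM2r => //.
  have : 1 <= F by rewrite exprn_ege1// ler1n.
  by lra.
Qed.

End Refine.

(** * The exponential scheme as a perturbed Milstein scheme *)

Section ExpStep.
Context {R : realType} (G g g1 : R -> R).

(* [powR] rather than [^-1], for measurability. *)
Definition quot0 (f : R -> R) (x : R) : R := f x * x `^ (-1).

(** The step of [scheme] at a positive x, with F = G / x, f = g / x and f' g = (g' - f) f, so that
    only G, g and [g1] occur. *)
Definition estep (h D x : R) : R :=
  x * expR (quot0 G x * h + quot0 g x * D
    + 2^-1 * ((g1 x - quot0 g x) * quot0 g x) * (D ^+ 2 - h) - 2^-1 * quot0 g x ^+ 2 * h).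

Fixpoint esch {Omega : Type} (B : R -> Omega -> R) (x0 h : R) (n : nat) (w : Omega) : R :=
  if n is m.+1 then estep h (B (m%:R * h + h) w - B (m%:R * h) w) (esch B x0 h m w)
  else x0.

Lemma esch_ge0 {Omega : Type} (B : R -> Omega -> R) x0 h n w : 0 <= x0 -> 0 <= esch B x0 h n w.
Proof. by move=> x00; elim: n => [|n IH] //=; rewrite /estep mulr_ge0// expR_ge0. Qed.

Lemma quot0E (f : R -> R) x : 0 < x -> quot0 f x = f x / x.
Proof. by move=> x0; rewrite /quot0 powR_inv1// ltW. Qed.

Lemma quot0_measurable (f : R -> R) : measurable_fun setT f -> measurable_fun setT (quot0 f).
Proof. by move=> mf; apply: measurable_funM. Qed.

End ExpStep.

Section ExpStepExpand.
Context {R : realType} (G G1 g g1 : R -> R) (L : R).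
Hypotheses (cG : smooth_coef L G G1) (cg : smooth_coef L g g1).
Local Notation cc := (milc g g1).

Let L1 : 1 <= L. Proof. exact: sc_ge1 cG. Qed.
Let L0 : 0 <= L. Proof. exact: sc_ge0 cG. Qed.

Definition erem (h : R) (xD : R * R) : R :=
  estep G g g1 h xD.2 xD.1 - xD.1 - (G xD.1 * h + g xD.1 * xD.2 + cc xD.1 * (xD.2 ^+ 2 - h)).

Lemma erem_measurable h : measurable_fun setT (erem h).
Proof.
have f1 : measurable_fun setT (fst : R * R -> R) by exact: measurable_fst.
have f2 : measurable_fun setT (snd : R * R -> R) by exact: measurable_snd.
have mG := sc_measurable cG; have mg := sc_measurable cg; have mg1 := sc_measurable1 cg.
have mc := milc_measurable cg.
have mqG := quot0_measurable mG; have mqg := quot0_measurable mg.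
have c1 (k : R -> R) : measurable_fun setT k -> measurable_fun setT (fun x : R * R => k x.1).
  by move=> mk; exact: (measurableT_comp mk f1).
have d2 : measurable_fun setT (fun x : R * R => x.2 ^+ 2 - h).
  by apply: measurable_funB => //; exact: measurable_funX.
apply: measurable_funB; last first.
  apply: measurable_funD; last by apply: measurable_funM => //; exact: c1.
  by apply: measurable_funD; apply: measurable_funM => //; exact: c1.
apply: measurable_funB => //; apply: measurable_funM => //; apply: measurableT_comp => //.
apply: measurable_funB; last first.
  apply: measurable_funM => //; apply: measurable_funM => //; apply: measurable_funX; exact: c1.
apply: measurable_funD; first by apply: measurable_funD; apply: measurable_funM => //; exact: c1.
apply: measurable_funM => //; apply: measurable_funM => //; apply: measurable_funM; last exact: c1.
by apply: measurable_funB; exact: c1.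
Qed.

(** Expanding the exponential to first order in its part of size h and to second order in f D, all
    retained terms add up exactly to the Milstein increment. [exp_expand] bounds the rest: order
    h^(3/2) pointwise, order h^2 after averaging over D and -D, both proportional to x. *)
Lemma erem_bounds (N : R) : 1 <= N -> exists C h0 : R, [/\ 0 <= C, 0 < h0 < 1 & forall h x D : R,
  0 < h <= h0 -> 0 <= x ->
  `|erem h (x, D)| <= C * x * Num.sqrt h ^+ 3 * expR (D ^+ 2 / (4 * N * h)) /\
  `|erem h (x, D) + erem h (x, - D)| <= C * x * Num.sqrt h ^+ 4 * expR (D ^+ 2 / (4 * N * h))].
Proof.
move=> N1; have K1 : 1 <= 2 * L ^+ 2 by have := exprn_ege1 2 L1; lra.
have [C [s0 [C0 /andP[s00 s01] H]]] := exp_expand N1 K1.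
exists C, (s0 ^+ 2); split => //.
  by rewrite exprn_gt0//= expr2 mulr_ilt1// ltW.
move=> h x D /andP[h0 hs0] x_ge0.
set s := Num.sqrt h; have s_gt0 : 0 < s by rewrite sqrtr_gt0.
have s2 : s ^+ 2 = h by rewrite sqr_sqrtr// ltW.
have ss0 : s <= s0 by rewrite -(ler_pXn2r (n:=2)) ?nnegrE ?s2 //; exact: ltW.
have N0 : 0 < N by lra.
have [->|x_neq0] := eqVneq x 0.
  have z : erem h (0, D) = 0 by rewrite /erem /estep /milc /= (sc0 cG) (sc0 cg); ring.
  have z' : erem h (0, - D) = 0 by rewrite /erem /estep /milc /= (sc0 cG) (sc0 cg); ring.
  by rewrite z z' addr0 normr0 mulr0 !mul0r.
have x_gt0 : 0 < x by rewrite lt0r x_neq0.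
set qG := quot0 G x; set qg := quot0 g x.
have xqG : G x = x * qG by rewrite /qG quot0E// mulrC divfK.
have xqg : g x = x * qg by rewrite /qg quot0E// mulrC divfK.
have bq f f1 : smooth_coef L f f1 -> `|quot0 f x| <= L.
  move=> cf; rewrite quot0E// normrM normfV (gtr0_norm x_gt0) ler_pdivrMr//.
  by apply: (le_trans (sc_growth cf x)); rewrite (gtr0_norm x_gt0).
have bG : `|qG| <= L := bq _ _ cG; have bg : `|qg| <= L := bq _ _ cg.
have b1 : `|g1 x| <= L := sc_bnd1 cg x.
have LL : L <= L ^+ 2 by rewrite expr2 ler_peMl.
have bF : `|qG - 2^-1 * qg ^+ 2| <= 2 * L ^+ 2.
  apply: (le_trans (ler_normB _ _)).
  rewrite (normrM 2^-1) (ger0_norm (_ : 0 <= 2^-1)) ?invr_ge0// normrX.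
  have : `|qg| ^+ 2 <= L ^+ 2 by rewrite lerXn2r ?nnegrE.
  by lra.
have bf : `|qg| <= 2 * L ^+ 2 by lra.
have bc : `|2^-1 * ((g1 x - qg) * qg)| <= 2 * L ^+ 2.
  rewrite (normrM 2^-1) (ger0_norm (_ : 0 <= 2^-1)) ?invr_ge0// (normrM (g1 x - qg)).
  have : `|g1 x - qg| * `|qg| <= (2 * L) * L.
    by apply: ler_pM => //; apply: (le_trans (ler_normB _ _)); lra.
  by rewrite expr2; lra.
pose z := D / s; have Dz : D = s * z by rewrite /z mulrC divfK// gt_eqF.
have wE : D ^+ 2 / (4 * N * h) = z ^+ 2 / (4 * N) by rewrite Dz -s2; field; rewrite !gt_eqF.
have s_ok : 0 < s <= s0 by rewrite s_gt0.
(* The part of the exponent of size h; the correction - f^2 h / 2 is counted with the drift. *)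
pose A := (qG - 2^-1 * qg ^+ 2) * s ^+ 2 + (2^-1 * ((g1 x - qg) * qg)) * ((s * z) ^+ 2 - s ^+ 2).
have [H1 H2] := H _ _ _ s z A (qg * (s * z)) bF bf bc s_ok erefl erefl.
have eE : erem h (x, D) = x * (expR (A + qg * (s * z)) - 1 - A - qg * (s * z) - 2^-1 * (qg * (s * z)) ^+ 2).
  rewrite /erem /estep /milc /= -/qG -/qg xqG xqg.
  have -> : qG * h + qg * D + 2^-1 * ((g1 x - qg) * qg) * (D ^+ 2 - h) - 2^-1 * qg ^+ 2 * h = A + qg * (s * z).
    by rewrite /A -Dz s2; ring.
  by rewrite /A -Dz s2; field.
have eE2 : erem h (x, D) + erem h (x, - D) =
    x * (expR (A + qg * (s * z)) + expR (A - qg * (s * z)) - 2 - 2 * A - (qg * (s * z)) ^+ 2).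
  rewrite /erem /estep /milc /= -/qG -/qg xqG xqg.
  have -> : qG * h + qg * D + 2^-1 * ((g1 x - qg) * qg) * (D ^+ 2 - h) - 2^-1 * qg ^+ 2 * h = A + qg * (s * z).
    by rewrite /A -Dz s2; ring.
  have -> : qG * h + qg * (- D) + 2^-1 * ((g1 x - qg) * qg) * ((- D) ^+ 2 - h) - 2^-1 * qg ^+ 2 * h = A - qg * (s * z).
    by rewrite /A -Dz s2; ring.
  by rewrite /A -Dz s2; field.
rewrite eE2 eE wE !(normrM x) (gtr0_norm x_gt0); split.
  rewrite [leRHS](_ : _ = x * (C * s ^+ 3 * expR (z ^+ 2 / (4 * N)))); last ring.
  exact: ler_wpM2l.
rewrite [leRHS](_ : _ = x * (C * s ^+ 4 * expR (z ^+ 2 / (4 * N)))); last ring.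
exact: ler_wpM2l.
Qed.

End ExpStepExpand.

Section ExpScheme.
Context d (Omega : measurableType d) (R : realType) (P : probability Omega R).
Variables (Ft : R -> set (set Omega)) (B : R -> Omega -> R).
Hypotheses (hFt : is_filtration Ft) (hB : is_wiener P Ft B).
Variables (G G1 g g1 : R -> R) (L x0 : R).
Hypotheses (cG : smooth_coef L G G1) (cg : smooth_coef L g g1) (x00 : 0 <= x0).
Local Notation mil := (mil G g g1 B x0).
Local Notation esch := (esch G g g1 B x0).
Local Notation cc := (milc g g1).
Local Notation er := (erem G g g1).

Let L1 : 1 <= L. Proof. exact: sc_ge1 cG. Qed.
Let L0 : 0 <= L. Proof. exact: sc_ge0 cG. Qed.
Let pw (v : R) q : 0 <= v ^+ q.*2.+2. Proof. by rewrite -doubleS; ge0. Qed.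

Lemma estepE h D x : estep G g g1 h D x =
  x + (G x * h + g x * D + cc x * (D ^+ 2 - h) + er h (x, D)).
Proof. by rewrite /erem /=; ring. Qed.

Lemma esch_fm h n : 0 <= h -> fm Ft (n%:R * h) (esch h n).
Proof.
move=> h0; elim: n => [|n IH] /=; first exact: fm_cst.
have nh : 0 <= n%:R * h by ge0.
have le : n%:R * h <= n.+1%:R * h by rewrite succ_time lerDl.
have mB1 : fm Ft (n.+1%:R * h) (B (n%:R * h + h)).
  by rewrite succ_time; apply: (fm_wiener hFt hB); rewrite addr_ge0.
have mB0 : fm Ft (n.+1%:R * h) (B (n%:R * h)).
  by apply: (fm_mono hFt nh le); exact: (fm_wiener hFt hB).
have {}IH := fm_mono hFt nh le IH.
rewrite (_ : (fun w => _) = fun w => esch h n w + (G (esch h n w) * h + g (esch h n w) * (B (n%:R * h + h) w - B (n%:R * h) w)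
  + cc (esch h n w) * ((B (n%:R * h + h) w - B (n%:R * h) w) ^+ 2 - h)
  + er h (esch h n w, B (n%:R * h + h) w - B (n%:R * h) w))); last first.
  by apply/funext => w; rewrite estepE.
apply: fmD => //; apply: fmD; first by fmt.
apply: (measurableT_comp (erem_measurable cG cg h)).
by apply: measurable_fun_pair => //; exact: measurable_funB.
Qed.

Lemma esch_measurable h n : 0 < h -> measurable_fun setT (esch h n).
Proof.
move=> h0; have nh : 0 <= n%:R * h by rewrite mulr_ge0// ltW.
by apply: (fm_measurable hFt nh); apply: esch_fm; exact: ltW.
Qed.

Lemma sqrt_pow_le1 (h c : R) q : 0 < h <= 1 -> (Num.sqrt h * c) ^+ q.*2.+2 = h ^+ q.+1 * c ^+ q.*2.+2.
Proof.
move=> /andP[h0 _]; rewrite exprMn (_ : Num.sqrt h ^+ q.*2.+2 = h ^+ q.+1)//.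
by rewrite -doubleS expr_dbl sqr_sqrtr// ltW.
Qed.

(** As for [mil_moment], with the remainder [erem] dominated by the scheme itself. The threshold h0
    is fixed before T; it leads to the maximal step [taup], which must precede eps and T. *)
Lemma esch_moment q : exists2 h0 : R, 0 < h0 < 1 & forall T : R, exists2 K : R, 0 <= K &
  forall h n, 0 < h <= h0 -> n%:R * h <= T -> (\int[P]_w (esch h n w ^+ q.*2.+2)%:E <= K%:E)%E.
Proof.
have [C C0 H] := wiener_step hFt hB q.
have N1 : 1 <= (q.*2.+2)%:R :> R by rewrite ler1n.
have [Cr [h0 [Cr0 h001 Hr]]] := erem_bounds cG cg N1.
exists h0 => // T.
pose K0 := L ^+ q.*2.+2 + L ^+ q.*2.+2 + (L ^+ 2) ^+ q.*2.+2 + Cr ^+ q.*2.+2.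
have K00 : 0 <= K0 by rewrite /K0; ge0.
pose xx := x0 ^+ q.*2.+2.
exists ((xx + 0) * expR (C * (1 + K0) * T)) => [|h n h01 nT].
  by rewrite addr0 mulr_ge0 ?expR_ge0// exprn_ge0.
have h_gt0 : 0 < h by case/andP: h01.
have h1 : h <= 1 by case/andP: h01 => _ /le_trans; apply; case/andP: h001 => _ /ltW.
have hge0 := ltW h_gt0.
have Ck : 0 <= C * (1 + K0) by ge0.
have h011 : 0 < h <= 1 by rewrite h_gt0.
apply: (@le_trans _ _ ((xx + 0) * expR (C * (1 + K0) * (n%:R * h)))%:E); last first.
  by rewrite lee_fin; apply: ler_wpM2l; [rewrite addr0; exact: pw|rewrite ler_expR; apply: ler_wpM2l].
apply: (@le_erec _ (fun n => \int[P]_w (esch h n w ^+ q.*2.+2)%:E)%E _ _ _ _ n) => //; first exact: pw.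
  by rewrite /= int_cst.
move=> m x mn x_ge0 mx.
have u0 : 0 <= m%:R * h by ge0.
have mm := @esch_fm h m hge0.
have Y0 w : 0 <= esch h m w by exact: esch_ge0.
rewrite [leRHS](_ : _ = (x + C * h * ((1 + K0) * x + 0))%:E); last by congr _%:E; ring.
rewrite [leLHS](_ : _ = \int[P]_w ((esch h m w + (G (esch h m w) * h + g (esch h m w) * increment B (m%:R * h) (m%:R * h + h) w
  + cc (esch h m w) * (increment B (m%:R * h) (m%:R * h + h) w ^+ 2 - h)
  + (fun wz => er h (esch h m wz.1, wz.2)) (w, increment B (m%:R * h) (m%:R * h + h) w))) ^+ q.*2.+2)%:E)%E; last first.
  by apply: eq_integral => w _; rewrite /= estepE.
apply: (H _ _ K0 x 0 (esch h m) (fun w => G (esch h m w)) (fun w => g (esch h m w))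
  (fun w => cc (esch h m w)) (fun w => Cr * esch h m w) (fun=> 0)
  (fun wz => er h (esch h m wz.1, wz.2))) => //; try by fmt.
- apply: (measurableT_comp (erem_measurable cG cg h)).
  by apply: measurable_fun_pair; [exact: (measurableT_comp mm measurable_fst)|exact: measurable_snd].
- by move=> w; apply: mulr_ge0.
- by move=> w z; have [] := Hr h (esch h m w) z h01 (Y0 w).
- by move=> w z; have [] := Hr h (esch h m w) z h01 (Y0 w).
- move=> w; rewrite addr0 /K0 !mulrDl sqrt_pow_le1//.
  apply: lerD; first (apply: lerD; first apply: lerD).
  + by apply: pow_dom => //; exact: sc_growth cG _.
  + by apply: pow_dom => //; exact: sc_growth cg _.
  + apply: (@le_trans _ _ (1 * cc (esch h m w) ^+ q.*2.+2)).
      by apply: ler_wpM2r; [exact: pw|rewrite exprn_ile1].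
    by rewrite mul1r; apply: pow_dom; [ge0|exact: milc_growth cg _].
  + apply: pow_dom => //; rewrite !normrM !ger0_norm//.
    by rewrite mulrA; apply: ler_wpM2r => //; rewrite ler_piMl.
- by rewrite int_cst.
Qed.

(** [second_pass] again. The remainder of the exponential step enters [wiener_step] as a source of
    size h^(2q+2) times a moment of the scheme, which is compatible with order one. *)
Lemma esch_mil q (T : R) : exists C h0 : R, [/\ 0 <= C, 0 < h0 <= 1 & forall h n, 0 < h <= h0 ->
  n%:R * h <= T -> (\int[P]_w ((esch h n w - mil h n w) ^+ q.*2.+2)%:E <= (C * h ^+ q.*2.+2)%:E)%E].
Proof.
apply: (second_pass cg (T := T) (Y := esch) (Z := mil)).
- by move=> h n h0; exact: esch_measurable.
- by move=> h n h0; exact: (mil_measurable hFt hB x0 cG cg).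
- move=> p; have [h0 /andP[h00 h01] HK] := esch_moment p.
  by have [K K0 H] := HK T; exists K, h0; split => //; rewrite h00 ltW.
- move=> p; have [K K0 HK] := mil_moment hFt hB x0 cG cg p T.
  by exists K, 1; split => //; rewrite ltr01 lexx.
move=> p; have [C C0 H] := wiener_step hFt hB p.
have N1 : 1 <= (p.*2.+2)%:R :> R by rewrite ler1n.
have [Cr [hr [Cr0 hr01 Hr]]] := erem_bounds cG cg N1.
have [hY hY01 HK'] := esch_moment p; have [KY KY0 HK] := HK' T.
pose K0 := L ^+ p.*2.+2 + L ^+ p.*2.+2.
have K00 : 0 <= K0 by rewrite /K0; ge0.
pose W := Cr ^+ p.*2.+2 * KY; have W0 : 0 <= W by rewrite /W; ge0.
have Ck : 0 <= C * (1 + K0) by ge0.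
exists ((1 + W) * expR (C * (1 + K0) * `|T|)), (Num.min hr hY); split; first by ge0.
  by rewrite lt_min ge_min; case/andP: hr01 => -> /ltW ->; case/andP: hY01 => ->.
move=> h m y; rewrite le_min => /and3P[h_gt0 hhr hhY] y0 mT Hy.
have hge0 := ltW h_gt0.
have h1 : h <= 1 by apply: (le_trans hhr); case/andP: hr01 => _ /ltW.
have h011 : 0 < h <= 1 by rewrite h_gt0.
have h0r : 0 < h <= hr by rewrite h_gt0.
have h0Y : 0 < h <= hY by rewrite h_gt0.
have hN : 0 <= h ^+ p.*2.+2 by rewrite exprn_ge0.
have yy : 0 <= y + h ^+ p.*2.+2 * W by apply: addr_ge0 => //; apply: mulr_ge0.
apply: (@le_trans _ _ (((0 + (y + h ^+ p.*2.+2 * W)) * expR (C * (1 + K0) * (m%:R * h)))%:E)); last first.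
  rewrite lee_fin add0r [leRHS]mulrAC; apply: ler_pM => //; rewrite ?expR_ge0//.
    by have := mulr_ge0 W0 y0; lra.
  by rewrite ler_expR; apply: ler_wpM2l => //; rewrite (le_trans mT)// ler_norm.
apply: (@le_erec _ (fun n => \int[P]_w ((esch h n w - mil h n w) ^+ p.*2.+2)%:E)%E _ h 0 (y + h ^+ p.*2.+2 * W) m) => //.
  by rewrite [leLHS]integral0_eq// => w _ /=; rewrite subrr expr0n.
move=> n x nm x_ge0 ex.
have nT : n%:R * h <= T.
  by apply: le_trans mT; apply: ler_wpM2r; [exact: ltW|rewrite ler_nat ltnW].
have u0 : 0 <= n%:R * h by ge0.
have mY := @esch_fm h n hge0; have mM := @mil_fm _ _ _ P Ft B hFt hB G G1 g g1 L x0 cG cg h n hge0.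
have Y0 w : 0 <= esch h n w by exact: esch_ge0.
apply: (@le_trans _ _ (x + C * h * ((1 + K0) * x + (y + h ^+ p.*2.+2 * W)))%:E); last first.
  rewrite lee_fin lerD2l [leRHS](_ : _ = C * h * ((1 + K0) * x + (y + h ^+ p.*2.+2 * W))
    + C * h * (K0 * (y + h ^+ p.*2.+2 * W))); last ring.
  by rewrite lerDl; repeat (apply: mulr_ge0 => //).
rewrite [leLHS](_ : _ = \int[P]_w ((esch h n w - mil h n w + ((G (esch h n w) - G (mil h n w)) * h
  + (g (esch h n w) - g (mil h n w)) * increment B (n%:R * h) (n%:R * h + h) w
  + (cc (esch h n w) - cc (mil h n w)) * (increment B (n%:R * h) (n%:R * h + h) w ^+ 2 - h)
  + (fun wz => er h (esch h n wz.1, wz.2)) (w, increment B (n%:R * h) (n%:R * h + h) w))) ^+ p.*2.+2)%:E)%E; last first.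
  by apply: eq_integral => w _; rewrite /= estepE /mstep /increment; congr (_ ^+ _)%:E; ring.
have toM Z0 : fm Ft (n%:R * h) Z0 -> measurable_fun setT Z0 by exact: fm_measurable.
apply: (H _ _ K0 x _ (fun w => esch h n w - mil h n w) (fun w => G (esch h n w) - G (mil h n w))
  (fun w => g (esch h n w) - g (mil h n w))
  (fun w => cc (esch h n w) - cc (mil h n w)) (fun w => Cr * esch h n w)
  (fun w => h ^+ p.+1 * (cc (esch h n w) - cc (mil h n w)) ^+ p.*2.+2
     + h ^+ p.*2.+2 * (Cr ^+ p.*2.+2 * esch h n w ^+ p.*2.+2))
  (fun wz => er h (esch h n wz.1, wz.2))) => //; try by fmt.
- apply: (measurableT_comp (erem_measurable cG cg h)).
  by apply: measurable_fun_pair; [exact: (measurableT_comp mY measurable_fst)|exact: measurable_snd].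
- by apply: toM; fmt.
- by move=> w; apply: addr_ge0; repeat (apply: mulr_ge0 => //); rewrite exprn_ge0.
- by move=> w; apply: mulr_ge0.
- by move=> w z; have [] := Hr h (esch h n w) z h0r (Y0 w).
- by move=> w z; have [] := Hr h (esch h n w) z h0r (Y0 w).
- move=> w; rewrite sqrt_pow_le1// (exprMn _ h) (exprMn _ Cr) addrA lerD2r lerD2r /K0 mulrDl.
  apply: lerD; first by apply: pow_dom => //; exact: (sc_lip cG).
  by apply: pow_dom => //; exact: (sc_lip cg).
- apply: int_add => //; try by apply: toM; fmt.
  + by move=> w; apply: mulr_ge0 => //; rewrite exprn_ge0.
  + by move=> w; repeat (apply: mulr_ge0 => //); rewrite exprn_ge0.
  + exact: Hy.
  + have CrN : 0 <= Cr ^+ p.*2.+2 by rewrite exprn_ge0.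
    apply: int_scale => //; [by apply: toM; fmt|by move=> w; apply: mulr_ge0|].
    by apply: int_scale => //; [apply: toM; fmt|exact: HK].
Qed.

End ExpScheme.

(** * Calculus on the half-line and extension of the coefficients *)

Section HalfLineCalculus.
Context {R : realType}.
Implicit Types h : R -> R.

Lemma within_ge0_dnbhs (x : R) : 0 < x -> within [set y | 0 <= y] (x^') = x^'.
Proof.
move=> x0; apply/seteqP; split => A /= HA; last first.
  by rewrite /within /=; apply: filterS HA => y Ay _.
have pos : \forall y \near x^', 0 <= y.
  by apply: nbhs_dnbhs; near=> y; apply: ltW; near: y; exact: lt_nbhsr.
rewrite /within /= in HA.
near=> y; have : 0 <= y by near: y; exact: pos.
by near: y.
Unshelve. all: by end_near. Qed.

Lemma hl_slope_cvg h x : 0 < x -> hl_derivable h x ->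
  hl_slope h x y @[y --> x^'] --> hl_derive h x.
Proof. by move=> x0; rewrite /hl_derivable /hl_derive within_ge0_dnbhs. Qed.

Lemma hl_is_derive h x : 0 < x -> hl_derivable h x -> is_derive x 1 h (hl_derive h x).
Proof.
move=> x0 hx; have cv := hl_slope_cvg x0 hx.
apply/is_derive1_caratheodory.
exists (fun z => if z == x then hl_derive h x else hl_slope h x z); split.
- move=> z; case: eqVneq => [->|zx]; first by rewrite !subrr mulr0.
  by rewrite /hl_slope divfK// subr_eq0.
- apply/cvgrPdist_lt => e e0; rewrite eqxx; move/cvgrPdist_lt : cv => /(_ e e0).
  rewrite near_withinE => H; near=> y; case: eqVneq => [_|yx]; first by rewrite subrr normr0.
  by move: yx; near: y.
- by rewrite eqxx.
Unshelve. all: by end_near. Qed.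

Lemma hl_cvg_right h x : 0 <= x -> hl_derivable h x -> h y @[y --> x^'+] --> h x.
Proof.
move=> x0 /cvg_ex[l /= cl].
have cl' : hl_slope h x y @[y --> x^'+] --> l.
  apply/cvgrPdist_lt => e e0; move/cvgrPdist_lt : cl => /(_ e e0).
  rewrite !near_withinE => H; near=> y => xy.
  have yx : y != x by rewrite gt_eqF.
  have y0 : 0 <= y by apply: ltW; exact: le_lt_trans xy.
  by move: (yx) y0; near: y.
have : hl_slope h x y * (y - x) + h x @[y --> x^'+] --> l * (x - x) + h x.
  apply: cvgD; last exact: cvg_cst.
  apply: cvgM => //; apply: cvgB; last exact: cvg_cst.
  exact: cvg_at_right_filter cvg_id.
rewrite subrr mulr0 add0r => /cvgrPdist_lt H.
apply/cvgrPdist_lt => e e0; have := H e e0; rewrite !near_withinE => {}H.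
near=> y => xy; have : `|h x - (hl_slope h x y * (y - x) + h x)| < e by move: xy; near: y.
by rewrite /hl_slope divfK ?subr_eq0 ?gt_eqF// subrK.
Unshelve. all: by end_near. Qed.

Lemma hl_continuous h x : 0 < x -> hl_derivable h x -> {for x, continuous h}.
Proof.
move=> x0 hx; apply: differentiable_continuous; apply/derivable1_diffP.
by case: (hl_is_derive x0 hx).
Qed.

Lemma hl_within_continuous h a b : 0 <= a -> a < b -> (forall x, 0 <= x -> hl_derivable h x) ->
  {within `[a, b], continuous h}.
Proof.
move=> a0 ab hd; apply/(continuous_within_itvP _ ab); split.
- move=> x; rewrite in_itv/= => /andP[ax _]; have x0 := le_lt_trans a0 ax.
  by apply: hl_continuous => //; apply: hd; exact: ltW.
- by apply: hl_cvg_right => //; exact: hd.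
- have b0 := le_lt_trans a0 ab; apply: cvg_at_left_filter.
  by apply: hl_continuous => //; apply: hd; exact: ltW.
Qed.

Lemma hl_MVT h a b : 0 <= a -> a < b -> (forall x, 0 <= x -> hl_derivable h x) ->
  exists2 c, a < c < b & h b - h a = hl_derive h c * (b - a).
Proof.
move=> a0 ab hd; have [] := @MVT R h (hl_derive h) a b ab.
- move=> x; rewrite in_itv/= => /andP[ax _]; have x0 := le_lt_trans a0 ax.
  by apply: hl_is_derive => //; apply: hd; exact: ltW.
- exact: hl_within_continuous.
- by move=> c; rewrite in_itv => cab E; exists c.
Qed.

Lemma hl_lipschitz h (M : R) : (forall x, 0 <= x -> hl_derivable h x) ->
  (forall x, 0 <= x -> `|hl_derive h x| <= M) ->
  forall x y, 0 <= x -> 0 <= y -> `|h x - h y| <= M * `|x - y|.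
Proof.
move=> hd hM.
have key x y : 0 <= x -> x < y -> `|h y - h x| <= M * `|y - x|.
  move=> x0 xy; have [c /andP[xc cy] ->] := hl_MVT x0 xy hd.
  by rewrite normrM; apply: ler_wpM2r => //; apply: hM; rewrite ltW// (le_lt_trans x0).
move=> x y x0 y0; have [xy|yx|->] := ltgtP x y.
- by rewrite distrC (distrC x); exact: key.
- exact: key.
- by rewrite !subrr normr0 mulr0.
Qed.

Lemma hl_taylor h (M : R) : (forall x, 0 <= x -> hl_derivable h x) ->
  (forall x y, 0 <= x -> 0 <= y -> `|hl_derive h x - hl_derive h y| <= M * `|x - y|) ->
  forall x y, 0 <= x -> 0 <= y -> `|h y - h x - hl_derive h x * (y - x)| <= M * (y - x) ^+ 2.
Proof.
move=> hd hM.
have M0 : 0 <= M.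
  have := hM 1 0 ler01 (lexx 0); rewrite subr0 normr1 mulr1; exact: le_trans.
have sq (z : R) : z ^+ 2 = `|z| * `|z| by rewrite -normrM -expr2 ger0_norm// sqr_ge0.
move=> x y x0 y0; have [xy|yx|->] := ltgtP x y.
- have [c /andP[xc cy] ->] := hl_MVT x0 xy hd.
  rewrite -mulrBl normrM sq mulrA; apply: ler_wpM2r => //.
  have c0 : 0 <= c by rewrite ltW// (le_lt_trans x0).
  apply: (le_trans (hM _ _ c0 x0)); apply: ler_wpM2l => //.
  by rewrite !ger0_norm ?subr_ge0 ?lerD2r ltW// (lt_trans xc).
- have [c /andP[yc cx] E] := hl_MVT y0 yx hd.
  rewrite (_ : h y - h x - _ = (hl_derive h c - hl_derive h x) * (y - x)); last first.
    by rewrite mulrBl; congr (_ - _); rewrite -[LHS]opprB E -mulrN opprB.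
  rewrite normrM sq mulrA; apply: ler_wpM2r => //.
  have c0 : 0 <= c by rewrite ltW// (le_lt_trans y0).
  apply: (le_trans (hM _ _ c0 x0)); apply: ler_wpM2l => //.
  rewrite distrC (distrC y) !ger0_norm ?subr_ge0 ?lerD2l ?lerN2 ?(ltW yc) ?(ltW cx) ?(ltW yx)//.
- by rewrite !subrr mulr0 subrr normr0 expr0n mulr0.
Qed.

(* The linear extension to the negative half-line keeps the derivative Lipschitz. *)
Definition hl_ext h x : R := if 0 <= x then h x else hl_derive h 0 * x.
Definition hl_ext1 h x : R := hl_derive h (Num.max 0 x).

(** On each side of the origin the bounds are those of the half-line, or trivial by linearity. For
    points on opposite sides they are obtained by passing through 0, where both pieces share value
    and slope. *)
Lemma hl_smooth_coef h (M1 M2 L : R) : hl_C2 h -> h 0 = 0 ->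
  (forall x, 0 <= x -> `|hl_derive h x| <= M1) ->
  (forall x, 0 <= x -> `|hl_derive (hl_derive h) x| <= M2) ->
  1 <= L -> M1 <= L -> 2 * M2 <= L -> smooth_coef L (hl_ext h) (hl_ext1 h).
Proof.
move=> [[hd _] [hd' _]] h0 hM1 hM2 L1 ML1 ML2.
have lip := hl_lipschitz hd hM1; have lip1 := hl_lipschitz hd' hM2.
have tay := hl_taylor hd lip1.
have M20 : 0 <= M2 by apply: le_trans (hM2 0 (lexx 0)).
have M2L : M2 <= L by lra.
have d0 : `|hl_derive h 0| <= M1 by exact: hM1.
have max0 (x : R) : 0 <= Num.max 0 x by rewrite le_max lexx.
have maxlip (x y : R) : `|Num.max 0 x - Num.max 0 y| <= `|x - y|.
  rewrite ler_norml; have := ler_norm (x - y); have := ler_norm (y - x); rewrite (distrC y).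
  by case: (leP 0 x) => x0; case: (leP 0 y) => y0; lra.
have E0 : hl_ext h 0 = 0 by rewrite /hl_ext lexx.
have Epos x : 0 <= x -> hl_ext h x = h x by rewrite /hl_ext => ->.
have Eneg x : x <= 0 -> hl_ext h x = hl_derive h 0 * x.
  move=> x0; rewrite /hl_ext; case: (leP 0 x) => // x0'.
  have -> : x = 0 by apply/eqP; rewrite eq_le x0 x0'.
  by rewrite h0 mulr0.
have E1pos x : 0 <= x -> hl_ext1 h x = hl_derive h x by move=> x0; rewrite /hl_ext1 max_r.
have E1neg x : x <= 0 -> hl_ext1 h x = hl_derive h 0 by move=> x0; rewrite /hl_ext1 max_l.
split => //.
- have M10 : 0 <= M1 by apply: le_trans d0.
  have key x y : x <= y -> `|hl_ext h x - hl_ext h y| <= M1 * `|x - y|.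
    move=> xy; have [x0|x0] := leP 0 x.
      by have y0 := le_trans x0 xy; rewrite (Epos x)// (Epos y)//; exact: lip.
    have [y0|y0] := leP 0 y.
      rewrite (Eneg _ (ltW x0)) (Epos _ y0).
      have a := lip 0 y (lexx 0) y0; rewrite h0 !sub0r !normrN in a.
      rewrite (ger0_norm y0) in a.
      apply: (le_trans (ler_normB _ _)); rewrite normrM.
      have b : `|hl_derive h 0| * `|x| <= M1 * `|x| by exact: ler_wpM2r.
      have nx : `|x| = - x by rewrite ltr0_norm.
      have nxy : `|x - y| = y - x by rewrite distrC ger0_norm// subr_ge0.
      by rewrite nxy; rewrite nx in b *; rewrite mulrBr; lra.
    by rewrite (Eneg _ (ltW x0)) (Eneg _ (ltW y0)) -mulrBr normrM; apply: ler_wpM2r.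
  move=> x y; apply: (@le_trans _ _ (M1 * `|x - y|)); last exact: ler_wpM2r.
  have [xy|/ltW yx] := leP x y; first exact: key.
  by rewrite distrC (distrC x); exact: key.
- by move=> x; apply: (le_trans (hM1 _ (max0 x))).
- move=> x y; apply: (le_trans (lip1 _ _ (max0 x) (max0 y))).
  by apply: ler_pM.
- move=> x y; have sq (z : R) := sqr_ge0 z.
  have LM (z : R) : 2 * M2 * z ^+ 2 <= L * z ^+ 2 by apply: ler_wpM2r.
  have [x0|/ltW x0] := leP 0 x; have [y0|/ltW y0] := leP 0 y.
  + rewrite !Epos// E1pos//; apply: (le_trans (tay x y x0 y0)); exact: ler_wpM2r.
  + rewrite (Epos x)// (Eneg y)// E1pos//; apply: le_trans (LM _).
    have t := tay x 0 x0 (lexx 0); rewrite h0 !sub0r sqrrN in t.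
    have l := lip1 0 x (lexx 0) x0; rewrite sub0r normrN (ger0_norm x0) in l.
    rewrite (_ : _ * y - h x - _ = (- h x - hl_derive h x * - x) + (hl_derive h 0 - hl_derive h x) * y); last ring.
    apply: (le_trans (ler_normD _ _)); rewrite normrM.
    have t2 : `|hl_derive h 0 - hl_derive h x| * `|y| <= M2 * x * - y.
      by rewrite (ler0_norm y0); apply: ler_pM => //; rewrite oppr_ge0.
    have p : 0 <= M2 * (x * - y) by rewrite !mulr_ge0// oppr_ge0.
    have p2 : 0 <= M2 * y ^+ 2 by rewrite mulr_ge0.
    have p3 : 0 <= M2 * x ^+ 2 by rewrite mulr_ge0.
    rewrite (_ : 2 * M2 * (y - x) ^+ 2 = 2 * (M2 * x ^+ 2) + 4 * (M2 * (x * - y)) + 2 * (M2 * y ^+ 2)); last ring.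
    by rewrite -mulrA in t2; lra.
  + rewrite (Eneg x)// (Epos y)// E1neg//; apply: le_trans (LM _).
    have t := tay 0 y (lexx 0) y0; rewrite h0 !subr0 in t.
    rewrite (_ : h y - _ - _ = h y - hl_derive h 0 * y); last ring.
    apply: (le_trans t).
    have p : 0 <= M2 * (- x * y) by rewrite !mulr_ge0// oppr_ge0.
    have p2 : 0 <= M2 * y ^+ 2 by rewrite mulr_ge0.
    have p3 : 0 <= M2 * x ^+ 2 by rewrite mulr_ge0.
    rewrite (_ : 2 * M2 * (y - x) ^+ 2 = 2 * (M2 * x ^+ 2) + 4 * (M2 * (- x * y)) + 2 * (M2 * y ^+ 2)); last ring.
    by lra.
  + rewrite (Eneg x)// (Eneg y)// E1neg// (_ : _ - _ - _ = 0); last ring.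
    by rewrite normr0 mulr_ge0//; lra.
Qed.

End HalfLineCalculus.

(** * The quotients F and f in closed form *)

Section HalfLineQuotient.
Context {R : realType}.
Implicit Types (h : R -> R) (x t : R).

(** Fundamental theorem of calculus on [0, 1] for t -> h(t x) / x, whose derivative is h'(t x). *)
Lemma hl_quotE h x (L : R) : (forall y : R, 0 <= y -> hl_derivable h y) ->
  smooth_coef L (hl_ext h) (hl_ext1 h) -> 0 < x -> hl_quot h x = h x / x.
Proof.
move=> hd sc x0.
have x_neq0 : x != 0 by rewrite gt_eqF.
have cext := lipschitz_continuous (sc_lip sc).
have cext1 := lipschitz_continuous (sc_lip1 sc).
(* Through the extension, F is continuous on the whole line, which gives the one-sided limits at 0
   and 1. *)
pose F (t : R) := hl_ext h (t * x) / x.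
have cm : continuous (fun t : R => t * x) by move=> t; apply: cvgM; [exact: cvg_id|exact: cvg_cst].
have cf : continuous (fun t : R => hl_ext1 h (t * x)).
  by move=> t; apply: (@continuous_comp _ _ _ (fun t : R => t * x) (hl_ext1 h)); [exact: cm|exact: cext1].
have cF : continuous F.
  move=> t; apply: cvgM; last exact: cvg_cst.
  by apply: (@continuous_comp _ _ _ (fun t : R => t * x) (hl_ext h)); [exact: cm|exact: cext].
have dF (t : R) : 0 < t -> is_derive t 1 F (hl_derive h (t * x)).
  move=> t0; have tx : 0 < t * x by rewrite mulr_gt0.
  have /is_derive1_caratheodory[phi [E cphi phi0]] := hl_is_derive tx (hd _ (ltW tx)).
  have : is_derive t 1 (fun t : R => h (t * x) / x) (hl_derive h (t * x)).
    apply/is_derive1_caratheodory; exists (fun s => phi (s * x)); split => //.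
    - by move=> s; rewrite -mulrBl E -mulrBl mulrA mulfK.
    - by apply: (@continuous_comp _ _ _ (fun t : R => t * x) phi); [exact: cm|exact: cphi].
  apply: near_eq_is_derive; near=> s; rewrite /F /hl_ext ifT// mulr_ge0 ?(ltW x0)//.
  by apply: ltW; near: s; exact: lt_nbhsr.
have H := @continuous_FTC2 R (fun t => hl_ext1 h (t * x)) F 0 1 ltr01.
have F0 : F 0 = 0 by rewrite /F mul0r (sc0 sc) mul0r.
have F1 : F 1 = h x / x by rewrite /F mul1r /hl_ext (ltW x0).
have -> : hl_quot h x = \int[lebesgue_measure]_(t in `[0, 1]) hl_ext1 h (t * x).
  apply: eq_Rintegral => t /set_mem; rewrite /= in_itv/= => /andP[t0 _].
  by rewrite /hl_ext1 max_r// mulr_ge0// ltW.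
rewrite /Rintegral H ?F0 ?F1 ?sube0//.
- exact: continuous_subspaceT.
- split.
  + by move=> t; rewrite in_itv/= => /andP[t0 _]; case: (dF _ t0).
  + exact: cvg_at_right_filter (cF 0).
  + exact: cvg_at_left_filter (cF 1).
- move=> t; rewrite in_itv/= => /andP[t0 _]; rewrite derive1E.
  have dft := dF _ t0; rewrite derive_val /hl_ext1 max_r// ltW// mulr_gt0//.
Unshelve. all: by end_near. Qed.

Lemma hl_derive_quot h x (L : R) : (forall y : R, 0 <= y -> hl_derivable h y) ->
  smooth_coef L (hl_ext h) (hl_ext1 h) -> 0 < x ->
  hl_derive (hl_quot h) x = (hl_derive h x - h x / x) / x.
Proof.
move=> hd sc x0.
have x_neq0 : x != 0 by rewrite gt_eqF.
have dh := hl_is_derive x0 (hd _ (ltW x0)).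
suff H : hl_slope (hl_quot h) x y @[y --> x^'] --> (hl_derive h x - h x / x) / x.
  by rewrite {1}/hl_derive within_ge0_dnbhs//; apply: cvg_lim.
have slope : hl_slope h x y @[y --> x^'] --> hl_derive h x.
  exact: hl_slope_cvg x0 (hd _ (ltW x0)).
have : ((hl_slope h x y - h x / x) / y) @[y --> x^'] --> (hl_derive h x - h x / x) / x.
  apply: cvgM; first by apply: cvgB => //; exact: cvg_cst.
  by apply: cvgV => //; exact: nbhs_dnbhs.
apply: cvg_trans; apply: near_eq_cvg; near=> y.
have y0 : 0 < y by near: y; apply: nbhs_dnbhs; exact: lt_nbhsr.
have yx : y - x != 0 by rewrite subr_eq0; near: y; exact: nbhs_dnbhs_neq.
have y_neq0 : y != 0 by rewrite gt_eqF.
rewrite /hl_slope (hl_quotE hd sc y0) (hl_quotE hd sc x0).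
by field; rewrite yx y_neq0 x_neq0.
Unshelve. all: by end_near. Qed.

(** A zero state stays zero in both schemes, whatever the exponents; at a positive state [hl_quotE]
    and [hl_derive_quot] identify them. *)
Lemma scheme_esch (Omega : Type) (G g : R -> R) (LG Lg : R) (B : R -> Omega -> R) (x0 h : R) n w :
  (forall y : R, 0 <= y -> hl_derivable G y) -> (forall y : R, 0 <= y -> hl_derivable g y) ->
  smooth_coef LG (hl_ext G) (hl_ext1 G) -> smooth_coef Lg (hl_ext g) (hl_ext1 g) ->
  0 <= x0 ->
  scheme G g B x0 h n w = esch (hl_ext G) (hl_ext g) (hl_ext1 g) B x0 h n w.
Proof.
move=> dG dg sG sg x00; elim: n => [//|n IH] /=.
rewrite succ_time IH.
have := @esch_ge0 R (hl_ext G) (hl_ext g) (hl_ext1 g) Omega B x0 h n w x00.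
set x := esch _ _ _ _ _ _ _ _; rewrite le0r => /orP[/eqP ->|x_gt0].
  by rewrite /scheme_step /estep mul0r mulr0.
rewrite /scheme_step /estep mulrC; congr (_ * expR _).
rewrite !(quot0E _ x_gt0) (hl_quotE dG sG x_gt0) (hl_quotE dg sg x_gt0).
rewrite (hl_derive_quot dg sg x_gt0).
have gE k : hl_ext k x = k x by rewrite /hl_ext (ltW x_gt0).
by rewrite !gE /hl_ext1 max_r ?(ltW x_gt0)//; field; rewrite gt_eqF.
Qed.

End HalfLineQuotient.

(** * Events of small outer probability *)

Section OuterProbability.
Context d (Omega : measurableType d) (R : realType) (P : probability Omega R).
Implicit Types (A B : set Omega) (a b : R).

(** Smallness through a measurable cover: exceptional sets coming from convergence in probability or
    from almost sure statements need not be measurable. *)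
Definition outer_le a A : Prop :=
  exists A', [/\ measurable A', A `<=` A' & (P A' <= a%:E)%E].

Lemma outer_le_sub a b A B : A `<=` B -> a <= b -> outer_le a B -> outer_le b A.
Proof.
move=> AB ab [B' [mB BB' PB]]; exists B'; split => //; first exact: subset_trans BB'.
by apply: (le_trans PB); rewrite lee_fin.
Qed.

Lemma outer_leU a b A B : outer_le a A -> outer_le b B -> outer_le (a + b) (A `|` B).
Proof.
move=> [A' [mA AA' PA]] [B' [mB BB' PB]]; exists (A' `|` B'); split.
- exact: measurableU.
- exact: setUSS.
- by apply: (le_trans (measureU2 _ mA mB)); rewrite EFinD leeD.
Qed.

Lemma outer_le0 A : P.-negligible A -> outer_le 0 A.
Proof. by move=> [N [mN PN AN]]; exists N; split => //; rewrite PN. Qed.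

Lemma outer_le_ae (Q : Omega -> Prop) : {ae P, forall w, Q w} -> outer_le 0 [set w | ~ Q w].
Proof. by move=> h; apply: outer_le0; move: h; rewrite /almost_everywhere; congr (negligible _ _). Qed.

Lemma outer_le_big a n (A : nat -> set Omega) : (forall j, (j < n)%N -> outer_le a (A j)) ->
  outer_le (n%:R * a) [set w | exists2 j, (j < n)%N & A j w].
Proof.
elim: n => [|n IH] H.
  by exists set0; split => //; [move=> w [] | rewrite measure0 mul0r].
rewrite -natr1 mulrDl mul1r.
have h := outer_leU (IH (fun j jn => H j (leqW jn))) (H n (ltnSn n)).
apply: (outer_le_sub _ _ h) => // w [j]; rewrite ltnS leq_eqVlt => /orP[/eqP ->|jn]; first by right.
by left; exists j.
Qed.

Lemma outer_le_measurable a A : measurable A -> outer_le a A -> (P A <= a%:E)%E.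
Proof. by move=> mA [A' [mA' AA' PA]]; apply: le_trans PA; apply: le_measure; rewrite ?inE. Qed.

Lemma mu_ext_outer_le a A : (mu_ext P A < a%:E)%E -> outer_le a A.
Proof.
move=> /ereal_inf_lt[_ [F [mF AF] <-]] lt; exists (\bigcup_k F k); split => //.
- by apply: bigcup_measurable => k _; exact: mF.
- by apply: (le_trans _ (ltW lt)); apply: measure_sigma_subadditive => //; exact: bigcup_measurable.
Qed.

Lemma cvg0_outer_le (Y : nat -> Omega -> \bar R) (e a : R) : cvg0_in_probability P Y -> 0 < e -> 0 < a ->
  \forall k \near \oo, outer_le a [set w | (e%:E < Y k w)%E].
Proof.
move=> cY e0 a0; have c := cY e e0; have nb : nbhs (0 : \bar R)%E [set y | (y < a%:E)%E].
  by apply: open_nbhs_nbhs; split; [exact: open_ereal_lt_ereal|rewrite /= lte_fin].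
near=> k; apply: mu_ext_outer_le; near: k; exact: (c _ nb).
Unshelve. all: by end_near. Qed.

Lemma measurable_lt_set (f g : Omega -> R) : measurable_fun setT f -> measurable_fun setT g ->
  measurable [set w | f w < g w].
Proof.
move=> mf mg; rewrite (_ : [set w | _] = ~` (setT `&` [set w | g w <= f w])).
  by apply: measurableC; exact: measurable_fun_le.
by rewrite setTI; apply/seteqP; split => w /=; rewrite ltNge => /negP.
Qed.

Lemma markov_sq (Z : Omega -> R) (l c : R) : measurable_fun setT Z -> 0 < l ->
  (\int[P]_w (Z w ^+ 2)%:E <= c%:E)%E -> outer_le (c / l ^+ 2) [set w | l <= `|Z w|].
Proof.
move=> mZ l0 H; set A := [set w | l <= `|Z w|].
have mA : measurable A.
  rewrite -[A]setTI; apply: (@measurable_fun_le _ _ _ setT (cst l) (fun w => `|Z w|)) => //.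
  exact: measurableT_comp mZ.
exists A; split => //.
have -> : (c / l ^+ 2)%:E = (c%:E * ((l ^+ 2)^-1)%:E)%E by rewrite EFinM.
rewrite lee_pdivlMr ?exprn_gt0//; apply: le_trans H.
rewrite muleC -(@integral_cst _ _ _ P _ mA).
apply: (@le_trans _ _ (\int[P]_(w in A) (Z w ^+ 2)%:E)%E).
  apply: ge0_le_integral => //.
  - by move=> w _; rewrite lee_fin sqr_ge0.
  - by apply/measurable_EFinP; apply: measurable_funTS; exact: measurable_funX.
  - move=> w Aw; rewrite lee_fin -(real_normK (num_real (Z w))) lerXn2r ?nnegrE//; exact: ltW.
apply: ge0_subset_integral => //.
- by apply/measurable_EFinP; exact: measurable_funX.
- by move=> w _; rewrite lee_fin sqr_ge0.
Qed.

End OuterProbability.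

(** * A Lenglart inequality for discrete stochastic integrals *)

Section Lenglart.
Context d (Omega : measurableType d) (R : realType) (P : probability Omega R).
Variables (Ft : R -> set (set Omega)) (B : R -> Omega -> R).
Hypotheses (hFt : is_filtration Ft) (hB : is_wiener P Ft B).

Lemma increment_indep u h : 0 <= u -> 0 < h ->
  forall (A : set (g_sigma_algebraType (Ft u))) (C : set R), measurable A -> measurable C ->
    P (idfun @^-1` A `&` increment B u (u + h) @^-1` C) =
    (P (idfun @^-1` A) * normal_prob 0 (Num.sqrt h) C)%E.
Proof.
move=> u0 h0 A C mA mC; have FA : Ft u A by apply/(measurable_Ft hFt).
have uuh : u < u + h by rewrite ltrDl.
have := wiener_indep hB u0 uuh FA mC; rewrite (wiener_normal hB u0 uuh mC).
by rewrite (_ : u + h - u = h) => [E|]; [exact: E|rewrite addrAC subrr add0r].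
Qed.

(** Averaging over b and -b removes the cross term while only nonnegative functions are
    integrated. *)
Lemma integral_normal_affine_sqr (s e b : R) : 0 < s ->
  (\int[normal_prob 0 s]_y ((e + b * y) ^+ 2)%:E = (e ^+ 2 + s ^+ 2 * b ^+ 2)%:E)%E.
Proof.
move=> s0; set V := LHS.
have mf (k : R) : measurable_fun setT (fun y : R => ((e + k * y) ^+ 2)%:E).
  apply/measurable_EFinP; apply: measurable_funX; apply: measurable_funD => //.
have f0 (k y : R) : (0 <= ((e + k * y) ^+ 2)%:E)%E by rewrite lee_fin sqr_ge0.
have V' : (\int[normal_prob 0 s]_y ((e + (- b) * y) ^+ 2)%:E = V)%E.
  apply: etrans (integral_normal_sym s0 (mf b) (f0 b)).
  by apply: eq_integral => y _; rewrite mulNr mulrN.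
have VV : (V + V = (2 * e ^+ 2 + (2 * b ^+ 2) * s ^+ 2 + 0 * Num.sqrt 2)%:E)%E.
  transitivity (\int[normal_prob 0 s]_y (((e + b * y) ^+ 2)%:E + ((e + (- b) * y) ^+ 2)%:E))%E.
    by rewrite ge0_integralD ?V'//; try exact: mf; try by move=> *; exact: f0.
  have p0 : 0 <= 2 * e ^+ 2 by rewrite mulr_ge0 ?sqr_ge0.
  have p1 : 0 <= 2 * b ^+ 2 by rewrite mulr_ge0 ?sqr_ge0.
  apply: etrans (integral_normal_quad s0 p0 p1 (lexx 0)).
  by apply: eq_integral => y _; rewrite -EFinD; congr EFin; ring.
have V0 : (0 <= V)%E by apply: integral_ge0 => y _; exact: f0.
have Vfin : V \is a fin_num.
  rewrite ge0_fin_numE//; have : (V <= V + V)%E by rewrite leeDl.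
  by move=> /le_lt_trans; apply; rewrite VV ltry.
move: VV; rewrite -(fineK Vfin) -EFinD => -[E]; congr EFin; lra.
Qed.

Lemma ito_isometry_step (u h : R) (e b : Omega -> R) : 0 <= u -> 0 <= h -> fm Ft u e -> fm Ft u b ->
  (\int[P]_w ((e w + b w * increment B u (u + h) w) ^+ 2)%:E =
   \int[P]_w (e w ^+ 2 + h * b w ^+ 2)%:E)%E.
Proof.
move=> u0; rewrite le0r => /orP[/eqP ->|h0] me mb.
  by apply: eq_integral => w _; rewrite /increment addr0 subrr mulr0 mul0r !addr0.
have uuh : u <= u + h by rewrite lerDl ltW.
have mI := fm_measurable hFt (le_trans u0 uuh) (fm_increment hFt hB u0 uuh).
pose phi (x : g_sigma_algebraType (Ft u) * R) := ((e x.1 + b x.1 * x.2) ^+ 2)%:E.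
have mphi : measurable_fun setT phi.
  apply/measurable_EFinP; apply: measurable_funX; apply: measurable_funD.
    exact: (measurableT_comp me measurable_fst).
  apply: measurable_funM; last exact: measurable_snd.
  exact: (measurableT_comp mb measurable_fst).
rewrite (_ : (\int[P]_w _)%E = \int[P]_w phi (idfun w, increment B u (u + h) w))%E//.
rewrite (integral_indep (measurable_id_Ft hFt u0) mI (increment_indep u0 h0) (phi := phi))//; last first.
  by move=> x; rewrite lee_fin sqr_ge0.
apply: eq_integral => w _; rewrite /phi/=.
by rewrite (integral_normal_affine_sqr (e w) (b w) (s := Num.sqrt h)) ?sqrtr_gt0// sqr_sqrtr// ltW.
Qed.

Variables (v : nat -> R) (D : nat -> Omega -> R).
Hypotheses (v0 : 0 <= v 0%N) (v_le : forall l, v l <= v l.+1).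
Hypothesis mD : forall l, fm Ft (v l) (D l).

(** Discrete stochastic integral of D along the times v; [qsum] is its bracket and [wmax] its
    running maximum. *)
Definition wsum (D : nat -> Omega -> R) (n : nat) (w : Omega) : R :=
  \sum_(l < n) D l w * increment B (v l) (v l.+1) w.

Definition qsum (D : nat -> Omega -> R) (n : nat) (w : Omega) : R :=
  \sum_(l < n) D l w ^+ 2 * (v l.+1 - v l).

Fixpoint wmax (n : nat) (w : Omega) : R :=
  if n is m.+1 then Num.max (wmax m w) `|wsum D n w| else 0.

Lemma le_wmax m n w : (m <= n)%N -> `|wsum D m w| <= wmax n w.
Proof.
elim: n => [|n IH]; first by rewrite leqn0 => /eqP ->; rewrite /wsum big_ord0 normr0.
rewrite leq_eqVlt => /orP[/eqP ->|]; first by rewrite /= le_max lexx orbT.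
by rewrite ltnS /= le_max => /IH ->.
Qed.

Let v_ge0 l : 0 <= v l.
Proof. by elim: l => // l IH; exact: le_trans (v_le l). Qed.

Lemma wsum_fm D' n : (forall l, fm Ft (v l) (D' l)) -> fm Ft (v n) (wsum D' n).
Proof.
move=> mD'; elim: n => [|n IH].
  by rewrite /wsum; under eq_fun do rewrite big_ord0; exact: fm_cst.
rewrite /wsum; under eq_fun do rewrite big_ord_recr/=.
apply: fmD; first exact: (fm_mono hFt _ (v_le n)).
by apply: fmM; [exact: (fm_mono hFt _ (v_le n))|exact: (fm_increment hFt hB)].
Qed.

Lemma qsum_fm D' n : (forall l, fm Ft (v l) (D' l)) -> fm Ft (v n) (qsum D' n.+1).
Proof.
move=> mD'; elim: n => [|n IH].
  rewrite /qsum; under eq_fun do rewrite big_ord1; apply: fmM; last exact: fm_cst.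
  exact: fmX.
rewrite /qsum; under eq_fun do rewrite big_ord_recr/=.
apply: fmD; first exact: (fm_mono hFt _ (v_le n)).
by apply: fmM; [exact: fmX|exact: fm_cst].
Qed.

Lemma wmax_fm n : fm Ft (v n) (wmax n).
Proof.
have mabs l : fm Ft (v l) (fun w => `|wsum D l w|).
  by apply: (fm_comp (k := Num.norm)); [exact: normr_measurable|exact: wsum_fm].
elim: n => [|n IH] /=; first exact: fm_cst.
have IH1 := fm_mono hFt (v_ge0 n) (v_le n) IH; apply: measurable_maxr; [exact: IH1|exact: mabs].
Qed.

Lemma qsum_measurable D' n : (forall l, fm Ft (v l) (D' l)) -> measurable_fun setT (qsum D' n).
Proof.
move=> mD'; case: n => [|n]; last exact: (fm_measurable hFt (v_ge0 n) (qsum_fm mD')).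
by rewrite (_ : qsum D' 0 = cst 0)//; apply/funext => w; rewrite /qsum big_ord0.
Qed.

Lemma wmax_measurable n : measurable_fun setT (wmax n).
Proof. exact: (fm_measurable hFt (v_ge0 n) (@wmax_fm n)). Qed.

Section Stopped.
Variables (lam eta : R).
Hypotheses (lam0 : 0 < lam) (eta0 : 0 <= eta).

(** D is switched off once the running maximum has reached [lam] or the bracket, current step
    included, exceeds [eta]. Both conditions are known at time v l, so adaptedness is preserved. *)
Let D' l w : R := if (wmax l w < lam) && (qsum D l.+1 w <= eta) then D l w else 0.

Let mD' l : fm Ft (v l) (D' l).
Proof.
apply: measurable_fun_ifT; [apply: measurable_and|exact: mD|exact: fm_cst].
- by apply: measurable_fun_ltr; [exact: wmax_fm|exact: fm_cst].
- by apply: measurable_fun_ler; [exact: qsum_fm|exact: fm_cst].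
Qed.

Let qsum_ge0 D'' n w : 0 <= qsum D'' n w.
Proof. by apply: sumr_ge0 => l _; rewrite mulr_ge0 ?sqr_ge0 ?subr_ge0. Qed.

Let qsum_stopped n w : qsum D' n w <= qsum D n w /\ qsum D' n w <= eta.
Proof.
elim: n => [|n [IH1 IH2]]; first by rewrite /qsum !big_ord0.
rewrite /qsum !big_ord_recr/= -!/(qsum _ _ _).
have dv : 0 <= v n.+1 - v n by rewrite subr_ge0.
rewrite {2 4}/D'; case: ifPn => [/andP[_ Q]|_]; last first.
  rewrite expr0n/= mul0r addr0; split => //; apply: (le_trans IH1).
  by rewrite lerDl mulr_ge0 ?sqr_ge0.
rewrite lerD2r; split => //; apply: le_trans Q.
by rewrite /qsum big_ord_recr/= lerD2r.
Qed.

Let stopped_isometry n :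
  (\int[P]_w (wsum D' n w ^+ 2)%:E = \int[P]_w (qsum D' n w)%:E)%E.
Proof.
elim: n => [|n IH].
  by apply: eq_integral => w _; rewrite /wsum /qsum !big_ord0 expr0n.
under eq_integral do rewrite /wsum big_ord_recr/= -/(wsum _ _ _).
have dv : 0 <= v n.+1 - v n by rewrite subr_ge0.
have vE : v n.+1 = v n + (v n.+1 - v n) by rewrite addrC subrK.
rewrite {1}vE (ito_isometry_step (v_ge0 n) dv (wsum_fm mD') (@mD' n)).
have mw := fm_measurable hFt (v_ge0 n) (wsum_fm mD').
have mDn := fm_measurable hFt (v_ge0 n) (@mD' n).
have mq := qsum_measurable n mD'.
under eq_integral do rewrite EFinD.
have mD2 : measurable_fun setT (fun w => ((v n.+1 - v n) * D' n w ^+ 2)%:E).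
  by apply/measurable_EFinP; apply: measurable_funM => //; exact: measurable_funX.
rewrite ge0_integralD//; last 3 first.
- by move=> w _; rewrite lee_fin sqr_ge0.
- by apply/measurable_EFinP; exact: measurable_funX.
- by move=> w _; rewrite lee_fin mulr_ge0 ?sqr_ge0.
rewrite IH -ge0_integralD//; last 3 first.
- by move=> w _; rewrite lee_fin.
- exact/measurable_EFinP.
- by move=> w _; rewrite lee_fin mulr_ge0 ?sqr_ge0.
by apply: eq_integral => w _; rewrite /qsum big_ord_recr/= EFinD (mulrC (v n.+1 - v n)).
Qed.

(** While the bracket stays below [eta], the stopped integral follows the original one until it
    first reaches [lam] in absolute value and is frozen there. *)
Let stopped_alive n w : qsum D n w <= eta ->
  if wmax n w < lam then wsum D' n w = wsum D n w else lam <= `|wsum D' n w|.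
Proof.
elim: n => [|n IH] Q.
  by rewrite /= lam0 /wsum !big_ord0.
have {}IH : if wmax n w < lam then wsum D' n w = wsum D n w else lam <= `|wsum D' n w|.
  apply: IH; apply: le_trans Q; rewrite /qsum big_ord_recr/= lerDl.
  by rewrite mulr_ge0 ?sqr_ge0 ?subr_ge0.
have E : wsum D' n.+1 w = wsum D' n w + D' n w * increment B (v n) (v n.+1) w.
  by rewrite /wsum big_ord_recr.
rewrite /=; move: IH; case: (ltP (wmax n w) lam) => al IH; last first.
  rewrite ifF; last by rewrite gt_max (ltNge (wmax n w)) al.
  by rewrite E /D' (ltNge (wmax n w)) al /= mul0r addr0.
have E' : wsum D' n.+1 w = wsum D n.+1 w.
  by rewrite E IH /D' al Q /= /wsum big_ord_recr.
rewrite gt_max al /=; case: ltP => //; by rewrite E'.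
Qed.

(** Unless the bracket exceeds [eta], a large running maximum forces a large terminal value of the
    stopped integral. The isometry bounds its second moment by [eta], and Markov's inequality
    concludes. *)
Lemma lenglart n (a : R) : outer_le P a [set w | eta < qsum D n w] ->
  outer_le P (a + eta / lam ^+ 2) [set w | lam <= wmax n w].
Proof.
move=> H.
have M : outer_le P (eta / lam ^+ 2) [set w | lam <= `|wsum D' n w|].
  apply: markov_sq => //; first exact: (fm_measurable hFt (v_ge0 n) (wsum_fm mD')).
  rewrite stopped_isometry -(int_cst P eta); apply: ge0_le_integral => //.
  - by move=> w _; rewrite lee_fin.
  - apply/measurable_EFinP; exact: qsum_measurable.
  - by move=> w _; rewrite lee_fin; case: (qsum_stopped n w).
apply: (outer_le_sub _ _ (outer_leU H M)) => // w /= lw.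
have [Q|Q] := ltP eta (qsum D n w); [by left|right].
by have := stopped_alive Q; rewrite ltNge lw.
Qed.

End Stopped.

End Lenglart.

(** * Lower sums of an integral *)

Section LowerSum.
Context {R : realType}.
Local Notation mu := (@lebesgue_measure R).

Lemma cst_le_integral (a b c : R) (f : R -> \bar R) : a <= b -> 0 <= c ->
  measurable_fun (`]a, b] : set R) f -> (forall s, s \in `]a, b] -> (c%:E <= f s)%E) ->
  ((c * (b - a))%:E <= \int[mu]_(s in `]a, b]) f s)%E.
Proof.
move=> ab c0 mf cf.
have -> : ((c * (b - a))%:E = \int[mu]_(s in `]a, b]) c%:E)%E.
  rewrite integral_cst//= lebesgue_measure_itv/= lte_fin.
  move: ab; rewrite le_eqVlt => /predU1P[->|ab]; last by rewrite ab -EFinB -EFinM.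
  by rewrite ltxx subrr mulr0 mule0.
by apply: ge0_le_integral.
Qed.

Lemma lower_sum_le (v c : nat -> R) (f : R -> \bar R) (T : R) K : v 0%N = 0 ->
  (forall l, v l <= v l.+1) -> v K <= T -> (forall l, 0 <= c l) ->
  measurable_fun (`[0, T] : set R) f -> (forall s, (0 <= f s)%E) ->
  (forall l s, (l < K)%N -> s \in `]v l, v l.+1] -> ((c l)%:E <= f s)%E) ->
  ((\sum_(l < K) c l * (v l.+1 - v l))%:E <= \int[mu]_(s in `[0%R, v K]) f s)%E.
Proof.
move=> v0 v_le; elim: K => [|K IH] vT c0 mf f0 cf.
  by rewrite big_ord0; apply: integral_ge0.
have vK0 : 0 <= v K by elim: (K) => [|k]; [rewrite v0|move=> /le_trans; apply].
have U : `[0, v K.+1]%classic = `[0, v K]%classic `|` `]v K, v K.+1]%classic.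
  by rewrite -(@itv_bndbnd_setU _ _ (BLeft 0) (BRight (v K)) (BRight (v K.+1)))// bnd_simp.
have sub (a b : R) bb : 0 <= a -> b <= T -> [set` Interval (BSide bb a) (BRight b)] `<=` `[0, T]%classic.
  move=> a0 bT s /=; rewrite !in_itv/=; case: bb => /= /andP[as' sb]; rewrite (le_trans sb bT) andbT.
    exact: le_trans as'.
  exact: le_trans (ltW as').
have m1 : measurable_fun (`[0, v K] : set R) f.
  by apply: (measurable_funS _ _ mf) => //; apply: sub => //; apply: le_trans vT.
have m2 : measurable_fun (`]v K, v K.+1] : set R) f.
  by apply: (measurable_funS _ _ mf) => //; exact: sub.
rewrite big_ord_recr/= EFinD U ge0_integral_setU//=.
- apply: leeD.
    by apply: IH => // [|l s lK]; [exact: le_trans vT|apply: cf; exact: ltnW].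
  by apply: cst_le_integral => // s sv; apply: cf.
- by rewrite measurable_funU.
- apply/disj_setPS => s [/=]; rewrite !in_itv/= => /andP[_ sK] /andP[Ks _].
  by move: (lt_le_trans Ks sK); rewrite ltxx.
Qed.

End LowerSum.

(** * Common refinement of a uniform grid and a simple process *)

Section Refinement.
Context d (Omega : measurableType d) (R : realType) (P : probability Omega R).
Variables (Ft : R -> set (set Omega)) (B : R -> Omega -> R).
Hypotheses (hFt : is_filtration Ft) (hB : is_wiener P Ft B).
Variables (S : simple_process Ft) (h : R) (gam : nat -> Omega -> R).
Hypotheses (h0 : 0 <= h) (mgam : forall i, fm Ft (i%:R * h) (gam i)).

Local Notation s := (sp_time S).
Local Notation N := (sp_size S).
Let r (i : nat) : R := i%:R * h.

Let r_ge0 i : 0 <= r i. Proof. exact: mulr_ge0. Qed.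
Let r_le i : r i <= r i.+1. Proof. by rewrite /r succ_time lerDl. Qed.

Let s_mono i j : (i <= j)%N -> s i <= s j.
Proof.
elim: j => [|j IH]; first by rewrite leqn0 => /eqP ->.
rewrite leq_eqVlt => /orP[/eqP -> //|]; rewrite ltnS => /IH /le_trans; apply.
exact: sp_time_le.
Qed.

Let s_ge0 i : 0 <= s i. Proof. exact: le_trans (sp_time_ge0 S) (s_mono (leq0n i)). Qed.

Definition clamp (i j : nat) : R := Num.min (Num.max (s j) (r i)) (r i.+1).

(** Cut points of the i-th uniform interval: its two ends and, between them, the times s 0, ..., s N
    projected onto it. Every interval gets N.+2 cells, possibly degenerate, so that cells are
    numbered by quotient and remainder. *)
Definition cell (i j : nat) : R :=
  if j == 0%N then r i else if (j <= N.+1)%N then clamp i j.-1 else r i.+1.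

(** The simple process minus [gam] on a cell; the first and last cells lie outside the range of the
    simple process. If [s j.-1 <= r i.+1] fails, the cell is reduced to a point at which the
    coefficient is not yet known, and 0 keeps the family adapted. *)
Definition cell_coef (i j : nat) (w : Omega) : R :=
  (if [&& (0 < j)%N, (j <= N)%N & s j.-1 <= r i.+1] then sp_coef S j.-1 w else 0) - gam i w.

Definition ref_time (l : nat) : R := cell (l %/ N.+2) (l %% N.+2).
Definition ref_coef (l : nat) : Omega -> R := cell_coef (l %/ N.+2) (l %% N.+2).

Let clamp_ge i j : r i <= clamp i j.
Proof. by rewrite /clamp le_min le_max lexx orbT r_le. Qed.

Let clamp_le i j : clamp i j <= r i.+1.
Proof. by rewrite /clamp ge_min lexx orbT. Qed.

Let cell_le i j : cell i j <= cell i j.+1.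
Proof.
rewrite /cell /=; case: j => [|j] /=; first exact: clamp_ge.
case: (leqP j.+1 N.+1) => jN; last by rewrite ifF//; apply/negbTE; rewrite -ltnNge; exact: ltnW.
case: (leqP j.+2 N.+1) => _; last exact: clamp_le.
rewrite /clamp /= le_min; apply/andP; split; last by rewrite ge_min lexx orbT.
by rewrite ge_min ge_max !le_max lexx sp_time_le orbT.
Qed.

Let ref_timeE i j : (j <= N.+2)%N -> ref_time (i * N.+2 + j) = cell i j.
Proof.
rewrite leq_eqVlt => /orP[/eqP ->|jN].
  by rewrite -mulSnr /ref_time mulnK// modnMl /cell/= ltnn.
by rewrite /ref_time divnMDl// divn_small// addn0 modnMDl modn_small.
Qed.

Let ref_coefE i j : (j < N.+2)%N -> ref_coef (i * N.+2 + j) = cell_coef i j.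
Proof. by move=> jN; rewrite /ref_coef divnMDl// divn_small// addn0 modnMDl modn_small. Qed.

Lemma ref_time0 : ref_time 0 = 0.
Proof. by rewrite /ref_time div0n mod0n /cell/= /r mul0r. Qed.

Lemma ref_timeM n : ref_time (n * N.+2) = n%:R * h.
Proof. by rewrite -[(n * _)%N]addn0 ref_timeE. Qed.

Lemma ref_time_le l : ref_time l <= ref_time l.+1.
Proof.
have jN : (l %% N.+2 < N.+2)%N by rewrite ltn_mod.
have -> : ref_time l.+1 = cell (l %/ N.+2) (l %% N.+2).+1.
  by rewrite -ref_timeE// addnS -divn_eq.
exact: cell_le.
Qed.

Lemma ref_coef_fm l : fm Ft (ref_time l) (ref_coef l).
Proof.
rewrite /ref_time /ref_coef; move: (l %/ _)%N (l %% _)%N => i j.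
have c0 : r i <= cell i j.
  by rewrite /cell; case: ifP => // _; case: ifP => _; [exact: clamp_ge|exact: r_le].
rewrite /cell_coef; apply: fmB; last exact: (fm_mono hFt (r_ge0 i) c0 (@mgam i)).
case: (boolP [&& _, _ & _]) => [/and3P[j0 jN sr]|_]; last exact: fm_cst.
apply: (fm_mono hFt (s_ge0 j.-1)); last first.
  by apply: (fmP hFt (s_ge0 _)); exact: sp_coef_measurable.
rewrite /cell gtn_eqF// ifT; last exact: leqW.
by rewrite /clamp le_min sr andbT le_max lexx.
Qed.

Lemma big_blocks (F : nat -> R) n m :
  \sum_(l < n * m) F l = \sum_(i < n) \sum_(j < m) F (i * m + j)%N.
Proof.
elim: n => [|n IH]; first by rewrite mul0n !big_ord0.
by rewrite mulSnr big_split_ord/= IH big_ord_recr.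
Qed.

Let clampB (b : R -> R) i j :
  b (clamp i j) = b (Num.min (r i.+1) (s j)) - b (Num.min (r i) (s j)) + b (r i).
Proof.
rewrite /clamp; have ri := r_le i.
case: (leP (s j) (r i)) => si.
  by rewrite (min_l ri) (min_r (le_trans si ri)) subrr add0r.
case: (leP (s j) (r i.+1)) => si1; last by rewrite addrAC addrK // addrC addrK.
by rewrite subrK.
Qed.

(** Inside the i-th interval the cells add up to the increment of the simple integral, written with
    minima by [clampB], and the part in [gam] telescopes. *)
Lemma ref_wsum n w : wsum B ref_time ref_coef (n * N.+2) w =
  sp_integral B S (n%:R * h) w - \sum_(i < n) gam i w * increment B (i%:R * h) (i.+1%:R * h) w.
Proof.
rewrite /wsum (big_blocks (fun l => ref_coef l w * increment B (ref_time l) (ref_time l.+1) w)).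
have sp0 : sp_integral B S (r 0) w = 0.
  by rewrite /sp_integral big1// => j _; rewrite /r mul0r !min_l ?s_ge0// subrr mulr0.
transitivity (\sum_(i < n) (sp_integral B S (r i.+1) w - sp_integral B S (r i) w
    - gam i w * increment B (r i) (r i.+1) w)); last first.
  rewrite sumrB; congr (_ - _).
  by rewrite -(big_mkord xpredT (fun i => sp_integral B S (r i.+1) w - sp_integral B S (r i) w))
     telescope_sumr// sp0 subr0.
apply: eq_bigr => i _.
transitivity (\sum_(j < N.+2) cell_coef i j w * (B (cell i j.+1) w - B (cell i j) w)).
  apply: eq_bigr => j _; have jN := ltn_ord j.
  by rewrite ref_coefE// -addnS !ref_timeE// ltnW.
under eq_bigr do rewrite mulrBl; rewrite sumrB; congr (_ - _); last first.
  rewrite -mulr_sumr -(big_mkord xpredT (fun j => B (cell i j.+1) w - B (cell i j) w)).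
  by rewrite telescope_sumr// /cell/= ltnn.
rewrite big_ord_recl big_ord_recr/= /bump/= add1n ltnn !mul0r add0r addr0.
rewrite /sp_integral -sumrB; apply: eq_bigr => j _; have jN := ltn_ord j.
have jN1 : (j <= N)%N := ltnW jN.
rewrite /bump/= add1n /cell_coef /cell/= !ltnS jN jN1 -mulrBr /=.
rewrite !(clampB (B ^~ w)); case: ifPn => sr; first by congr (_ * _); ring.
rewrite mul0r; have {}sr : r i.+1 <= s j by rewrite ltW// ltNge.
have sr1 : r i.+1 <= s j.+1 by exact: le_trans (sp_time_le S j).
have ri := r_le i.
by rewrite !min_l ?(le_trans ri)//; ring.
Qed.

Let sp_val_out t w : (t <= s 0%N) || (s N < t) -> sp_val S t w = 0.
Proof.
move=> H; apply: big1 => k _; rewrite indicE memNset ?mulr0//= in_itv/=.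
case/orP: H => H; apply/negP; rewrite negb_and -!leNgt -ltNge.
  by rewrite (le_trans H)// s_mono.
by rewrite orbC (le_lt_trans _ H)// s_mono.
Qed.

Let sp_val_in t w k : (k < N)%N -> s k < t <= s k.+1 -> sp_val S t w = sp_coef S k w.
Proof.
move=> kN /andP[st ts]; rewrite /sp_val (bigD1 (Ordinal kN))//= big1 ?addr0.
  by rewrite indicE mem_set ?mulr1//= in_itv/= st ts.
move=> j; rewrite -val_eqE/= => jk; rewrite indicE memNset ?mulr0//= in_itv/=.
apply/negP; rewrite negb_and -leNgt -ltNge; apply/orP.
case: (ltngtP j k) jk => // [jk|kj] _.
  by right; apply: le_lt_trans st; exact: s_mono.
by left; apply: (le_trans ts); exact: s_mono.
Qed.

Let cell_coefE i j t w : t \in `]cell i j, cell i j.+1] -> (j < N.+2)%N ->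
  cell_coef i j w = sp_val S t w - gam i w.
Proof.
rewrite in_itv/= => /andP[t1 t2] jN; rewrite /cell_coef; congr (_ - _).
have up k : r i < t -> t <= clamp i k -> t <= s k.
  move=> rt; rewrite /clamp le_min le_max => /andP[/orP[//|tr] _].
  by move: (lt_le_trans rt tr); rewrite ltxx.
have lo k : clamp i k < t -> t <= r i.+1 -> s k < t.
  move=> ct tr; move: ct; rewrite /clamp gt_min gt_max => /orP[/andP[]//|rt].
  by move: (lt_le_trans rt tr); rewrite ltxx.
case: j jN t1 t2 => [|j]; rewrite /cell/=.
  by move=> _ t1 t2; rewrite sp_val_out// (up _ t1 t2).
rewrite !ltnS => jN; rewrite jN; case: ltnP => [jN'|Nj] t1 t2 /=; last first.
  have jN' : j = N by apply/eqP; rewrite eqn_leq Nj jN.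
  by rewrite sp_val_out// -jN' (lo _ t1 t2) orbT.
have t3 := le_trans t2 (clamp_le _ _).
have sjt := lo _ t1 t3; rewrite (le_trans (ltW sjt) t3).
by rewrite (@sp_val_in t w j)// sjt (up _ (le_lt_trans (clamp_ge _ _) t1) t2).
Qed.

(** On a cell the coefficient equals (S - H) + (H - gam) at every time, so its square is below 2 (S
    - H)^2 + 2 e^2 throughout, and [lower_sum_le] integrates this. *)
Lemma ref_qsum (H : R -> R) (T e : R) n w : n%:R * h <= T ->
  measurable_fun (`[0, T] : set R) H ->
  (forall i t, (i < n)%N -> i%:R * h <= t <= i.+1%:R * h -> `|H t - gam i w| <= e) ->
  ((qsum ref_time ref_coef (n * N.+2) w)%:E <=
    2%:E * \int[lebesgue_measure]_(t in `[0%R, T]) ((sp_val S t w - H t) ^+ 2)%:E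
      + (2 * e ^+ 2 * T)%:E)%E.
Proof.
move=> nT mH He.
have T0 : 0 <= T by exact: le_trans (r_ge0 n) nT.
have mS : measurable_fun (`[0, T] : set R) (fun t => sp_val S t w).
  apply: measurable_funTS; apply: measurable_sum => k; apply: measurable_funM => //.
have mD : measurable_fun (`[0, T] : set R) (fun t => ((sp_val S t w - H t) ^+ 2)%:E).
  by apply/measurable_EFinP; apply: measurable_funX; exact: measurable_funB.
pose f t : \bar R := (2%:E * ((sp_val S t w - H t) ^+ 2)%:E + (2 * e ^+ 2)%:E)%E.
have f0 t : (0 <= f t)%E by rewrite /f -EFinM -EFinD lee_fin addr_ge0// mulr_ge0// sqr_ge0.
have mf : measurable_fun (`[0, T] : set R) f.
  by apply: emeasurable_funD => //; exact: emeasurable_funM.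
have -> : (2%:E * \int[lebesgue_measure]_(t in `[0%R, T]) ((sp_val S t w - H t) ^+ 2)%:E
      + (2 * e ^+ 2 * T)%:E = \int[lebesgue_measure]_(t in `[0%R, T]) f t)%E.
  rewrite ge0_integralD//=; try exact: emeasurable_funM;
    try by move=> t _; rewrite -?EFinM lee_fin mulr_ge0// sqr_ge0.
  rewrite ge0_integralZl//=; last by move=> t _; rewrite lee_fin sqr_ge0.
  congr (_ + _)%E; rewrite integral_cst//= lebesgue_measure_itv/= lte_fin.
  move: T0; rewrite le_eqVlt => /predU1P[<-|T0]; last by rewrite T0 -EFinB subr0 -EFinM.
  by rewrite ltxx mulr0 mule0.
have rM := ref_timeM n.
apply: (@le_trans _ _ (\int[lebesgue_measure]_(t in `[0%R, ref_time (n * N.+2)]) f t)%E).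
  apply: (@lower_sum_le _ ref_time (fun l => ref_coef l w ^+ 2) f T) => //.
  - exact: ref_time0.
  - exact: ref_time_le.
  - by rewrite rM.
  - by move=> l; exact: sqr_ge0.
  - move=> l t lK tl.
    have lE := divn_eq l N.+2; set i := (l %/ N.+2)%N in lE; set j := (l %% N.+2)%N in lE.
    have jN : (j < N.+2)%N by rewrite /j ltn_mod.
    have in_ : (i < n)%N by rewrite /i ltn_divLR.
    have tc : t \in `]cell i j, cell i j.+1].
      by move: tl; rewrite lE -addnS !ref_timeE// ltnW.
    have := cell_coefE w tc jN.
    rewrite {1}lE ref_coefE// => ->; rewrite /f -EFinM -EFinD lee_fin.
    have it : r i <= t <= r i.+1.
      move: tc; rewrite in_itv/= => /andP[c1 c2]; apply/andP; split.
        by apply: le_trans (ltW c1); rewrite /cell; case: ifP => // _; case: ifP.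
      by apply: (le_trans c2); rewrite /cell/=; case: ifP.
    have := He i t in_ it; have e0 : 0 <= e by exact: le_trans (He i t in_ it).
    rewrite ler_norml => /andP[a1 a2].
    have sq : (H t - gam i w) ^+ 2 <= e ^+ 2.
      by rewrite -(real_normK (num_real (H t - _))) lerXn2r ?nnegrE// ler_norml a1 a2.
    have -> : sp_val S t w - gam i w = (sp_val S t w - H t) + (H t - gam i w) by ring.
    move: (sp_val S t w - H t) (H t - gam i w) sq => p q sq.
    have pq := sqr_ge0 (p - q); rewrite sqrrB in pq; rewrite sqrrD; lra.
apply: ge0_subset_integral => //.
by move=> t /=; rewrite !in_itv/= => /andP[-> /le_trans]; apply; rewrite rM.
Qed.

End Refinement.

(** * Uniform continuity of paths and Riemann sums *)

Section PathRegularity.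
Context {R : realType}.
Local Notation mu := (@lebesgue_measure R).

(** Heine's theorem by compactness; only s is confined to [0, T]. *)
Lemma heine (f : R -> R) (T e : R) : {within `[0, +oo[, continuous f} -> 0 < e ->
  exists2 r : R, 0 < r & forall s t, 0 <= s <= T -> 0 <= t -> `|s - t| < r -> `|f s - f t| <= e.
Proof.
move=> cf e0; have /compact_near_coveringP cov := @segment_compact R 0 T.
pose Q (r x : R) := forall t, 0 <= t -> `|x - t| < r -> `|f x - f t| <= e.
have : \forall r \near (0 : R)^'+, `[0, T]%classic `<=` [set x | 0 <= x -> Q r x].
  apply: cov => x /=; rewrite in_itv/= => /andP[x0 _].
  move/subspace_continuousP : cf => /(_ x); rewrite /= in_itv/= x0 => /(_ isT).
  move=> /cvgrPdist_lt /(_ (e / 2)); rewrite divr_gt0// => /(_ isT).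
  rewrite near_withinE => -[r /= r0 H].
  exists ([set y | `|x - y| < r / 2], [set i | i < r / 2]) => /=.
    split; first by exists (r / 2) => //=; rewrite divr_gt0.
    by exists (r / 2) => /=; [rewrite divr_gt0|move=> y /=; rewrite sub0r normrN => /(le_lt_trans (ler_norm _))].
  move=> [y i] /= [xy ir] y0 t t0 yt.
  have r2 : `|x - t| < r.
    have := ler_normD (x - y) (y - t); rewrite addrA subrK; lra.
  have xy' : `|x - y| < r by lra.
  have h1 := H y xy'; rewrite in_itv/= y0 in h1; have {}h1 := h1 isT.
  have h2 := H t r2; rewrite in_itv/= t0 in h2; have {}h2 := h2 isT.
  have := ler_normB (f x - f t) (f x - f y).
  rewrite (_ : _ - (f x - f y) = f y - f t); last ring.
  lra.
move=> [r /= r0 H]; exists (r / 2); first by rewrite divr_gt0.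
move=> s t /andP[s0 sT] t0 st; have r2 : 0 < r / 2 by rewrite divr_gt0.
have := H (r / 2); rewrite /= sub0r normrN gtr0_norm// ltr_pdivrMr// ltr_pMr// ltr1n => /(_ isT r2 s).
by rewrite /= in_itv/= s0 sT => /(_ isT isT); apply.
Qed.

Lemma rat_near (T s r : R) : 0 < T -> 0 <= s <= T -> 0 < r ->
  exists2 p : rat, 0 <= (ratr p : R) <= T & `|s - ratr p| < r.
Proof.
move=> T0 /andP[s0 sT] r0.
have lt : Num.max 0 (s - r) < Num.min T (s + r).
  by rewrite gt_max !lt_min T0 /= ltr_wpDl//= -ltrBrDr; lra.
have [p /itvP pI] := rat_in_itvoo lt.
have /andP[p0 ps] : (0 < (ratr p : R)) && (s - r < ratr p).
  by rewrite -gt_max pI.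
have /andP[pT sp] : ((ratr p : R) < T) && (ratr p < s + r).
  by rewrite -lt_min pI.
exists p; first by rewrite (ltW p0) (ltW pT).
by rewrite ltr_norml; lra.
Qed.

Lemma drift_sum (f : R -> R) (c : nat -> R) (h e : R) n : 0 <= h ->
  {within `[0, +oo[, continuous f} ->
  (forall i t, (i < n)%N -> i%:R * h <= t <= i.+1%:R * h -> `|f t - c i| <= e) ->
  `|\int[mu]_(t in `[0, n%:R * h]) f t - \sum_(i < n) c i * h| <= e * (n%:R * h).
Proof.
move=> h0 cf; elim: n => [|n IH] H.
  by rewrite big_ord0 mul0r set_itv1 Rintegral_set1 subr0 normr0 mulr0.
have n0 : 0 <= n%:R * h by rewrite mulr_ge0.
have nn : n%:R * h <= n.+1%:R * h by rewrite succ_time lerDl.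
have itg : mu.-integrable `[0, n.+1%:R * h]%classic (EFin \o f).
  apply: continuous_compact_integrable; first exact: segment_compact.
  apply: continuous_subspaceW cf => t /=; rewrite !in_itv/= andbT => /andP[]//.
have := @Rintegral_itvB R f (BLeft 0) (BRight (n.+1%:R * h)) (n%:R * h) itg.
rewrite !bnd_simp => /(_ n0 nn) /eqP; rewrite subr_eq => /eqP ->.
rewrite big_ord_recr/=.
have {}IH := IH (fun i t i_n => H i t (leqW i_n)).
suff : `|\int[mu]_(t in `]n%:R * h, n.+1%:R * h]) f t - c n * h| <= e * h.
  move=> last; rewrite [_ + \int[mu]_(t in `[_, _]) _]addrC opprD addrACA.
  by apply: (le_trans (ler_normD _ _)); rewrite {2}succ_time mulrDr; exact: lerD.
have itg2 : mu.-integrable `]n%:R * h, n.+1%:R * h]%classic (EFin \o f).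
  apply: integrableS itg => // t /=; rewrite !in_itv/= => /andP[nt ->]; rewrite andbT.
  by rewrite ltW// (le_lt_trans n0).
have mI : fine (mu `]n%:R * h, n.+1%:R * h]%classic) = h.
  rewrite lebesgue_measure_itv/= lte_fin.
  case: ltP => [_|]; first by rewrite -EFinB/= succ_time addrAC subrr add0r.
  by rewrite succ_time => hh; apply/eqP; rewrite eq_le h0/=; lra.
have itc (k : R) : mu.-integrable `]n%:R * h, n.+1%:R * h]%classic (EFin \o (fun=> k)).
  have : mu.-integrable `[0, n.+1%:R * h]%classic (EFin \o (fun=> k)).
    apply: continuous_compact_integrable; first exact: segment_compact.
    by apply: continuous_subspaceT => t; exact: cvg_cst.
  apply: integrableS => // t /=; rewrite !in_itv/= => /andP[nt ->]; rewrite andbT.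
  by rewrite ltW// (le_lt_trans n0).
have bnd t : `]n%:R * h, n.+1%:R * h]%classic t -> `|f t - c n| <= e.
  by rewrite /= in_itv/= => /andP[t1 t2]; apply: (H n t (ltnSn n)); rewrite (ltW t1).
have up : \int[mu]_(t in `]n%:R * h, n.+1%:R * h]) f t <= (c n + e) * h.
  have <- : \int[mu]_(t in `]n%:R * h, n.+1%:R * h]) (c n + e) = (c n + e) * h by rewrite Rintegral_cst// mI.
  apply: le_Rintegral => [//|//|//|t tI].
  by have := bnd t tI; rewrite ler_norml => /andP[]; lra.
have lo : (c n - e) * h <= \int[mu]_(t in `]n%:R * h, n.+1%:R * h]) f t.
  have <- : \int[mu]_(t in `]n%:R * h, n.+1%:R * h]) (c n - e) = (c n - e) * h by rewrite Rintegral_cst// mI.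
  apply: le_Rintegral => [//|//|//|t tI].
  by have := bnd t tI; rewrite ler_norml => /andP[]; lra.
clear -up lo; move: (\int[mu]_(t in _) _) up lo => I; rewrite mulrDl mulrBl => up lo.
by rewrite ler_norml; apply/andP; split; lra.
Qed.

End PathRegularity.

(** * Modulus of continuity in probability *)

Section Modulus.
Context d (Omega : measurableType d) (R : realType) (P : probability Omega R).
Variable X : R -> Omega -> R.
Hypotheses (mX : forall t, 0 <= t -> measurable_fun setT (X t)) (cX : continuous_paths P X).

(** Restricted to rational times the event F k is measurable and decreases, as k grows, to a null
    set, since almost every path is uniformly continuous. Continuity from above gives a k with small
    probability, and path continuity extends it to real times. *)
Lemma modulus (T e a : R) : 0 < T -> 0 < e -> 0 < a -> exists2 r : R, 0 < r &
  outer_le P a [set w | exists s t, [/\ 0 <= s <= T, 0 <= t <= T, `|s - t| < r & e < `|X s w - X t w| ]].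
Proof.
move=> T0 e0 a0.
pose A (r : R) (p q : rat) := [set w | [&& 0 <= (ratr p : R), ratr p <= T, 0 <= (ratr q : R), ratr q <= T,
   `|ratr p - ratr q| < r & e < `|X (ratr p) w - X (ratr q) w| ] ].
pose F (k : nat) := \bigcup_p \bigcup_q A (k.+1%:R^-1) p q.
have mF k : measurable (F k).
  apply: bigcupT_measurable_rat => p; apply: bigcupT_measurable_rat => q; rewrite /A.
  have [p0|p0] := leP 0 (ratr p : R); last by rewrite set_false.
  have [pT|pT] := leP (ratr p) T; last by rewrite set_false.
  have [q0|q0] := leP 0 (ratr q : R); last by rewrite set_false.
  have [qT|qT] := leP (ratr q) T; last by rewrite set_false.
  have [pq|pq] := ltP `|ratr p - ratr q| (k.+1%:R^-1 : R); last by rewrite set_false.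
  rewrite /=; apply: measurable_lt_set => //.
  by apply: measurableT_comp => //; apply: measurable_funB; exact: mX.
have decr : nonincreasing_seq F.
  move=> k l kl; apply/subsetPset => w [p _ [q _ /and5P[a1 a2 a3 a4 /andP[a5 a6]]]].
  exists p => //; exists q => //; rewrite /A/= a1 a2 a3 a4 a6 andbT /=; apply: (lt_le_trans a5).
  by rewrite lef_pV2 ?posrE ?ltr0n// ler_nat.
have mI : measurable (\bigcap_k F k) by exact: bigcapT_measurable.
have I0 : P (\bigcap_k F k) = 0%E.
  have [N [mN PN AN]] := cX; apply: (subset_measure0 mI mN _ PN).
  move=> w Fw; apply: AN => /= cw; have [r r0 H] := heine T cw e0.
  have [k kr] : exists k : nat, (k.+1%:R^-1 : R) < r.
    by have [k] := ltr_add_invr r0; rewrite add0r; exists k.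
  have [p _ [q _ /and5P[a1 a2 a3 a4 /andP[a5 a6]]]] := Fw k I.
  have := H (ratr p) (ratr q); rewrite a1 a2 a3 (lt_trans a5 kr) => /(_ isT isT isT).
  by rewrite leNgt a6.
have Pfin : (P (F 0%N) < +oo)%E.
  by apply: (le_lt_trans (probability_le1 P (mF 0%N))); rewrite ltry.
have cv : P \o F @ \oo --> 0%E by rewrite -I0; exact: nonincreasing_cvg_mu.
have nb : nbhs (0 : \bar R)%E [set y | (y < a%:E)%E].
  by apply: open_nbhs_nbhs; split; [exact: open_ereal_lt_ereal|rewrite /= lte_fin].
have [k _ /(_ k (leqnn k)) /= Pk] := cv _ nb.
exists k.+1%:R^-1; first by rewrite invr_gt0 ltr0n.
have H1 : outer_le P a (F k) by exists (F k); split => //; exact: ltW.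
have H2 := outer_le_ae cX.
apply: (outer_le_sub _ _ (outer_leU H1 H2)); last by rewrite addr0.
move=> w [s [t [sT tT st est]]].
have [cw|] := pselect {within `[0, +oo[, continuous (fun t => X t w)}; last by right.
(* The strict inequalities leave room in space and in time to replace s and t by nearby
   rationals. *)
left; pose z := (`|X s w - X t w| - e) / 2.
have z0 : 0 < z by rewrite divr_gt0// subr_gt0.
have [r1 r10 H] := heine T cw (divr_gt0 z0 (ltr0n R 2 : 0 < 2%:R)).
have y0 : 0 < (k.+1%:R^-1 - `|s - t|) / 2 by rewrite divr_gt0// subr_gt0.
have m0 : 0 < Num.min r1 ((k.+1%:R^-1 - `|s - t|) / 2) by rewrite lt_min r10.
have [p pT] := rat_near T0 sT m0; rewrite lt_min => /andP[p1 p2].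
have [q qT] := rat_near T0 tT m0; rewrite lt_min => /andP[q1 q2].
have /andP[p0 p0T] := pT; have /andP[q0 q0T] := qT.
have hp := H s _ sT p0 p1; have hq := H t _ tT q0 q1.
exists p => //; exists q => //; rewrite /A/= p0 p0T q0 q0T /=; apply/andP; split.
  have := ler_normD (ratr p - s) (s - t + (t - ratr q)); have := ler_normD (s - t) (t - ratr q).
  rewrite (_ : ratr p - s + _ = ratr p - ratr q); last by ring.
  move: p2 q2; rewrite (distrC _ s); clear; move: (k.+1%:R^-1) => K; lra.
have := ler_normD (X s w - X (ratr p) w) (X (ratr p) w - X (ratr q) w + (X (ratr q) w - X t w)).
have := ler_normD (X (ratr p) w - X (ratr q) w) (X (ratr q) w - X t w).
rewrite (_ : X s w - _ + _ = X s w - X t w); last by ring.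
rewrite (distrC _ (X t w)) /z in hp hq *; lra.
Qed.

End Modulus.

(** * The solution satisfies the Euler recursion approximately *)

Section ItoRiemann.
Context d (Omega : measurableType d) (R : realType) (P : probability Omega R).
Variables (Ft : R -> set (set Omega)) (B : R -> Omega -> R).
Hypotheses (hFt : is_filtration Ft) (hB : is_wiener P Ft B).
Variables (G g Ge ge : R -> R) (L x0 : R) (X : R -> Omega -> R).
Hypothesis hX : is_sde_solution P Ft B G g x0 X.
Hypotheses (L1 : 1 <= L) (lipG : forall x y, `|Ge x - Ge y| <= L * `|x - y|)
  (lipg : forall x y, `|ge x - ge y| <= L * `|x - y|).
Hypotheses (GE : forall x : R, 0 <= x -> Ge x = G x) (gE : forall x : R, 0 <= x -> ge x = g x).

(** Error committed when both integrals in the equation are replaced by left-point sums on the grid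
    of step h. *)
Definition euler_defect (h : R) (n : nat) (w : Omega) : R :=
  X (n%:R * h) w - x0 - \sum_(i < n) (Ge (X (i%:R * h) w) * h
    + ge (X (i%:R * h) w) * increment B (i%:R * h) (i.+1%:R * h) w).

Lemma sde_fm t : 0 <= t -> fm Ft t (X t).
Proof. by move=> t0; apply: (fmP hFt t0); exact: (sde_adapted hX). Qed.

Lemma sde_measurable t : 0 <= t -> measurable_fun setT (X t).
Proof. by move=> t0; exact: (fm_measurable hFt t0 (sde_fm t0)). Qed.

(** The Ito integral is close in probability to that of a simple process S k. The difference between
    the latter and the left-point sum is a discrete stochastic integral on the refined grid; its
    bracket is small because S k is close to g(X) in mean square over time and g(X) oscillates
    little over one step. [lenglart] makes this uniform over the grid; the drift follows from
    uniform continuity. *)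
Lemma ito_riemann (T e a : R) : 0 < T -> 0 < e -> 0 < a ->
  exists2 r : R, 0 < r & forall (h : R) n, 0 < h < r -> n%:R * h <= T ->
    outer_le P a [set w | exists2 j, (j < n.+1)%N & e < `|euler_defect h j w| ].
Proof.
move=> T0 e0 a0; have [I [[mH cI [S HS]] sde]] := sde_eq hX.
have L0 : 0 < L by exact: lt_le_trans L1.
(* The exceptional probabilities add up to 5 b, the three errors (drift, simple process, left-point
   sum) are at most [lam] each, and [eta] is such that eta / lam^2 = b. *)
pose b := a / 6; have b0 : 0 < b by rewrite divr_gt0.
pose lam := e / 3; have lam0 : 0 < lam by rewrite divr_gt0.
pose eta := b * lam ^+ 2; have eta0 : 0 < eta by rewrite mulr_gt0// exprn_gt0.
have [kap kap0 [kap1 kap2]] : exists2 kap : R, 0 < kap & kap * T <= lam /\ 2 * kap ^+ 2 * T <= eta / 2.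
  pose m := Num.min 1 (Num.min (lam / T) (eta / (4 * T))).
  have T4 : 0 < 4 * T by rewrite mulr_gt0.
  exists m; first by rewrite !lt_min ltr01 !divr_gt0.
  have m0 : 0 <= m by rewrite !le_min ler01 !ltW ?divr_gt0.
  have : m <= m by []; rewrite {2}/m !le_min => /and3P[m1 m2 m3].
  rewrite ler_pdivlMr// in m2; rewrite ler_pdivlMr// in m3; split => //.
  have : m ^+ 2 * T <= m * T by rewrite ler_pM2r// expr2 ler_piMr.
  lra.
have [r r0 W] := modulus sde_measurable (sde_continuous hX) T0 (divr_gt0 kap0 L0) b0.
exists r => // h n /andP[h0 hr] nT.
have h0' := ltW h0.
pose gam (i : nat) (w : Omega) := ge (X (i%:R * h) w).
have ih0 (i : nat) : 0 <= i%:R * h by exact: mulr_ge0.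
have mgam i : fm Ft (i%:R * h) (gam i).
  by apply: fm_comp; [exact: lipschitz_measurable lipg|exact: sde_fm].
have jT j : (j < n.+1)%N -> j%:R * h <= T.
  by rewrite ltnS => jn; apply: le_trans nT; rewrite ler_wpM2r// ler_nat.
have b'0 : 0 < b / n.+1%:R by rewrite divr_gt0// ltr0n.
(* The index k may depend on h and n: each of the n.+1 grid times is allowed the probability b /
   n.+1. *)
have [k [Hk Ik]] : exists k,
    outer_le P b [set w | ((eta / 4)%:E < \int[lebesgue_measure]_(s in `[0%R, T])
          ((sp_val (S k) s w - g (X s w)) ^+ 2)%:E)%E] /\
    forall j : 'I_n.+1, outer_le P (b / n.+1%:R)
      [set w | (lam%:E < `|sp_integral B (S k) (j%:R * h) w - I (j%:R * h) w|%:E)%E].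
  have c1 := cvg0_outer_le (HS T (ltW T0)).1 (divr_gt0 eta0 (ltr0n R 4 : 0 < 4%:R)) b0.
  have c2 (j : 'I_n.+1) := cvg0_outer_le (HS (j%:R * h) (ih0 j)).2 lam0 b'0.
  near \oo => k; exists k; split; first by near: k; exact: c1.
  by near: k; exact: (filter_forall _ c2).
have mI := @outer_le_big _ _ _ P _ n.+1 (fun j => [set w | lam < `|sp_integral B (S k) (j%:R * h) w - I (j%:R * h) w| ])
  (fun j jn => Ik (Ordinal jn)).
rewrite mulrC divfK ?pnatr_eq0// in mI.
pose good w := [/\ forall t : R, 0 <= t -> measurable_fun (`[0, t] : set R) (fun s => g (X s w)),
  {within `[0, +oo[, continuous (fun t => X t w)} & forall t : R, 0 <= t ->
    X t w = x0 + \int[lebesgue_measure]_(s in `[0, t]) G (X s w) + I t w].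
have N : outer_le P 0 [set w | ~ good w].
  have := outer_leU (outer_le_ae mH) (outer_leU (outer_le_ae (sde_continuous hX)) (outer_le_ae sde)).
  apply: outer_le_sub; last by rewrite !addr0.
  move=> w ng; apply: contrapT => H; apply: ng; split.
  - by apply: contrapT => H'; apply: H; left.
  - by apply: contrapT => H'; apply: H; right; left.
  - by apply: contrapT => H'; apply: H; right; right.
pose V := ref_time (S k) h; pose D := ref_coef (S k) h gam.
pose m := (n * (sp_size (S k)).+2)%N.
have osc w i t : ~ (exists s t, [/\ 0 <= s <= T, 0 <= t <= T, `|s - t| < r & kap / L < `|X s w - X t w| ]) ->
    (i < n)%N -> i%:R * h <= t <= i.+1%:R * h -> `|X t w - X (i%:R * h) w| <= kap / L.
  move=> nW i_n /andP[it ti]; rewrite leNgt; apply/negP => lt; apply: nW.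
  exists t, (i%:R * h); split => //.
  - by rewrite (le_trans (ih0 i) it) (le_trans ti)// jT.
  - by rewrite ih0 jT// ltnS ltnW.
  - by rewrite ger0_norm ?subr_ge0//; apply: le_lt_trans hr; rewrite lerBlDl -succ_time.
have LK (f : R -> R) x y : (forall x y, `|f x - f y| <= L * `|x - y|) ->
    `|x - y| <= kap / L -> `|f x - f y| <= kap.
  by move=> lf xy; apply: (le_trans (lf x y)); rewrite mulrC -ler_pdivlMr.
have Q : outer_le P (0 + (b + b)) [set w | eta < qsum V D m w].
  apply: (outer_le_sub _ _ (outer_leU N (outer_leU W Hk))) => // w Qw.
  have [[mg _ _]|ng] := pselect (good w); last by left.
  right; apply: contrapT => H.
  have nW : ~ (exists s t, [/\ 0 <= s <= T, 0 <= t <= T, `|s - t| < r & kap / L < `|X s w - X t w| ]).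
    by move=> H'; apply: H; left.
  have I1 : (\int[lebesgue_measure]_(s in `[0%R, T]) ((sp_val (S k) s w - g (X s w)) ^+ 2)%:E <= (eta / 4)%:E)%E.
    by rewrite leNgt; apply/negP => H'; apply: H; right.
  have bnd i t : (i < n)%N -> i%:R * h <= t <= i.+1%:R * h -> `|g (X t w) - gam i w| <= kap.
    move=> i_n ti; have /andP[it _] := ti.
    have t0 : 0 <= t by exact: le_trans it.
    rewrite -gE ?(sde_ge0 hX)//; apply: LK => //; exact: osc.
  have := @ref_qsum _ Omega R Ft (S k) h gam h0' (fun s => g (X s w)) T kap n w nT (mg T (ltW T0)) bnd.
  apply/negP; rewrite -ltNge; apply: (@le_lt_trans _ _ (2%:E * (eta / 4)%:E + (eta / 2)%:E)%E).
    by apply: leeD; [exact: lee_wpmul2l|rewrite lee_fin].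
  by rewrite -EFinM -EFinD lte_fin; apply: le_lt_trans Qw; lra.
have V0 : 0 <= V 0%N by rewrite /V ref_time0.
have Vle : forall l, V l <= V l.+1 by move=> l; exact: ref_time_le.
have mD : forall l, fm Ft (V l) (D l) by move=> l; exact: ref_coef_fm.
have M := lenglart hFt hB V0 Vle mD lam0 (ltW eta0) Q.
have etaE : eta / lam ^+ 2 = b by rewrite /eta mulfK// expf_neq0// gt_eqF.
rewrite etaE in M.
have A := outer_leU N (outer_leU W (outer_leU mI M)).
apply: (outer_le_sub _ _ A); last by rewrite /b; lra.
move=> w [j jn ej].
have [gw|ng] := pselect (good w); last by left.
right; apply: contrapT => H; have [_ cX eqX] := gw.
have nW : ~ (exists s t, [/\ 0 <= s <= T, 0 <= t <= T, `|s - t| < r & kap / L < `|X s w - X t w| ]).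
  by move=> H'; apply: H; left.
have J1 : `|sp_integral B (S k) (j%:R * h) w - I (j%:R * h) w| <= lam.
  by rewrite leNgt; apply/negP => H'; apply: H; right; left; exists j.
have J2 : `|wsum B V D (j * (sp_size (S k)).+2) w| <= lam.
  have le : (j * (sp_size (S k)).+2 <= m)%N by rewrite leq_mul2r -ltnS jn orbT.
  apply: (le_trans (le_wmax B V D w le)).
  by rewrite leNgt; apply/negP => H'; apply: H; right; right; exact: ltW.
have cGX : {within `[0, +oo[, continuous (fun t => Ge (X t w))}.
  move=> t; apply: (@continuous_comp _ _ _ (fun t : subspace (`[0, +oo[ : set R) => X t w) Ge); first exact: cX.
  exact: (lipschitz_continuous lipG).
have J3 : `|\int[lebesgue_measure]_(s in `[0, j%:R * h]) G (X s w) - \sum_(i < j) Ge (X (i%:R * h) w) * h| <= lam.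
  have -> : \int[lebesgue_measure]_(s in `[0, j%:R * h]) G (X s w) =
            \int[lebesgue_measure]_(s in `[0, j%:R * h]) Ge (X s w).
    by apply: eq_Rintegral => s /set_mem; rewrite /= in_itv/= => /andP[s0 _]; rewrite GE// (sde_ge0 hX).
  apply: (@le_trans _ _ (kap * (j%:R * h))).
    apply: (drift_sum (c := fun i => Ge (X (i%:R * h) w)) h0' cGX) => i t ij ti.
    by apply: LK => //; apply: osc => //; exact: leq_trans ij _.
  apply: le_trans kap1; apply: ler_wpM2l; [exact: ltW|exact: jT].
rewrite ref_wsum// in J2.
have J4 := ler_normD (\int[lebesgue_measure]_(s in `[0, j%:R * h]) G (X s w)
    - \sum_(i < j) Ge (X (i%:R * h) w) * h
    - (sp_integral B (S k) (j%:R * h) w - I (j%:R * h) w))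
  (sp_integral B (S k) (j%:R * h) w - \sum_(i < j) gam i w * increment B (i%:R * h) (i.+1%:R * h) w).
have J5 := ler_normB (\int[lebesgue_measure]_(s in `[0, j%:R * h]) G (X s w)
    - \sum_(i < j) Ge (X (i%:R * h) w) * h)
    (sp_integral B (S k) (j%:R * h) w - I (j%:R * h) w).
have E : euler_defect h j w = \int[lebesgue_measure]_(s in `[0, j%:R * h]) G (X s w)
    - \sum_(i < j) Ge (X (i%:R * h) w) * h
    - (sp_integral B (S k) (j%:R * h) w - I (j%:R * h) w) +
    (sp_integral B (S k) (j%:R * h) w - \sum_(i < j) gam i w * increment B (i%:R * h) (i.+1%:R * h) w).
  rewrite /euler_defect (eqX _ (ih0 j)) big_split/= /gam.
  move: (\int[_]_(_ in _) _) (\sum_(i < j) _) (\sum_(i < j) _) (sp_integral _ _ _ _) (I _ _) => q1 q2 q3 q4 q5.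
  by ring.
move: ej; rewrite E ltNge => /negP; apply.
rewrite (le_trans J4)// (le_trans (lerD J5 (lexx _)))// (le_trans (lerD (lerD J3 J1) J2))//.
by rewrite /lam -!mulrDl; lra.
Unshelve. all: by end_near. Qed.

End ItoRiemann.

(** * Fatou's lemma along convergence in probability *)

Section FatouInProbability.
Context d (Omega : measurableType d) (R : realType) (P : probability Omega R).

(** |Z| is truncated at level m. Off a set of probability a, Z is within e of some Y and convexity
    applies; on that set the truncated power is at most m^(2q+2), which a small a makes negligible.
    Monotone convergence removes the truncation. *)
Lemma fatou_in_probability (Z : Omega -> R) (K : R) q : measurable_fun setT Z -> 0 <= K ->
  (forall e a : R, 0 < e -> 0 < a -> exists Y : Omega -> R, [/\ measurable_fun setT Y,
     outer_le P a [set w | e < `|Z w - Y w| ] & (\int[P]_w (Y w ^+ q.*2.+2)%:E <= K%:E)%E]) ->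
  (\int[P]_w (Z w ^+ q.*2.+2)%:E <= (2 ^+ q.*2.+1 * K)%:E)%E.
Proof.
move=> mZ K0 H.
have ev0 (x : R) : 0 <= x ^+ q.*2.+2 by rewrite -doubleS expr_dbl_ge0.
pose V (m : nat) (w : Omega) : R := Num.min `|Z w| m%:R ^+ q.*2.+2.
have mV m : measurable_fun setT (V m).
  apply: measurable_funX; apply: measurable_minr => //.
  exact: measurableT_comp mZ.
have V0 m w : 0 <= V m w by exact: ev0.
have step m : (\int[P]_w (V m w)%:E <= (2 ^+ q.*2.+1 * K)%:E)%E.
  apply/lee_addgt0Pr => del del0; rewrite -EFinD.
  (* The closeness e and the probability a each account for at most del / 2. *)
  pose e : R := Num.min 1 (del / (2 * 2 ^+ q.*2.+1)).
  have F0 : (0 : R) < 2 ^+ q.*2.+1 by rewrite exprn_gt0.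
  have e0 : 0 < e by rewrite lt_min ltr01 divr_gt0// mulr_gt0.
  pose k : R := m%:R ^+ q.*2.+2 + 1.
  have k0 : 0 < k by rewrite ltr_wpDl.
  pose a : R := del / (2 * k).
  have a0 : 0 < a by rewrite divr_gt0// mulr_gt0.
  have [Y [mY [A' [mA AA' PA]] EY]] := H e a e0 a0.
  have b1 : 2 ^+ q.*2.+1 * e ^+ q.*2.+2 <= del / 2.
    have e1 : e <= 1 by rewrite ge_min lexx.
    have : e ^+ q.*2.+2 <= e by rewrite exprS; apply: ler_piMr; [exact: ltW|apply: exprn_ile1 => //; exact: ltW].
    have : e <= del / (2 * 2 ^+ q.*2.+1) by rewrite ge_min lexx orbT.
    move=> h1 h2; have := le_trans h2 h1; rewrite ler_pdivlMr ?mulr_gt0//.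
    by move: (e ^+ _) (2 ^+ _ : R) => u v; lra.
  have b2 : k * a = del / 2 by rewrite /a; field; rewrite gt_eqF.
  have mYq : measurable_fun setT (fun w => Y w ^+ q.*2.+2) by exact: measurable_funX.
  have mI : measurable_fun setT (fun w => \1_A' w : R) by exact: measurable_indic.
  apply: (@int_le _ _ _ P _ (fun w => 2 ^+ q.*2.+1 * Y w ^+ q.*2.+2 + (2 ^+ q.*2.+1 * e ^+ q.*2.+2 + k * \1_A' w))) => //.
  - apply: measurable_funD; first exact: measurable_funM.
    by apply: measurable_funD => //; exact: measurable_funM.
  - move=> w; have I0 : (0 : R) <= \1_A' w by rewrite indicE.
    have [wA|wA] := pselect (A' w).
      rewrite indicE mem_set// mulr1.
      have : V m w <= m%:R ^+ q.*2.+2.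
        by rewrite /V lerXn2r ?nnegrE ?le_min ?normr_ge0 ?ler0n// ge_min lexx orbT.
      have : 0 <= 2 ^+ q.*2.+1 * Y w ^+ q.*2.+2 by rewrite mulr_ge0// ltW.
      have : 0 <= 2 ^+ q.*2.+1 * e ^+ q.*2.+2 by rewrite mulr_ge0// ltW.
      by rewrite /k; lra.
    rewrite indicE memNset// mulr0 addr0 -mulrDr.
    have ZY : `|Z w - Y w| <= e.
      by rewrite leNgt; apply/negP => lt; apply: wA; exact: AA'.
    apply: (@le_trans _ _ (Z w ^+ q.*2.+2)).
      have -> : Z w ^+ q.*2.+2 = `|Z w| ^+ q.*2.+2 by rewrite -doubleS expr_dbl_norm.
      by rewrite /V lerXn2r ?nnegrE ?le_min ?normr_ge0 ?ler0n// ge_min lexx.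
    have -> : Z w = Y w + (Z w - Y w) by rewrite addrC subrK.
    apply: (le_trans (powD_even_convex _ _ _)).
    rewrite ler_pM2l// lerD2l.
    have -> : (Z w - Y w) ^+ q.*2.+2 = `|Z w - Y w| ^+ q.*2.+2 by rewrite -doubleS expr_dbl_norm.
    by rewrite lerXn2r ?nnegrE ?normr_ge0 ?(ltW e0).
  - apply: int_add => //.
    + exact: measurable_funM.
    + by apply: measurable_funD => //; exact: measurable_funM.
    + by move=> w; rewrite mulr_ge0// ltW.
    + by move=> w; rewrite addr_ge0// mulr_ge0 ?indicE// ltW.
    + by apply: int_scale => //; exact: ltW.
    + have -> : del = 2 ^+ q.*2.+1 * e ^+ q.*2.+2 + (del - 2 ^+ q.*2.+1 * e ^+ q.*2.+2) by rewrite addrC subrK.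
      apply: int_add => //.
      * exact: measurable_funM.
      * by move=> w; rewrite mulr_ge0// ltW.
      * by move=> w; rewrite mulr_ge0 ?indicE// ltW.
      * by rewrite int_cst.
      * apply: (@le_trans _ _ (k * a)%:E); last by rewrite lee_fin b2; lra.
        apply: int_scale => //; first exact: (ltW k0).
        by rewrite integral_indic// setIT.
have nd : forall w, setT w -> nondecreasing_seq (fun m => (V m w)%:E).
  move=> w _ m n mn; rewrite lee_fin /V lerXn2r ?nnegrE ?le_min ?normr_ge0 ?ler0n//.
  by rewrite ge_min lexx /= ge_min ler_nat mn orbT.
have cv := @cvg_monotone_convergence _ _ _ P setT measurableT (fun m w => (V m w)%:E)
  (fun m => (measurable_EFinP _ _).2 (mV m)) (fun m w _ => V0 m w) nd.
have -> : (\int[P]_w (Z w ^+ q.*2.+2)%:E = \int[P]_w limn (fun m => (V m w)%:E))%E.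
  apply: eq_integral => w _; apply/esym/cvg_lim => //.
  apply: cvg_near_cst; near=> m.
  have -> : V m w = `|Z w| ^+ q.*2.+2.
    by rewrite /V min_l//; near: m; exact: nbhs_infty_ger.
  by rewrite -doubleS expr_dbl_norm.
rewrite -(cvg_lim _ cv)//; apply: lime_le; first by apply/cvg_ex; eexists; exact: cv.
by near=> m; exact: step.
Unshelve. all: by end_near. Qed.

End FatouInProbability.

(** * Convergence in probability of the Milstein scheme *)

Section StrongRate.
Context d (Omega : measurableType d) (R : realType) (P : probability Omega R).
Variables (Ft : R -> set (set Omega)) (B : R -> Omega -> R).
Hypotheses (hFt : is_filtration Ft) (hB : is_wiener P Ft B).
Variables (G g Ge G1 ge g1 : R -> R) (L x0 : R) (X : R -> Omega -> R).
Hypothesis hX : is_sde_solution P Ft B G g x0 X.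
Hypotheses (cG : smooth_coef L Ge G1) (cg : smooth_coef L ge g1).
Hypotheses (GE : forall x : R, 0 <= x -> Ge x = G x) (gE : forall x : R, 0 <= x -> ge x = g x).
Hypothesis x00 : 0 <= x0.

Local Notation mil := (mil Ge ge g1 B x0).
Local Notation esch := (esch Ge ge g1 B x0).
Local Notation cc := (milc ge g1).
Local Notation Xi := (euler_defect B Ge ge x0 X).

Let L1 : 1 <= L. Proof. exact: sc_ge1 cG. Qed.
Let L0 : 0 <= L. Proof. exact: sc_ge0 cG. Qed.

Let XF := sde_fm hFt hX.
Let Xm := sde_measurable hFt hX.

Lemma euler_defect_fm h n : 0 <= h -> fm Ft (n%:R * h) (Xi h n).
Proof.
move=> h0; have nh (m : nat) : 0 <= m%:R * h by exact: mulr_ge0.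
have step m : m%:R * h <= m.+1%:R * h by rewrite succ_time lerDl.
have S m : fm Ft (m%:R * h) (fun w => \sum_(i < m) (Ge (X (i%:R * h) w) * h
    + ge (X (i%:R * h) w) * increment B (i%:R * h) (i.+1%:R * h) w)).
  elim: m => [|m IH]; first by under eq_fun do rewrite big_ord0; exact: fm_cst.
  under eq_fun do rewrite big_ord_recr/=.
  have X' := fm_mono hFt (nh m) (step m) (XF (nh m)).
  have B' := fm_increment hFt hB (nh m) (step m).
  have S' := fm_mono hFt (nh m) (step m) IH.
  by apply: fmD => //; fmt.
by apply: fmB => //; apply: fmB; [exact: XF|exact: fm_cst].
Qed.

Fixpoint defect_max (h : R) (n : nat) (w : Omega) : R :=
  if n is m.+1 then Num.max (defect_max h m w) `|Xi h n w| else `|Xi h 0 w|.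

Lemma defect_max_fm h n : 0 <= h -> fm Ft (n%:R * h) (defect_max h n).
Proof.
move=> h0; have mabs m : fm Ft (m%:R * h) (fun w => `|Xi h m w|).
  by apply: (fm_comp (k := Num.norm)); [exact: normr_measurable|exact: euler_defect_fm].
elim: n => [|n IH] /=; first exact: mabs.
have nn : n%:R * h <= n.+1%:R * h by rewrite succ_time lerDl.
have n0 : 0 <= n%:R * h by exact: mulr_ge0.
have IH1 := fm_mono hFt n0 nn IH; apply: measurable_maxr; [exact: IH1|exact: mabs].
Qed.

Lemma defect_max_gt h n w (e : R) : e < defect_max h n w -> exists2 j, (j < n.+1)%N & e < `|Xi h j w|.
Proof.
elim: n => [|n IH] /=; first by exists 0%N.
rewrite lt_max => /orP[/IH[j jn ej]|]; last by exists n.+1.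
by exists j => //; exact: leqW.
Qed.

(* The Milstein recursion minus the solution, with the Euler defect added back
   and stopped as soon as the defect exceeds [e]. *)
Fixpoint stopped_error (e h : R) (n : nat) (w : Omega) : R :=
  if n is m.+1 then
    stopped_error e h m w + (if defect_max h m w <= e then
      (Ge (mil h m w) - Ge (X (m%:R * h) w)) * h
      + (ge (mil h m w) - ge (X (m%:R * h) w)) * increment B (m%:R * h) (m%:R * h + h) w
      + cc (mil h m w) * (increment B (m%:R * h) (m%:R * h + h) w ^+ 2 - h) else 0)
  else 0.

Lemma stopped_errorE e h n w : defect_max h n w <= e ->
  stopped_error e h n w = mil h n w - X (n%:R * h) w + Xi h n w.
Proof.
elim: n => [|n IH] /=.
  by move=> _; rewrite /euler_defect big_ord0 subr0 addrA subrK subrr.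
rewrite ge_max => /andP[al _]; rewrite al IH//.
rewrite /euler_defect big_ord_recr/= /mstep /increment succ_time.
move: (\sum_(i < n) _) => Sg; by ring.
Qed.

Lemma stopped_error_fm e h n : 0 <= h -> fm Ft (n%:R * h) (stopped_error e h n).
Proof.
move=> h0; elim: n => [|n IH] /=; first exact: fm_cst.
have nn : n%:R * h <= n.+1%:R * h by rewrite succ_time lerDl.
have n0 : 0 <= n%:R * h by exact: mulr_ge0.
have IH1 := fm_mono hFt n0 nn IH.
have X1 := fm_mono hFt n0 nn (XF n0).
have M0 : fm Ft (n%:R * h) (mil h n) by exact: (mil_fm hFt hB x0 cG cg).
have M1 := fm_mono hFt n0 nn M0.
have B1 : fm Ft (n.+1%:R * h) (increment B (n%:R * h) (n%:R * h + h)).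
  by rewrite succ_time; apply: (fm_increment hFt hB) => //; rewrite lerDl.
have D0 : fm Ft (n%:R * h) (defect_max h n) by exact: defect_max_fm.
have D1 := fm_mono hFt n0 nn D0.
apply: fmD => //; apply: measurable_fun_ifT; last exact: fm_cst.
  by apply: measurable_fun_ler; [exact: D1|exact: fm_cst].
rewrite -/(fm _ _ _); fmt.
Qed.

(** Until the Euler defect exceeds e1, the stopped error has Lipschitz drift and diffusion
    coefficients in mil - X, which is that error minus the defect. Gronwall bounds its second moment
    by a multiple of e1^2 plus h, and Markov concludes. No rate is sought here. *)
Lemma mil_sde_probability (T e a : R) : 0 < T -> 0 < e -> 0 < a ->
  exists2 r : R, 0 < r & forall (h : R) n, 0 < h < r -> n%:R * h <= T ->
    outer_le P a [set w | e < `|mil h n w - X (n%:R * h) w| ].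
Proof.
move=> T0 e0 a0.
have [C C0 H] := wiener_step0 hFt hB 0.
have [KM KM0 HM] := mil_moment hFt hB x0 cG cg 0 T.
pose K := 4 * L ^+ 2; have K0 : 0 <= K by rewrite /K; ge0.
pose E := expR (C * (1 + K) * T); have E0 : 0 < E by exact: expR_gt0.
pose e2 := e / 2; have e20 : 0 < e2 by rewrite divr_gt0.
have kap0 : 0 < a * e2 ^+ 2 / 4 by rewrite divr_gt0// mulr_gt0// exprn_gt0.
(* The level y makes the Gronwall bound y E at most a e2^2 / 4; then [e1] and [r2] are chosen so
   that each of the two parts of the source [gg] has mean at most y / 2. *)
have [y y0 yE] : exists2 y : R, 0 < y & y * E <= a * e2 ^+ 2 / 4.
  by exists (a * e2 ^+ 2 / 4 / E); [exact: divr_gt0|rewrite divfK// gt_eqF].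
have [e1 [e10 e1e] e1y] : exists2 e1 : R, 0 < e1 /\ e1 <= e2 & 4 * L ^+ 2 * e1 ^+ 2 <= y / 2.
  pose c := 8 * L ^+ 2 * e2 + 1.
  have c0 : 0 < c by rewrite /c ltr_wpDl//; ge0; exact: ltW.
  exists (Num.min e2 (y / c)); first by rewrite lt_min e20 divr_gt0// ge_min lexx.
  set m := Num.min _ _.
  have m0 : 0 <= m by rewrite le_min !ltW// divr_gt0.
  have m1 : m <= e2 by rewrite ge_min lexx.
  have m2 : m * c <= y by rewrite -ler_pdivlMr// ge_min lexx orbT.
  have m3 : m * (8 * L ^+ 2 * m) <= m * (8 * L ^+ 2 * e2).
    by apply: ler_wpM2l => //; apply: ler_wpM2l => //; ge0.
  move: m2 m3; rewrite /c mulrDr expr2; move: (L ^+ 2) => l; lra.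
have a4 : 0 < a / 2 by rewrite divr_gt0.
have [r1 r10 HX] := ito_riemann hFt hB hX L1 (sc_lip cG) (sc_lip cg) GE gE T0 e10 a4.
have [r2 r20 r2y] : exists2 r : R, 0 < r & r * (L ^+ 4 * KM) <= y / 2.
  have c0 : 0 < L ^+ 4 * KM + 1 by rewrite ltr_wpDl//; ge0.
  exists (y / 2 / (L ^+ 4 * KM + 1)); first by rewrite !divr_gt0.
  rewrite mulrAC ler_pdivrMr// ler_wpM2l ?divr_ge0 ?(ltW y0)// lerDl//.
exists (Num.min 1 (Num.min r1 r2)); first by rewrite !lt_min ltr01 r10.
move=> h n /andP[h0]; rewrite !lt_min => /and3P[h1 hr1 hr2] nT.
have h0' := ltW h0.
have Q : outer_le P (a / 2) [set w | e1 < defect_max h n w].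
  apply: (outer_le_sub _ (lexx _) (HX h n _ nT)); last by rewrite h0.
  by move=> w /= /defect_max_gt.
have nh (m : nat) : 0 <= m%:R * h by exact: mulr_ge0.
have mT m : (m <= n)%N -> m%:R * h <= T.
  by move=> mn; apply: le_trans nT; rewrite ler_wpM2r// ler_nat.
have mil_f m : fm Ft (m%:R * h) (mil h m) by exact: (mil_fm hFt hB x0 cG cg).
have rec : forall m, (m <= n)%N -> (\int[P]_w (stopped_error e1 h m w ^+ 2)%:E
    <= ((0 + y) * expR (C * (1 + K) * (m%:R * h)))%:E)%E.
  apply: (@le_erec _ (fun m => \int[P]_w (stopped_error e1 h m w ^+ 2)%:E)%E) => //.
  - by ge0.
  - exact: ltW.
  - by rewrite /= expr0n /= int_cst.
  move=> m x mn x_ge0 mx.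
  have mM := mil_f m; have mXm := XF (nh m).
  have mD : fm Ft (m%:R * h) (defect_max h m) by exact: defect_max_fm.
  pose on (f : Omega -> R) w := if defect_max h m w <= e1 then f w else 0.
  have on_fm f : fm Ft (m%:R * h) f -> fm Ft (m%:R * h) (on f).
    move=> mf; apply: measurable_fun_ifT; [|exact: mf|exact: fm_cst].
    by apply: measurable_fun_ler; [exact: mD|exact: fm_cst].
  pose aa := on (fun w => Ge (mil h m w) - Ge (X (m%:R * h) w)).
  pose bb := on (fun w => ge (mil h m w) - ge (X (m%:R * h) w)).
  pose cx := on (fun w => cc (mil h m w)).
  have maa : fm Ft (m%:R * h) aa by apply: on_fm; fmt.
  have mbb : fm Ft (m%:R * h) bb by apply: on_fm; fmt.
  have mcx : fm Ft (m%:R * h) cx by apply: on_fm; fmt.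
  (* The first part comes from the Euler defect. The second is the whole Milstein correction, which
     has no counterpart in the Euler recursion and is bounded through a moment of the scheme. *)
  pose gg w := 4 * L ^+ 2 * e1 ^+ 2 + h * L ^+ 4 * mil h m w ^+ 2.
  have mmil := fm_measurable hFt (nh m) mM.
  have mgg2 : measurable_fun setT (fun w => mil h m w ^+ 2) by exact: measurable_funX.
  have mgg : measurable_fun setT gg by apply: measurable_funD => //; exact: measurable_funM.
  have hh : 0 < h <= 1 by rewrite h0 ltW.
  have gg0 w : 0 <= gg w by rewrite /gg; ge0.
  have L4 : L ^+ 4 = L ^+ 2 * L ^+ 2 by rewrite -exprD.
  have dom w : aa w ^+ 2 + bb w ^+ 2 + h ^+ 1 * cx w ^+ 2 <= K * stopped_error e1 h m w ^+ 2 + gg w.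
    have rhs0 : 0 <= K * stopped_error e1 h m w ^+ 2 + gg w by rewrite addr_ge0// mulr_ge0// sqr_ge0.
    rewrite /aa /bb /cx /on; case: ifPn => [al|_]; last by rewrite expr0n/= mulr0 !addr0.
    have Xi1 : `|Xi h m w| <= e1.
      apply: le_trans al; case: (m) => [|k] /=; first exact: lexx.
      by rewrite le_max lexx orbT.
    have diff : mil h m w - X (m%:R * h) w = stopped_error e1 h m w - Xi h m w.
      by rewrite (stopped_errorE al) addrK.
    have d2 : (mil h m w - X (m%:R * h) w) ^+ 2 <= 2 * stopped_error e1 h m w ^+ 2 + 2 * e1 ^+ 2.
      have Xi2 : Xi h m w ^+ 2 <= e1 ^+ 2.
        by rewrite -(real_normK (num_real (Xi _ _ _))) lerXn2r ?nnegrE// ltW.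
      rewrite diff; move: (stopped_error _ _ _ _) (Xi _ _ _) Xi2 => p1 p2 Xi2.
      have := sqr_ge0 (p1 + p2); rewrite sqrrD sqrrB; lra.
    have sq (u v M : R) : 0 <= M -> `|u| <= M * `|v| -> u ^+ 2 <= M ^+ 2 * v ^+ 2.
      by move=> M0; exact: (@pow_dom R u v M 0).
    have a1 := sq _ _ _ L0 (sc_lip cG (mil h m w) (X (m%:R * h) w)).
    have a2 := sq _ _ _ L0 (sc_lip cg (mil h m w) (X (m%:R * h) w)).
    have a3 := sq _ _ _ (sqr_ge0 L) (milc_growth cg (mil h m w)).
    have d3 := ler_wpM2l (sqr_ge0 L) d2.
    have a4' : h * cc (mil h m w) ^+ 2 <= h * (L ^+ 2 * L ^+ 2) * mil h m w ^+ 2.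
      by rewrite -(mulrA h); apply: ler_wpM2l => //; rewrite -(expr2 (L ^+ 2)).
    rewrite expr1 /K /gg L4.
    apply: (le_trans (lerD (lerD a1 a2) a4')).
    have fin (l q1 q3 q4 q5 : R) : l * q3 <= l * (2 * q4 + 2 * q5) ->
      l * q3 + l * q3 + q1 <= 4 * l * q4 + (4 * l * q5 + q1) by lra.
    exact: fin d3.
  have Egg : (\int[P]_w (gg w)%:E <= y%:E)%E.
    have -> : y = 4 * L ^+ 2 * e1 ^+ 2 + (y - 4 * L ^+ 2 * e1 ^+ 2) by rewrite addrC subrK.
    apply: int_add => //.
    - exact: measurable_funM.
    - by move=> w; ge0.
    - by move=> w; ge0.
    - by rewrite int_cst.
    apply: (@le_trans _ _ (h * L ^+ 4 * KM)%:E).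
      apply: int_scale => //; [by move=> w; exact: sqr_ge0|by ge0|].
      by apply: HM; [exact: hh|exact: mT (ltnW mn)].
    rewrite lee_fin -mulrA.
    have : h * (L ^+ 4 * KM) <= r2 * (L ^+ 4 * KM) by apply: ler_wpM2r; [ge0|exact: ltW].
    by move: (h * _) (r2 * _) r2y (4 * L ^+ 2 * e1 ^+ 2) e1y => u1 u2 u3 u4 u5 u6; lra.
  have mse : fm Ft (m%:R * h) (stopped_error e1 h m) by exact: stopped_error_fm.
  have step := H (m%:R * h) h K x y (stopped_error e1 h m) aa bb cx gg (nh m) hh K0
    mse maa mbb mcx mgg gg0 dom mx Egg.
  have Ch : 0 <= C * h by ge0.
  apply: (@le_trans _ _ (x + C * h * ((1 + K) * x + y))%:E); last first.
    rewrite lee_fin lerD2l (mulrAC _ _ h) -(mulrA (C * h)); apply: ler_wpM2l => //.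
    by rewrite mulrDr lerD2l ler_peMl ?(ltW y0)// lerDl.
  apply: le_trans step; rewrite le_eqVlt; apply/orP; left; apply/eqP.
  apply: eq_integral => w _; rewrite /= /aa /bb /cx /on; case: ifP => _ //.
  by congr EFin; rewrite !mul0r !addr0.
have Mk : outer_le P (a / 2) [set w | e2 <= `|stopped_error e1 h n w| ].
  apply: (outer_le_sub (@subset_refl _ _) (_ : y * E / e2 ^+ 2 <= _)).
    rewrite ler_pdivrMr ?exprn_gt0//; lra.
  apply: markov_sq => //; first by apply: (fm_measurable hFt (nh n)); exact: stopped_error_fm.
  apply: (le_trans (rec n (leqnn n))); rewrite lee_fin add0r ler_pM2l// ler_expR.
  by apply: ler_wpM2l => //; ge0.
apply: (outer_le_sub _ _ (outer_leU Q Mk)); last by lra.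
move=> w /= lt; have [dm|dm] := ltP e1 (defect_max h n w); [by left|right].
rewrite (stopped_errorE dm).
have X1 : `|Xi h n w| <= e1.
  apply: le_trans dm; case: (n) => [|k] /=; first exact: lexx.
  by rewrite le_max lexx orbT.
have := ler_normB (mil h n w - X (n%:R * h) w + Xi h n w) (Xi h n w).
rewrite addrK; rewrite /e2 in e1e *; lra.
Qed.

End StrongRate.

(** * Moments of the solution and order one at grid times *)

Section SolutionRate.
Context d (Omega : measurableType d) (R : realType) (P : probability Omega R).
Variables (Ft : R -> set (set Omega)) (B : R -> Omega -> R).
Hypotheses (hFt : is_filtration Ft) (hB : is_wiener P Ft B).
Variables (G g Ge G1 ge g1 : R -> R) (L x0 : R) (X : R -> Omega -> R).
Hypothesis hX : is_sde_solution P Ft B G g x0 X.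
Hypotheses (cG : smooth_coef L Ge G1) (cg : smooth_coef L ge g1).
Hypotheses (GE : forall x : R, 0 <= x -> Ge x = G x) (gE : forall x : R, 0 <= x -> ge x = g x).
Hypothesis x00 : 0 <= x0.

Local Notation mil := (mil Ge ge g1 B x0).
Local Notation esch := (esch Ge ge g1 B x0).

Let Xm := sde_measurable hFt hX.

Lemma exists_dyadic (h r : R) : 0 < h -> 0 < r -> exists k : nat, 0 < h / 2 ^+ k < r.
Proof.
move=> h0 r0; have hr : 0 <= h / r by rewrite divr_ge0// ltW.
exists (Num.bound (h / r)); have p0 (k : nat) : (0 : R) < 2 ^+ k by rewrite exprn_gt0.
rewrite divr_gt0//= ltr_pdivrMr// mulrC -ltr_pdivrMr//.
apply: (lt_trans (archi_boundP hr)); rewrite -natrX ltr_nat; exact: ltn_expl.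
Qed.

Lemma dyadic_time (h : R) n k : (n * 2 ^ k)%N%:R * (h / 2 ^+ k) = n%:R * h.
Proof.
have p0 : (2 : R) ^+ k != 0 by rewrite expf_neq0.
by rewrite natrM natrX; field.
Qed.

Let mil_m h n : 0 < h -> measurable_fun setT (mil h n).
Proof. by move=> h0; exact: (mil_measurable hFt hB x0 cG cg). Qed.

(** Milstein schemes with step h / 2^k pass through the same time, have uniformly bounded moments
    and converge in probability to X, so Fatou transfers the bound. *)
Lemma sde_moment q (T : R) : 0 < T -> exists2 K : R, 0 <= K & forall (h : R) n, 0 < h ->
  n%:R * h <= T -> (\int[P]_w (X (n%:R * h) w ^+ q.*2.+2)%:E <= K%:E)%E.
Proof.
move=> T0; have [K K0 HK] := mil_moment hFt hB x0 cG cg q T.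
exists (2 ^+ q.*2.+1 * K) => [|h n h0 nT]; first by rewrite mulr_ge0// exprn_ge0.
apply: fatou_in_probability => //; first by apply: Xm; rewrite mulr_ge0// ltW.
move=> e a e0 a0.
have [r r0 H] := mil_sde_probability hFt hB hX cG cg GE gE T0 e0 a0.
have m0 : 0 < Num.min 1 r by rewrite lt_min ltr01.
have [k /andP[hk0]] := exists_dyadic h0 m0; rewrite lt_min => /andP[hk1 hkr].
have tE := dyadic_time h n k.
exists (mil (h / 2 ^+ k) (n * 2 ^ k)); split; first exact: mil_m.
  have := H (h / 2 ^+ k) (n * 2 ^ k)%N; rewrite hk0 hkr tE => /(_ isT nT).
  by apply: outer_le_sub => // w /=; rewrite distrC.
by apply: HK; rewrite ?hk0 ?tE// ltW.
Qed.

(** The distance to the scheme with step h / 2^k is bounded uniformly in k by [mil_refine]; Fatou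
    replaces that scheme by X. *)
Lemma mil_sde q (T : R) : 0 < T -> exists C h0 : R, [/\ 0 <= C, 0 < h0 <= 1 &
  forall (h : R) n, 0 < h <= h0 -> n%:R * h <= T ->
  (\int[P]_w ((mil h n w - X (n%:R * h) w) ^+ q.*2.+2)%:E <= (C * h ^+ q.*2.+2)%:E)%E].
Proof.
move=> T0; have [C [h0 [C0 h01 HC]]] := mil_refine hFt hB x0 cG cg q T.
exists (2 ^+ q.*2.+1 * C), h0; split => // [|h n hh nT]; first by rewrite mulr_ge0// exprn_ge0.
have h_gt0 : 0 < h by case/andP: hh.
rewrite -mulrA; apply: fatou_in_probability.
- by apply: measurable_funB; [exact: mil_m|apply: Xm; rewrite mulr_ge0// ltW].
- by rewrite mulr_ge0// exprn_ge0// ltW.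
move=> e a e0 a0.
have [r r0 H] := mil_sde_probability hFt hB hX cG cg GE gE T0 e0 a0.
have [k /andP[hk0 hkr]] := exists_dyadic h_gt0 r0.
have tE := dyadic_time h n k.
exists (fun w => mil h n w - mil (h / 2 ^+ k) (n * 2 ^ k) w); split.
- by apply: measurable_funB; exact: mil_m.
- have := H (h / 2 ^+ k) (n * 2 ^ k)%N; rewrite hk0 hkr tE => /(_ isT nT).
  apply: outer_le_sub => // w /=.
  rewrite (_ : _ - _ - _ = mil (h / 2 ^+ k) (n * 2 ^ k) w - X (n%:R * h) w)//; ring.
- exact: HC.
Qed.

Lemma esch_sde q (T : R) : 0 < T -> exists C h0 : R, [/\ 0 <= C, 0 < h0 <= 1 &
  forall (h : R) n, 0 < h <= h0 -> n%:R * h <= T ->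
  (\int[P]_w ((esch h n w - X (n%:R * h) w) ^+ q.*2.+2)%:E <= (C * h ^+ q.*2.+2)%:E)%E].
Proof.
move=> T0; have [C [h0 [C0 h01 HC]]] := mil_sde q T0.
have [C' [h0' [C0' h01' HC']]] := esch_mil hFt hB cG cg x00 q T.
have F0 : (0 : R) <= 2 ^+ q.*2.+1 by rewrite exprn_ge0.
exists (2 ^+ q.*2.+1 * (C' + C)), (Num.min h0 h0'); split.
- by rewrite mulr_ge0// addr_ge0.
- case/andP: h01 => h00 h01; case/andP: h01' => h00' _.
  by rewrite lt_min h00 h00' /= ge_min h01.
move=> h n /andP[h_gt0]; rewrite le_min => /andP[hh hh'] nT.
have mE : measurable_fun setT (esch h n) by exact: (esch_measurable hFt hB x0 cG cg).
have mM := mil_m n h_gt0; have mX : measurable_fun setT (X (n%:R * h)).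
  by apply: Xm; rewrite mulr_ge0// ltW.
have ev (x : R) : 0 <= x ^+ q.*2.+2 by rewrite -doubleS expr_dbl_ge0.
apply: (@int_le _ _ _ P _ (fun w => 2 ^+ q.*2.+1 *
   ((esch h n w - mil h n w) ^+ q.*2.+2 + (mil h n w - X (n%:R * h) w) ^+ q.*2.+2))) => //.
- by apply: measurable_funX; exact: measurable_funB.
- apply: measurable_funM => //; apply: measurable_funD; apply: measurable_funX; exact: measurable_funB.
- move=> w; apply: le_trans (powD_even_convex _ _ _).
  by rewrite addrA subrK.
rewrite -mulrA; apply: int_scale => //.
- by apply: measurable_funD; apply: measurable_funX; exact: measurable_funB.
- by move=> w; rewrite addr_ge0.
rewrite mulrDl; apply: int_add => //.
- by apply: measurable_funX; exact: measurable_funB.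
- by apply: measurable_funX; exact: measurable_funB.
- by apply: HC' => //; rewrite h_gt0.
- by apply: HC => //; rewrite h_gt0.
Qed.

End SolutionRate.

(** * Maxima, real exponents and roots *)

Section SupError.
Context d (Omega : measurableType d) (R : realType) (P : probability Omega R).

Lemma int_sum (f : nat -> Omega -> R) (c : R) n : (forall i, measurable_fun setT (f i)) ->
  (forall i w, 0 <= f i w) -> (forall i, (i < n)%N -> (\int[P]_w (f i w)%:E <= c%:E)%E) ->
  (\int[P]_w (\sum_(i < n) f i w)%:E <= (n%:R * c)%:E)%E.
Proof.
move=> mf f0; elim: n => [|n IH] fc.
  by rewrite mul0r; under eq_integral do rewrite big_ord0; rewrite integral0.
under eq_integral do rewrite big_ord_recr/=.
rewrite -natr1 mulrDl mul1r; apply: int_add => //.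
- by apply: measurable_sum => i.
- by move=> w; apply: sumr_ge0.
- by apply: IH => i i_n; apply: fc; exact: leqW.
- exact: fc.
Qed.

Lemma measurable_bigmax (f : nat -> Omega -> R) n : (forall i, measurable_fun setT (f i)) ->
  measurable_fun setT (fun w => \big[Num.max/0]_(i < n) f i w).
Proof.
elim: n f => [|n IH] f mf.
  by rewrite (_ : (fun w => _) = cst 0)//; apply/funext => w; rewrite big_ord0.
under eq_fun do rewrite big_ord_recl.
by apply: measurable_maxr; [exact: mf|exact: (IH (fun i => f i.+1))].
Qed.

Lemma bigmax_pow (a : nat -> R) n q :
  0 <= \big[Num.max/0]_(i < n) `|a i| /\
  (\big[Num.max/0]_(i < n) `|a i|) ^+ q.*2.+2 <= \sum_(i < n) a i ^+ q.*2.+2.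
Proof.
apply: (big_ind2 (fun x y : R => 0 <= x /\ x ^+ q.*2.+2 <= y)).
- by rewrite expr0n.
- move=> x1 y1 x2 y2 [x10 xy1] [x20 xy2]; split; first by rewrite le_max x10.
  have y10 : 0 <= y1 by apply: le_trans xy1; rewrite exprn_ge0.
  have y20 : 0 <= y2 by apply: le_trans xy2; rewrite exprn_ge0.
  by case: (leP x1 x2) => _; [rewrite ler_wpDl|rewrite ler_wpDr].
- by move=> i _; split => //; rewrite -doubleS expr_dbl_norm.
Qed.

Lemma powR_le_expr (x r : R) M : 0 <= x -> 0 <= r -> r <= M%:R -> x `^ r <= 1 + x ^+ M.
Proof.
move=> x0 r0 rM; have [x1|/ltW x1] := leP x 1.
  apply: (@le_trans _ _ 1); last by rewrite lerDl exprn_ge0.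
  have := @ge0_ler_powR R r r0 x 1; rewrite !nnegrE x0 ler01 powR1; exact.
by rewrite -powR_mulrn// (le_trans (ler_powR x1 rM))// lerDr.
Qed.

(** Passes from a real exponent to a larger integer one after normalisation by the expected size l,
    so that the scale l^r is not lost. *)
Lemma powR_scale (x l : R) (r : R) M : 0 <= x -> 0 < l -> 0 <= r -> r <= M%:R ->
  x `^ r <= l `^ r * (1 + (x / l) ^+ M).
Proof.
move=> x0 l0 r0 rM; have xl : 0 <= x / l by rewrite divr_ge0// ltW.
rewrite -{1}(divfK (lt0r_neq0 l0) x) mulrC powRM//; last exact: ltW.
by apply: ler_wpM2l; [exact: powR_ge0|exact: powR_le_expr].
Qed.

Lemma root_le (I : \bar R) (l D r : R) : (0 <= I)%E -> 0 <= l -> 1 <= D -> 1 <= r ->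
  (I <= (l `^ r * D)%:E)%E -> (I `^ r^-1 <= (D * l)%:E)%E.
Proof.
move=> I0 l0 D1 r1 H; have r0 : 0 < r by exact: lt_le_trans r1.
have D0 : 0 <= D by exact: le_trans D1.
have ri : 0 <= r^-1 by rewrite invr_ge0 ltW.
have lD : 0 <= l `^ r * D by rewrite mulr_ge0// powR_ge0.
apply: (@le_trans _ _ ((l `^ r * D)%:E `^ r^-1)%E).
  by apply: gt0_ler_poweR => //; rewrite in_itv/= leey ?andbT// lee_fin.
rewrite poweR_EFin lee_fin powRM ?powR_ge0// -powRrM mulfV ?gt_eqF// powRr1// mulrC.
by apply: ler_wpM2r => //; apply: ler1_powR => //; rewrite invf_le1.
Qed.

Lemma sum_inv_sqr n : \sum_(k < n) ((k.+1%:R : R) ^+ 2)^-1 <= 2.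
Proof.
(* Telescoping: 1 / k^2 <= 2 / k - 2 / (k + 1) for k >= 1. *)
suff : \sum_(k < n) ((k.+1%:R : R) ^+ 2)^-1 <= 2 - 2 * n.+1%:R^-1.
  by move=> /le_trans; apply; rewrite lerBlDr lerDl mulr_ge0// invr_ge0.
elim: n => [|n IH]; first by rewrite big_ord0 invr1 mulr1 subrr.
rewrite big_ord_recr/=; apply: (le_trans (lerD IH (lexx _))).
have n1 : (0 : R) < n.+1%:R by rewrite ltr0n.
have n11 : (1 : R) <= n.+1%:R by rewrite ler1n.
rewrite -(natr1 n.+1); move: (n.+1%:R : R) n1 n11 => x x0 x1.
have x10 : 0 < x + 1 by rewrite addr_gt0.
have : 2 * x^-1 - 2 * (x + 1)^-1 - (x ^+ 2)^-1 = (x - 1) / (x ^+ 2 * (x + 1)).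
  by field; rewrite !gt_eqF.
have : 0 <= (x - 1) / (x ^+ 2 * (x + 1)).
  by rewrite divr_ge0 ?subr_ge0// mulr_ge0 ?sqr_ge0// ltW.
move: (x ^+ 2)^-1 x^-1 (x + 1)^-1 ((x - 1) / _) => u1 u2 u3 u4; lra.
Qed.

End SupError.

(** * Moments of the maximal error *)

Section ErrorBounds.
Context d (Omega : measurableType d) (R : realType) (P : probability Omega R).
Variables (Ft : R -> set (set Omega)) (B : R -> Omega -> R).
Hypotheses (hFt : is_filtration Ft) (hB : is_wiener P Ft B).
Variables (G g Ge G1 ge g1 : R -> R) (L x0 : R) (X : R -> Omega -> R).
Hypothesis hX : is_sde_solution P Ft B G g x0 X.
Hypotheses (cG : smooth_coef L Ge G1) (cg : smooth_coef L ge g1).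
Hypotheses (GE : forall x : R, 0 <= x -> Ge x = G x) (gE : forall x : R, 0 <= x -> ge x = g x).
Hypothesis x00 : 0 <= x0.
Hypothesis schemeE : forall h n w, scheme G g B x0 h n w = esch Ge ge g1 B x0 h n w.

Local Notation esch := (esch Ge ge g1 B x0).
Local Notation err := (sup_error G g B x0 X).

Let errE (T : R) N w : err T N w =
  \big[Num.max/0]_(n < N.+1) `|esch (T / N%:R) n w - X (n%:R * (T / N%:R)) w|.
Proof. by apply: eq_bigr => n _; rewrite schemeE. Qed.

Let step_gt0 (T : R) N : 0 < T -> (0 < N)%N -> 0 < T / N%:R.
Proof. by move=> T0 N0; rewrite divr_gt0// ltr0n. Qed.

Let diff_m (h : R) n : 0 < h -> measurable_fun setT (fun w => esch h n w - X (n%:R * h) w).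
Proof.
move=> h0; apply: measurable_funB; first exact: (esch_measurable hFt hB x0 cG cg).
by apply: (sde_measurable hFt hX); rewrite mulr_ge0// ltW.
Qed.

Lemma sup_error_ge0 T N w : 0 <= err T N w.
Proof. by rewrite errE; case: (bigmax_pow (fun n => esch (T / N%:R) n w - X (n%:R * (T / N%:R)) w) N.+1 0). Qed.

Lemma sup_error_measurable T N : 0 < T -> (0 < N)%N -> measurable_fun setT (err T N).
Proof.
move=> T0 N0; rewrite (funext (errE T N)).
apply: (measurable_bigmax (f := fun n w => `|esch (T / N%:R) n w - X (n%:R * (T / N%:R)) w|)) => n.
by apply: measurableT_comp => //; apply: diff_m; exact: step_gt0.
Qed.

Lemma sup_error_moment q (T c : R) N : 0 < T -> (0 < N)%N ->
  (forall n, (n <= N)%N ->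
    (\int[P]_w ((esch (T / N%:R) n w - X (n%:R * (T / N%:R)) w) ^+ q.*2.+2)%:E <= c%:E)%E) ->
  (\int[P]_w (err T N w ^+ q.*2.+2)%:E <= (N.+1%:R * c)%:E)%E.
Proof.
move=> T0 N0 H; have h0 := step_gt0 T0 N0.
have mD n : measurable_fun setT (fun w => (esch (T / N%:R) n w - X (n%:R * (T / N%:R)) w) ^+ q.*2.+2).
  by apply: measurable_funX; exact: diff_m.
have ev (x : R) : 0 <= x ^+ q.*2.+2 by rewrite -doubleS expr_dbl_ge0.
apply: (@int_le _ _ _ P _ (fun w => \sum_(n < N.+1) (esch (T / N%:R) n w - X (n%:R * (T / N%:R)) w) ^+ q.*2.+2)) => //.
- by apply: measurable_funX; exact: sup_error_measurable.
- by apply: measurable_sum => n.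
- by move=> w; rewrite errE; case: (bigmax_pow (fun n => esch (T / N%:R) n w - X (n%:R * (T / N%:R)) w) N.+1 q).
by apply: (int_sum (f := fun n w => (esch (T / N%:R) n w - X (n%:R * (T / N%:R)) w) ^+ q.*2.+2)).
Qed.

Let grid (T : R) N n : 0 <= T -> (0 < N)%N -> (n <= N)%N -> n%:R * (T / N%:R) <= T.
Proof.
move=> T0 N0 nN; rewrite mulrCA ler_piMr// ler_pdivrMr ?ltr0n// mul1r ler_nat//.
Qed.

(** The maximum is bounded by the sum over the N.+1 grid points; as (N + 1) T / N <= 2 T, this costs
    exactly one power of the step. *)
Lemma sup_error_fine q (T : R) : 0 < T -> exists C h0 : R, [/\ 0 <= C, 0 < h0 <= 1 &
  forall N, (0 < N)%N -> T / N%:R <= h0 ->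
  (\int[P]_w (err T N w ^+ q.*2.+2)%:E <= (C * (T / N%:R) ^+ q.*2.+1)%:E)%E].
Proof.
move=> T0; have [C [h0 [C0 h01 H]]] := esch_sde hFt hB hX cG cg GE gE x00 q T0.
exists (2 * T * C), h0; split => // [|N N0 Nh]; first by rewrite !mulr_ge0// ltW.
have h_gt0 := step_gt0 T0 N0.
have hh : 0 < T / N%:R <= h0 by rewrite h_gt0.
have E n (nN : (n <= N)%N) := H (T / N%:R) n hh (grid (ltW T0) N0 nN).
apply: (le_trans (sup_error_moment T0 N0 E)); rewrite lee_fin.
have -> : N.+1%:R * (C * (T / N%:R) ^+ q.*2.+2) = (N.+1%:R * (T / N%:R)) * (C * (T / N%:R) ^+ q.*2.+1).
  by rewrite exprS; ring.
rewrite -[leRHS]mulrA; apply: ler_wpM2r; first by rewrite mulr_ge0// exprn_ge0// ltW.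
rewrite mulrCA [leRHS]mulrC ler_pM2l// ler_pdivrMr ?ltr0n//.
by rewrite -natrM ler_nat mul2n -addnn -addn1 leq_add2l.
Qed.

(** A bound without rate whose threshold is fixed before T; it covers the steps between the
    threshold of [sup_error_fine], chosen after T, and this one. *)
Lemma sup_error_coarse q : exists2 h0 : R, 0 < h0 < 1 & forall T : R, 0 < T -> exists2 K : R, 0 <= K &
  forall N, (0 < N)%N -> T / N%:R <= h0 ->
  (\int[P]_w (err T N w ^+ q.*2.+2)%:E <= (N.+1%:R * K)%:E)%E.
Proof.
have [h0 h01 H] := esch_moment hFt hB cG cg x00 q; exists h0 => // T T0.
have [K1 K10 H1] := H T; have [K2 K20 H2] := sde_moment hFt hB hX cG cg GE gE q T0.
have F0 : (0 : R) <= 2 ^+ q.*2.+1 by rewrite exprn_ge0.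
exists (2 ^+ q.*2.+1 * (K1 + K2)) => [|N N0 Nh]; first by rewrite mulr_ge0// addr_ge0.
have h_gt0 := step_gt0 T0 N0.
apply: sup_error_moment => // n nN; have nT := grid (ltW T0) N0 nN.
have mE : measurable_fun setT (esch (T / N%:R) n) by exact: (esch_measurable hFt hB x0 cG cg).
have mX : measurable_fun setT (X (n%:R * (T / N%:R))).
  by apply: (sde_measurable hFt hX); rewrite mulr_ge0// ltW.
have ev (x : R) : 0 <= x ^+ q.*2.+2 by rewrite -doubleS expr_dbl_ge0.
have m1 : measurable_fun setT (fun w => esch (T / N%:R) n w ^+ q.*2.+2) by exact: measurable_funX.
have m2 : measurable_fun setT (fun w => X (n%:R * (T / N%:R)) w ^+ q.*2.+2) by exact: measurable_funX.
apply: (@int_le _ _ _ P _ (fun w => 2 ^+ q.*2.+1 *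
   (esch (T / N%:R) n w ^+ q.*2.+2 + X (n%:R * (T / N%:R)) w ^+ q.*2.+2))) => //.
- by apply: measurable_funX; exact: diff_m.
- by apply: measurable_funM => //; exact: measurable_funD.
- move=> w; apply: (le_trans (powD_even_convex _ _ _)).
  by rewrite -!doubleS -(expr_dbl_norm (- _)) normrN expr_dbl_norm.
apply: int_scale => //.
- exact: measurable_funD.
- by move=> w; rewrite addr_ge0.
apply: int_add => //; first by apply: H1 => //; rewrite h_gt0.
exact: H2.
Qed.

(** Here epsilon is spent: after division by the step to the power 1 - eps, the exponent left is
    (2q+2) eps - 1, at least s for q large. *)
Lemma sup_error_scaled q s (eps T C h0 : R) N : 0 < T -> (0 < N)%N -> 0 < eps -> 0 <= C -> h0 <= 1 ->
  s.+1%:R <= q.*2.+2%:R * eps -> T / N%:R <= h0 ->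
  (\int[P]_w (err T N w ^+ q.*2.+2)%:E <= (C * (T / N%:R) ^+ q.*2.+1)%:E)%E ->
  (\int[P]_w ((err T N w / (T / N%:R) `^ (1 - eps)) ^+ q.*2.+2)%:E <= (C * (T / N%:R) ^+ s)%:E)%E.
Proof.
move=> T0 N0 e0 C0 h01 se Nh H; have := step_gt0 T0 N0; move: (T / N%:R) Nh H => h hh H h_gt0.
have l0 : 0 < h `^ (1 - eps) by exact: powR_gt0.
under eq_integral do rewrite exprMn mulrC.
have mE : measurable_fun setT (fun w => err T N w ^+ q.*2.+2).
  by apply: measurable_funX; exact: sup_error_measurable.
have ev w : 0 <= err T N w ^+ q.*2.+2 by rewrite exprn_ge0// sup_error_ge0.
have il : 0 <= ((h `^ (1 - eps))^-1) ^+ q.*2.+2 by rewrite exprn_ge0// invr_ge0 ltW.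
apply: (le_trans (int_scale mE ev il H)); rewrite lee_fin mulrCA; apply: ler_wpM2l => //.
rewrite exprVn mulrC ler_pdivrMr ?exprn_gt0//.
rewrite -!powR_mulrn ?powR_ge0 ?(ltW h_gt0)// -powRrM -powRD; last first.
  by apply/implyP => _; rewrite gt_eqF.
apply: ger_powR; first by rewrite h_gt0 (le_trans hh).
rewrite mulrBl mul1r (mulrC eps); move: se; rewrite -(natr1 s) -(natr1 q.*2.+1).
move: (q.*2.+1%:R : R) (s%:R : R) => a b; lra.
Qed.

End ErrorBounds.

(** * Strong and almost sure rates *)

Section Conclusions.

Lemma leq_double2 n : (n <= n.*2.+2)%N.
Proof. by rewrite -addnn; apply/leqW/leqW/leq_addr. Qed.

Context d (Omega : measurableType d) (R : realType) (P : probability Omega R).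
Variables (Ft : R -> set (set Omega)) (B : R -> Omega -> R).
Hypotheses (hFt : is_filtration Ft) (hB : is_wiener P Ft B).
Variables (G g Ge G1 ge g1 : R -> R) (L x0 : R) (X : R -> Omega -> R).
Hypothesis hX : is_sde_solution P Ft B G g x0 X.
Hypotheses (cG : smooth_coef L Ge G1) (cg : smooth_coef L ge g1).
Hypotheses (GE : forall x : R, 0 <= x -> Ge x = G x) (gE : forall x : R, 0 <= x -> ge x = g x).
Hypothesis x00 : 0 <= x0.
Hypothesis schemeE : forall h n w, scheme G g B x0 h n w = esch Ge ge g1 B x0 h n w.

Local Notation err := (sup_error G g B x0 X).

Let errm T N : 0 < T -> (0 < N)%N -> measurable_fun setT (err T N).
Proof. exact: (sup_error_measurable hFt hB hX cG cg schemeE). Qed.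

Let err0 T N w : 0 <= err T N w.
Proof. exact: (sup_error_ge0 _ schemeE). Qed.

(** Below a threshold h1 depending on eps and T, the scaled moment bound is raised to a root.
    Between h1 and [taup] the number of grid points is bounded, so the coarse bound suffices, and
    the rate is bounded below by h1^(1 - eps). *)
Lemma strong_error (p : R) : 1 <= p ->
  exists taup : R, 0 < taup < 1 /\
    forall eps T : R, 0 < eps < 1 -> 0 < T ->
      exists C : R, 0 < C /\
        forall N : nat, (0 < N)%N -> T / N%:R <= taup ->
          ('E_P[fun w => (err T N w `^ (2 * p))%R]
             `^ (2 * p)^-1 <= (C * (T / N%:R) `^ (1 - eps))%:E)%E.
Proof.
move=> p1; pose r := 2 * p; have r1 : 1 <= r by rewrite /r; lra.
have r0 : 0 <= r by exact: le_trans r1.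
have boundP (x : R) : 0 <= x -> x <= (Num.bound x)%:R by move=> /archi_boundP/ltW.
pose q := Num.bound r.
have rq : r <= q.*2.+2%:R.
  by apply: (le_trans (boundP _ r0)); rewrite ler_nat leq_double2.
have [taup taup01 HK] := sup_error_coarse hFt hB hX cG cg GE gE x00 schemeE q.
exists taup; split => // eps T /andP[e0 e1] T0.
have [K K0 {}HK] := HK T T0.
have ei : 0 <= eps^-1 by rewrite invr_ge0 ltW.
(* Large enough for both 2 p <= 2q' + 2 and (2q' + 2) eps >= 1. *)
pose q' := (Num.bound r + Num.bound eps^-1)%N.
have rq' : r <= q'.*2.+2%:R.
  apply: (le_trans rq); rewrite ler_nat !ltnS leq_double; exact: leq_addr.
have eq' : 1 <= q'.*2.+2%:R * eps.
  rewrite -ler_pdivrMr// div1r (le_trans (boundP _ ei))// ler_nat.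
  exact: leq_trans (leq_addl (Num.bound r) _) (leq_double2 _).
have [C [h1 [C0 /andP[h10 h11] HC]]] := sup_error_fine hFt hB hX cG cg GE gE x00 schemeE q' T0.
(* A step above h1 means N < T / h1, which bounds the factor N.+1 of the coarse estimate. *)
pose D := 1 + (T / h1 + 1) * K.
have D1 : 1 <= D by rewrite lerDl mulr_ge0// addr_ge0// divr_ge0// ltW.
pose c := h1 `^ (1 - eps); have c0 : 0 < c by exact: powR_gt0.
have C1 : 1 <= 1 + C by rewrite lerDl.
have Dc : 0 <= D / c by rewrite divr_ge0 ?(le_trans ler01 D1)// ltW.
exists (1 + C + D / c); split; first by rewrite ltr_pwDl// ?(lt_le_trans ltr01 C1).
move=> N N0 Ntau; have h0 : 0 < T / N%:R by rewrite divr_gt0// ltr0n.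
have me := errm T0 N0.
have mr : measurable_fun setT (fun w => err T N w `^ r).
  exact: (measurableT_comp (measurable_powR r) me).
have I0 : (0 <= \int[P]_w (err T N w `^ r)%:E)%E.
  by apply: integral_ge0 => w _; rewrite lee_fin powR_ge0.
rewrite unlock -/r.
have l0 : 0 < (T / N%:R) `^ (1 - eps) by exact: powR_gt0.
have [Nh|Nh] := leP (T / N%:R) h1.
  apply: (@le_trans _ _ ((1 + C) * (T / N%:R) `^ (1 - eps))%:E); last first.
    by rewrite lee_fin ler_wpM2r ?(ltW l0)// lerDl.
  apply: root_le => //; first exact: ltW.
  have ms : measurable_fun setT (fun w => (err T N w / (T / N%:R) `^ (1 - eps)) ^+ q'.*2.+2).
    by apply: measurable_funX; exact: measurable_funM.
  have s0 w : 0 <= (err T N w / (T / N%:R) `^ (1 - eps)) ^+ q'.*2.+2.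
    by rewrite exprn_ge0// divr_ge0// ltW.
  have E := sup_error_scaled hFt hB hX cG cg schemeE (s := 0%N) T0 N0 e0 C0 h11 eq' Nh (HC N N0 Nh).
  rewrite expr0 mulr1 in E.
  apply: (@int_le _ _ _ P _ (fun w => ((T / N%:R) `^ (1 - eps)) `^ r *
     (1 + (err T N w / (T / N%:R) `^ (1 - eps)) ^+ q'.*2.+2))) => //.
  - by apply: measurable_funM => //; exact: measurable_funD.
  - by move=> w; exact: powR_ge0.
  - by move=> w; apply: powR_scale.
  apply: int_scale; [exact: measurable_funD|by move=> w; rewrite addr_ge0|exact: powR_ge0|].
  by apply: int_add => //; rewrite int_cst.
apply: (@le_trans _ _ (D * 1)%:E).
  apply: root_le => //; rewrite powR1 mul1r.
  have mM : measurable_fun setT (fun w => err T N w ^+ q.*2.+2) by exact: measurable_funX.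
  have M0 w : 0 <= err T N w ^+ q.*2.+2 by exact: exprn_ge0.
  apply: (@int_le _ _ _ P _ (fun w => 1 + err T N w ^+ q.*2.+2)) => //.
  - exact: measurable_funD.
  - by move=> w; exact: powR_ge0.
  - by move=> w; exact: powR_le_expr.
  apply: int_add => //; first by rewrite int_cst.
  apply: (le_trans (HK N N0 Ntau)); rewrite lee_fin; apply: ler_wpM2r => //.
  rewrite -natr1 lerD2r ler_pdivlMr//.
  move: Nh; rewrite ltr_pdivlMr ?ltr0n// mulrC; exact: ltW.
rewrite lee_fin mulr1.
have cl : c <= (T / N%:R) `^ (1 - eps).
  by apply: ge0_ler_powR; rewrite ?nnegrE ?subr_ge0 ?(ltW e1) ?(ltW h10) ?(ltW h0) ?(ltW Nh).
apply: (@le_trans _ _ (D / c * (T / N%:R) `^ (1 - eps))).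
  apply: (@le_trans _ _ (D / c * c)); first by rewrite divfK// gt_eqF.
  exact: ler_wpM2l.
by apply: ler_wpM2r; [exact: ltW|rewrite lerDr (le_trans ler01)].
Qed.

(** Borel-Cantelli in summed form: with (2q+2) eps >= 3 the moments of the scaled errors are O(1 /
    N^2), so the series of their powers has finite mean and is almost surely finite. It dominates
    every term, and the finitely many coarse steps are added separately. *)
Lemma pathwise_error (eps T : R) : 0 < eps < 1 -> 0 < T ->
  exists M : Omega -> \bar R,
    [/\ measurable_fun setT M,
        {ae P, forall w, M w \is a fin_num} &
        {ae P, forall w, forall N : nat, (0 < N)%N ->
          ((err T N w)%:E <= M w * ((T / N%:R) `^ (1 - eps))%:E)%E}].
Proof.
move=> /andP[e0 e1] T0.
have boundP (x : R) : 0 <= x -> x <= (Num.bound x)%:R by move=> /archi_boundP/ltW.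
have ei : 0 <= 3 / eps by rewrite divr_ge0// ltW.
pose q := Num.bound (3 / eps).
have eq3 : 3%:R <= q.*2.+2%:R * eps.
  rewrite -ler_pdivrMr// (le_trans (boundP _ ei))// ler_nat.
  exact: leq_double2.
have [C [h0 [C0 /andP[h00 h01] HC]]] := sup_error_fine hFt hB hX cG cg GE gE x00 schemeE q T0.
pose k0 := Num.bound (T / h0).
have k0P k : (k0 <= k)%N -> T / k.+1%:R <= h0.
  move=> kk; rewrite ler_pdivrMr ?ltr0n// mulrC -ler_pdivrMr//.
  by apply: (le_trans (boundP _ _)); [rewrite divr_ge0// ltW|rewrite ler_nat leqW].
pose lam k := (T / k.+1%:R) `^ (1 - eps).
have t0 k : 0 < T / k.+1%:R by rewrite divr_gt0// ltr0n.
have lam0 k : 0 < lam k by exact: powR_gt0.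
pose x k w := err T k.+1 w / lam k.
have x0' k w : 0 <= x k w by rewrite divr_ge0// ltW.
have mx k : measurable_fun setT (x k) by apply: measurable_funM => //; exact: errm.
(* The index k stands for N = k.+1. The first k0 terms, where the step may exceed h0, are left out
   of the series and enter M directly. *)
pose y k w := if (k < k0)%N then 0 else x k w ^+ q.*2.+2.
have y0 k w : 0 <= y k w by rewrite /y; case: ifP => // _; exact: exprn_ge0.
have my k : measurable_fun setT (y k).
  by rewrite /y; case: (k < k0)%N => //; exact: measurable_funX.
have Ey k : (\int[P]_w (y k w)%:E <= (C * T ^+ 2 * (k.+1%:R ^+ 2)^-1)%:E)%E.
  rewrite /y; case: (ltnP k k0) => kk.
    by rewrite integral0 lee_fin; apply: mulr_ge0; [apply: mulr_ge0 => //; exact: sqr_ge0|rewrite invr_ge0 sqr_ge0].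
  have kh := k0P k kk.
  have := sup_error_scaled hFt hB hX cG cg schemeE (s := 2) T0 (ltn0Sn k) e0 C0 h01 eq3 kh (HC k.+1 (ltn0Sn k) kh).
  by rewrite exprMn exprVn mulrA.
pose W w : \bar R := (\sum_(k <oo) (y k w)%:E)%E.
have W0 w : (0 <= W w)%E by apply: nneseries_ge0 => k _ _; rewrite lee_fin.
have mW : measurable_fun setT W.
  apply: ge0_emeasurable_sum => [k w _ _|k _]; [by rewrite lee_fin|exact/measurable_EFinP].
have EW : (\int[P]_w W w <= (C * T ^+ 2 * 2)%:E)%E.
  have mEy k : measurable_fun setT (fun w => (y k w)%:E) by exact/measurable_EFinP.
  have Ey0 k w : setT w -> (0 <= (y k w)%:E)%E by rewrite lee_fin.
  rewrite (integral_nneseries P measurableT mEy Ey0).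
  apply: lime_le; first by apply: is_cvg_nneseries => k _ _; apply: integral_ge0 => w _; rewrite lee_fin.
  apply: nearW => n; apply: (@le_trans _ _ (\sum_(k < n) (C * T ^+ 2 * (k.+1%:R ^+ 2)^-1))%:E).
    by rewrite big_mkord -sumEFin; apply: lee_sum => k _; exact: Ey.
  by rewrite lee_fin -mulr_sumr ler_wpM2l ?sum_inv_sqr// mulr_ge0// sqr_ge0.
have iW : P.-integrable setT W.
  apply/integrableP; split => //; under eq_integral do rewrite gee0_abs//.
  by apply: le_lt_trans EW _; rewrite ltry.
exists (fun w => ((1 + \sum_(k < k0) x k w)%:E + W w)%E); split.
- apply: emeasurable_funD => //; apply/measurable_EFinP; apply: measurable_funD => //.
  by apply: measurable_sum => k.
- have := integrable_ae measurableT iW; apply: filterS => w /(_ I) Wf.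
  by rewrite fin_numD Wf.
apply: aeW => w [//|k] _; rewrite -/(lam k).
have -> : ((err T k.+1 w)%:E = (x k w)%:E * (lam k)%:E)%E by rewrite -EFinM divfK// gt_eqF.
apply: lee_wpmul2r; first by rewrite lee_fin ltW.
have sx0 : 0 <= \sum_(k < k0) x k w by apply: sumr_ge0 => j _.
have [kk|kk] := ltnP k k0.
  apply: (@le_trans _ _ (1 + \sum_(k < k0) x k w)%:E); last by rewrite leeDl.
  rewrite lee_fin (bigD1 (Ordinal kk))//= addrCA lerDl addr_ge0//.
  by apply: sumr_ge0 => j _.
(* The constant 1 in M pays for x <= 1 + x^(2q+2). *)
apply: (@le_trans _ _ (1 + y k w)%:E).
  rewrite lee_fin /y ltnNge kk /=; have := powR_le_expr (M := q.*2.+2) (x0' k w) ler01.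
  by rewrite powRr1//; apply; rewrite ler1n.
rewrite !EFinD; apply: leeD.
  by rewrite -EFinD lee_fin lerDl.
have h : (\sum_(0 <= j < k.+1) (y j w)%:E <= W w)%E.
  by apply: nneseries_lim_ge => j _ _; rewrite lee_fin.
apply: le_trans h; rewrite big_nat_recr//= leeDr// sume_ge0// => j _.
by rewrite lee_fin.
Qed.

End Conclusions.

Theorem corollary7 (d : measure_display) (Omega : measurableType d)
    (R : realType) (P : probability Omega R)
    (Ft : R -> set (set Omega)) (B : R -> Omega -> R)
    (G g : R -> R) (x0 : R) (X : R -> Omega -> R)
    (hFt : is_filtration Ft) (hB : is_wiener P Ft B)
    (hx0 : 0 <= x0)
    (hG : hl_C2 G) (hg : hl_C2 g)
    (hG1 : hl_bounded (hl_derive G)) (hG2 : hl_bounded (hl_derive (hl_derive G)))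
    (hg1 : hl_bounded (hl_derive g)) (hg2 : hl_bounded (hl_derive (hl_derive g)))
    (hG0 : G 0 = 0) (hg0 : g 0 = 0)
    (hX : is_sde_solution P Ft B G g x0 X) :
  (forall p : R, 1 <= p ->
    exists taup : R, 0 < taup < 1 /\
      forall eps T : R, 0 < eps < 1 -> 0 < T ->
        exists C : R, 0 < C /\
          forall N : nat, (0 < N)%N -> T / N%:R <= taup ->
            ('E_P[fun w => (sup_error G g B x0 X T N w `^ (2 * p))%R]
               `^ (2 * p)^-1 <= (C * (T / N%:R) `^ (1 - eps))%:E)%E)
  /\
  (forall eps T : R, 0 < eps < 1 -> 0 < T ->
    exists M : Omega -> \bar R,
      [/\ measurable_fun setT M,
          {ae P, forall w, M w \is a fin_num} &
          {ae P, forall w, forall N : nat, (0 < N)%N ->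
            ((sup_error G g B x0 X T N w)%:E
               <= M w * ((T / N%:R) `^ (1 - eps))%:E)%E}]).
Proof.
have [MG1 bG1] := hG1; have [MG2 bG2] := hG2; have [Mg1 bg1] := hg1; have [Mg2 bg2] := hg2.
have n1 := normr_ge0 MG1; have n2 := normr_ge0 MG2.
have n3 := normr_ge0 Mg1; have n4 := normr_ge0 Mg2.
have l1 := ler_norm MG1; have l2 := ler_norm MG2; have l3 := ler_norm Mg1; have l4 := ler_norm Mg2.
(* One constant for G and g: at least 1, both bounds on first derivatives and twice those on second
   derivatives. *)
pose L := 1 + `|MG1| + 2 * `|MG2| + `|Mg1| + 2 * `|Mg2|.
have cG : smooth_coef L (hl_ext G) (hl_ext1 G).
  by apply: (hl_smooth_coef hG hG0 bG1 bG2); rewrite /L; lra.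
have cg : smooth_coef L (hl_ext g) (hl_ext1 g).
  by apply: (hl_smooth_coef hg hg0 bg1 bg2); rewrite /L; lra.
have ext h (y : R) : 0 <= y -> hl_ext h y = h y by rewrite /hl_ext => ->.
have sE t n w : scheme G g B x0 t n w = esch (hl_ext G) (hl_ext g) (hl_ext1 g) B x0 t n w.
  by apply: (scheme_esch (LG := L) (Lg := L)) => //; [case: hG => [[]]|case: hg => [[]]].
split.
- exact: (strong_error hFt hB hX cG cg (ext G) (ext g) hx0 sE).
- exact: (pathwise_error hFt hB hX cG cg (ext G) (ext g) hx0 sE).
Qed.
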